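(* Consider the opinion dynamics on $V=(\mathbf{1}_{N_o}^{\perp})^{N_a}$ given by $$\dot{\boldsymbol Z}_i=P_0\boldsymbol F_i(\boldsymbol Z),\qquad F_{ij}(\boldsymbol Z)=-d z_{ij}+u\Big(S_1\Big(\alpha z_{ij}+\sum_{k\ne i}\gamma_{ik}z_{kj}\Big)+\sum_{l\neq j}S_2\Big(\beta z_{il}+\sum_{k\neq i}\delta_{ik}z_{kl}\Big)\Big),$$ for $i=1,\dots,N_a$, $j=1,\dots,N_o$ (that is, with inputs $b_{ij}=0$ and with $d_i=d$, $u_i=u$, $\alpha_i=\alpha$, $\beta_i=\beta$ for all agents). Let $J$ be the Jacobian of the system evaluated at the neutral equilibrium $\boldsymbol Z=0$. Let $\lambda$ be the eigenvalue of $\Gamma-\Delta$ with largest real part, where $\Gamma=[\gamma_{ik}]$, $\Delta=[\delta_{ik}]\in\mathbb{R}^{N_a\times N_a}$. Assume that $\lambda$ is real, that $\alpha-\beta+\lambda>0$, and that $\operatorname{Re}[\mu]\ne\lambda$ for any eigenvalue $\mu\neq\lambda$ of $\Gamma-\Delta$. Then $\boldsymbol Z=0$ is locally exponentially stable for $0<u<u^*$, with $$u^*=\frac{d}{\alpha-\beta+\lambda},$$ and unstable for $u>u^*$. If $\lambda$ is simple, then at $u=u^*$ an opinion-forming steady-state bifurcation happens along $\ker J=\mathbb{R}\{\mathbf v^*\}\otimes\mathbf 1_{N_o}^{\perp}$, where $\mathbf v^*$ is the right unit eigenvector of $\Gamma-\Delta$ associated to $\lambda$. More precisely, generically, for each bifurcation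 branch there exists $\mathbf v_{ax}\in\mathbf 1_{N_o}^\perp$ such that the branch is tangent at $\boldsymbol Z=0$ to the one-dimensional subspace $\mathbb R\{\mathbf v^*\otimes\mathbf v_{ax}\}$.
   Context: There are $N_a$ agents and $N_o$ options. $\mathbf 1_{N_o}\in\mathbb R^{N_o}$ is the vector of ones, $\mathbf 1_{N_o}^\perp$ its orthogonal complement, and $P_0=\mathcal I_{N_o}-\frac1{N_o}\mathbf 1_{N_o}\mathbf 1_{N_o}^T$ the orthogonal projection onto $\mathbf 1_{N_o}^\perp$. The opinion of agent $i$ is $\boldsymbol Z_i=(z_{i1},\dots,z_{iN_o})\in\mathbf 1_{N_o}^\perp$; the system state is $\boldsymbol Z=(\boldsymbol Z_1,\dots,\boldsymbol Z_{N_a})\in V$; $\boldsymbol F_i=(F_{i1},\dots,F_{iN_o})$. The origin $\boldsymbol Z=0$ is the neutral point. The parameter $d>0$ is the resistance and $u\ge0$ the attention; $u$ is the bifurcation parameter. The parameters $\alpha\geq 0$, $\beta$, $\gamma_{ik}$, $\delta_{ik}$ ($i\ne k$) are real, and $\Gamma,\Delta$ have zero diagonal. For $q\in\{1,2\}$, $S_q:\mathbb R\to[-k_{q1},k_{q2}]$ with $k_{q1},k_{q2}>0$ is a generic sigmoidal saturating function with $S_q(0)=0$, $S_q'(0)=1$, $S_q''(0)\neq0$, $S_q'''(0)\ne0$. $\mathbb R\{\mathbf v_1,\dots,\mathbf v_k\}$ denotes the linear span, $\otimes$ the Kronecker product. $J$ is regarded as a linear map on $V$. An opinion-forming steady-state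 bifurcation is a steady-state bifurcation from the neutral equilibrium $\boldsymbol Z=0$ at which branches of nonzero equilibria emerge from $\boldsymbol Z=0$; ''along $\ker J$'' means that $\ker J$ is the kernel of the Jacobian at the bifurcation point. *)

(* Defs.v *)
From HB Require Import structures.
From mathcomp Require Import all_boot all_order all_algebra complex.
From mathcomp Require Import all_classical all_reals all_analysis.

Set Implicit Arguments.
Unset Strict Implicit.
Unset Printing Implicit Defensive.

Import Order.TTheory GRing.Theory Num.Theory.
Import numFieldNormedType.Exports.

Local Open Scope classical_set_scope.
Local Open Scope ring_scope.

(* A state Z = (Z_1, ..., Z_Na) is the Na x No matrix whose i-th row is Z_i.
   Under this identification v (x) y is the matrix (v_i y_j)_(i, j), that is the
   product [v *m y] of the column v and the row y. *)

Section StateSpace.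
Variables (R : realType) (Na No : nat).

Definition ones : 'cV[R]_No := const_mx 1.

Definition ones_perp : set 'rV[R]_No := [set y | y *m ones = 0].

Definition P0 : 'M[R]_No := 1%:M - No%:R^-1 *: (ones *m ones^T).

Definition V : set 'M[R]_(Na, No) := [set Z | forall i, ones_perp (row i Z)].

Definition line (v : 'cV[R]_Na) : set 'cV[R]_Na :=
  [set x | exists c : R, x = c *: v].

(* Tensor product of a line L with a subspace W; since L has dimension at most
   one, the elementary tensors already form a subspace. *)
Definition tens_line (L : set 'cV[R]_Na) (W : set 'rV[R]_No) :
  set 'M[R]_(Na, No) := [set X | exists x y, [/\ L x, W y & X = x *m y]].

End StateSpace.

Arguments V {R Na No}.
Arguments ones_perp {R No}.

Section Sigmoid.
Variable R : realType.

(* Sigmoidal saturating function with lower and upper saturation levels -k1 and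
   k2, regular enough (C^3) for its first three derivatives to be used. *)
Definition sigmoid (k1 k2 : R) (S : R -> R) : Prop :=
  [/\ 0 < k1 /\ 0 < k2,
      forall x, - k1 <= S x <= k2,
      {homo S : x y / x <= y},
      (S x @[x --> -oo] --> - k1) /\ (S x @[x --> +oo] --> k2) &
  [/\ (forall (n : nat) (x : R), (n < 3)%N -> derivable (derive1n n S) x 1),
      continuous (derive1n 3 S),
      S 0 = 0 /\ derive1n 1 S 0 = 1 &
      derive1n 2 S 0 != 0 /\ derive1n 3 S 0 != 0]].

End Sigmoid.

Section ModelParams.
Variables (R : realType) (Na : nat).

(* (d, alpha, beta, Gamma, Delta); a product type, so as to carry the product
   topology. *)
Definition params : Type := (R * R * R * 'M[R]_Na * 'M[R]_Na)%type.

Definition pd (p : params) : R := p.1.1.1.1.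
Definition palpha (p : params) : R := p.1.1.1.2.
Definition pbeta (p : params) : R := p.1.1.2.
Definition pGamma (p : params) : 'M[R]_Na := p.1.2.
Definition pDelta (p : params) : 'M[R]_Na := p.2.

Definition complex_eigenvalue (M : 'M[R]_Na) (mu : R[i]) : Prop :=
  eigenvalue (map_mx (real_complex R) M) mu.

Definition real_leading_eigenvalue (M : 'M[R]_Na) (lam : R) : Prop :=
  [/\ complex_eigenvalue M (real_complex R lam),
      forall mu, complex_eigenvalue M mu -> complex.Re mu <= lam &
      forall mu, complex_eigenvalue M mu -> mu != real_complex R lam ->
        complex.Re mu != lam].

Definition simple_eigenvalue (M : 'M[R]_Na) (lam : R) : Prop :=
  mup lam (char_poly M) = 1%N.

Definition right_unit_eigenvector (M : 'M[R]_Na) (lam : R) (v : 'cV[R]_Na) :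
  Prop := M *m v = lam *: v /\ \sum_(i < Na) v i 0 ^+ 2 = 1.

Definition admissible (p : params) (lam : R) : Prop :=
  [/\ 0 < pd p /\ 0 <= palpha p,
      (forall i, pGamma p i i = 0) /\ (forall i, pDelta p i i = 0),
      real_leading_eigenvalue (pGamma p - pDelta p) lam &
      0 < palpha p - pbeta p + lam].

Definition ustar (p : params) (lam : R) : R :=
  pd p / (palpha p - pbeta p + lam).

(* P holds for all members of A in a relatively open and dense subset of A. *)
Definition generically (A P : set params) : Prop :=
  exists U : set params,
    [/\ open U, A `<=` closure (A `&` U) & A `&` U `<=` P].

End ModelParams.

Section Dynamics.
Variables (R : realType) (Na No : nat) (S1 S2 : R -> R) (p : params R Na).

Definition drive (u : R) (Z : 'M[R]_(Na, No)) : 'M[R]_(Na, No) :=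
  let d := pd p in
  let alpha := palpha p in
  let beta := pbeta p in
  let Gamma := pGamma p in
  let Delta := pDelta p in
  \matrix_(i, j)
    (- d * Z i j
     + u * (S1 (alpha * Z i j + \sum_(k < Na | k != i) Gamma i k * Z k j)
            + \sum_(l < No | l != j)
                S2 (beta * Z i l
                    + \sum_(k < Na | k != i) Delta i k * Z k l))).

(* The i-th row of [field u Z] is the row form of P0 F_i(Z). The formula makes
   sense for every matrix Z; the system itself is its restriction to V, which
   [field u] maps to itself. *)
Definition field (u : R) (Z : 'M[R]_(Na, No)) : 'M[R]_(Na, No) :=
  drive u Z *m (P0 R No)^T.

(* The Jacobian at the neutral point. As a linear map on V it is the
   restriction to V of this differential, hence the kernel below. *)
Definition neutral_jacobian (u : R) : 'M[R]_(Na, No) -> 'M[R]_(Na, No) :=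
  'd (field u) (0 : 'M[R]_(Na, No)).

Definition ker_jacobian (u : R) : set 'M[R]_(Na, No) :=
  V `&` [set X | neutral_jacobian u X = 0].

Definition equilibrium (u : R) (Z : 'M[R]_(Na, No)) : Prop :=
  V Z /\ field u Z = 0.

Definition solution (u : R) (z : R -> 'M[R]_(Na, No)) : Prop :=
  [/\ {within `[0, +oo[, continuous z},
      forall t : R, 0 <= t -> V (z t) &
      forall t : R, 0 < t -> is_derive t (1 : R) z (field u (z t))].

Definition loc_exp_stable (u : R) : Prop :=
  exists delta C r : R, [/\ 0 < delta, 0 < C, 0 < r &
    forall z, solution u z -> `|z 0| < delta ->
      forall t : R, 0 <= t -> `|z t| <= C * expR (- r * t) * `|z 0|].

Definition lyapunov_stable (u : R) : Prop :=
  forall eps : R, 0 < eps -> exists2 delta : R, 0 < delta &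
    forall z, solution u z -> `|z 0| < delta ->
      forall t : R, 0 <= t -> `|z t| < eps.

Definition unstable (u : R) : Prop := ~ lyapunov_stable u.

(* A branch emerging from (0, u0): a continuous curve (Z(t), u(t)), with t in
   [0, 1], that starts at (0, u0) and consists of nonzero equilibria for t > 0.
   No differentiability at t = 0 is required. *)
Definition bifurcation_branch (u0 : R)
    (Zb : R -> 'M[R]_(Na, No)) (ub : R -> R) : Prop :=
  [/\ {within `[0, 1], continuous Zb},
      {within `[0, 1], continuous ub},
      Zb 0 = 0, ub 0 = u0 &
      forall t : R, 0 < t <= 1 -> equilibrium (ub t) (Zb t) /\ Zb t != 0].

Definition opinion_forming_bifurcation (u0 : R) : Prop :=
  [/\ forall u, equilibrium u 0,
      exists2 X, ker_jacobian u0 X & X != 0 &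
      exists Zb ub, bifurcation_branch u0 Zb ub].

End Dynamics.

(* The curve Zb leaves 0 tangentially to the line spanned by w: it lies on that
   line up to an error o(|Zb t|) as t -> 0+. *)
Definition tangent_to_line (R : realType) (m n : nat)
    (Zb : R -> 'M[R]_(m, n)) (w : 'M[R]_(m, n)) : Prop :=
  exists c : R -> R,
    `|Zb t - c t *: w| / `|Zb t| @[t --> (0 : R)^'+] --> (0 : R).

(* Main.v *)
Require Import Defs.
From HB Require Import structures.
From mathcomp Require Import all_boot all_order all_algebra complex.
From mathcomp Require Import all_classical all_reals all_analysis.
From mathcomp Require Import ring lra.

Set Implicit Arguments.
Unset Strict Implicit.
Unset Printing Implicit Defensive.

Import Order.TTheory GRing.Theory Num.Theory.
Import numFieldNormedType.Exports.

Local Open Scope classical_set_scope.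
Local Open Scope ring_scope.

(** Write M for Gamma - Delta, A for alpha + Gamma, B for beta + Delta. The sum
    over all options of the S2-terms is constant along a row, so the projection
    kills it, and on states of V the system reads
      Z' = - d Z + u (S1(A Z) - S2(B Z)) P0
    with entrywise sigmoids ([fieldE]). As both sigmoids have derivative 1 at 0,
    the linearization is (- d + u (alpha - beta)) Z + u M Z ([lin_mul]): all
    options obey the same equation, and a mode of M whose eigenvalue has real
    part th grows at the rate - d + u (alpha - beta + th). For th = lam this rate
    vanishes at the critical attention.

    Stability. If no eigenvalue of M has real part th, then there is a symmetric
    H with tr(X^T H M X) >= th tr(X^T H X) + c |X|^2, negative definite when all
    eigenvalues lie to the left of th ([lyapunov_form]). The gap c absorbs the
    nonlinear remainder near 0, so tr(Z^T H Z) obeys the linear growth inequality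
    along the nonlinear flow ([energy_growth]). Below the critical attention, th
    slightly above lam yields a decaying definite energy ([stable_below]). Above
    it, th slightly below lam yields a form that is positive somewhere close to 0
    and must grow exponentially ([unstable_above]); that solutions exist for all
    times is [global_solution].

    Bifurcation. At the critical attention the kernel consists of the states of V
    whose columns are multiples of v ([ker_jacobianE]). The states
    x (x) (No - 1, -1, ..., -1) form an invariant subspace ([map_pattern]), on
    which the equilibria solve a nonlinear eigenvalue problem for x with
    eigenvalue d / u. There the critical eigenvalue is simple, and a contraction
    argument for the Lyapunov-Schmidt reduction produces a branch
    ([simple_branch], [opinion_bifurcation]).

    Tangency. Let w be the left eigenvector with w v = 1 and let Z run along any
    branch. Then Z = v Y + o(|Z|) with Y = w Z, and w times the equilibrium
    equation is
      sigma Y = (q / 2) (Y_j^2)_j P0 + o(|Z|^2),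
      q = sum_i w_i (S1''(0) (A v)_i^2 - S2''(0) (B v)_i^2),
    where sigma = d / u - (alpha - beta + lam). If q is nonzero, the coordinates
    of Y are asymptotically roots of one quadratic equation, so they form at most
    two clusters. By continuity along the branch the two clusters cannot change,
    and as the coordinates of Y add up to 0 this fixes the direction of Y in the
    limit ([axial_limit], [branch_tangent]).

    It remains to see that q is generically nonzero. The condition is open: the
    matrix v w is the adjugate of lam - M up to a factor ([adj_rank1]) and a
    simple leading eigenvalue depends continuously on M ([quad_open]). It is
    dense: adding the same matrix to A and B changes neither M nor v nor w, but
    changes q ([quad_dense]). *)

(** * Norms, limits and derivatives of matrix functions *)

Section MatrixNorm.
Variable R : realType.

Lemma mx_entry_le m n (A : 'M[R]_(m, n)) i j : `|A i j| <= `|A|.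
Proof.
rewrite [leRHS]/Num.Def.normr /= mx_normrE.
exact: (le_bigmax _ (fun ij : 'I_m * 'I_n => `|A ij.1 ij.2|) (i, j)).
Qed.

Lemma mx_norm_le m n (A : 'M[R]_(m, n)) (c : R) :
  0 <= c -> (forall i j, `|A i j| <= c) -> `|A| <= c.
Proof.
move=> c0 Ac; rewrite [leLHS]/Num.Def.normr /= mx_normrE.
by apply: bigmax_le => // -[i j] _; exact: Ac.
Qed.

Lemma mx_norm_attained m n (A : 'M[R]_(m, n)) :
  A != 0 -> exists i j, `|A| = `|A i j|.
Proof.
move=> A0; have /mx_norm_neq0[[i j] /= e] : mx_norm A != 0.
  by apply: contraNneq A0 => /mx_norm_eq0 ->.
by exists i, j.
Qed.

Lemma mx_norm_mul m n p (A : 'M[R]_(m, n)) (B : 'M[R]_(n, p)) :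
  `|A *m B| <= n%:R * `|A| * `|B|.
Proof.
apply: mx_norm_le => [|i j]; first by rewrite !mulr_ge0.
rewrite mxE (le_trans (ler_norm_sum _ _ _))//.
rewrite (@le_trans _ _ (\sum_(k < n) `|A| * `|B|))//.
  by apply: ler_sum => k _; rewrite normrM ler_pM ?mx_entry_le.
by rewrite sumr_const card_ord -mulrA -[leLHS]mulr_natl.
Qed.

Lemma mx_cvgP (T : Type) (F : set_system T) (FF : Filter F) m n
    (f : T -> 'M[R]_(m, n)) (l : 'M[R]_(m, n)) :
  (f x @[x --> F] --> l) <-> (forall i j, f x i j @[x --> F] --> l i j).
Proof.
split=> [fl i j|fl].
  by apply: (cvg_comp f (fun M : 'M[R]_(m, n) => M i j) fl); exact: coord_continuous.
apply/cvgrPdist_le => e e0.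
have H : \forall x \near F, forall ij : 'I_m * 'I_n, `|l ij.1 ij.2 - f x ij.1 ij.2| <= e.
  by apply: filter_forall => -[i j]; exact: (cvgrPdist_le _ _).1 (fl i j) e e0.
near=> x; apply: mx_norm_le => [|i j]; first exact: ltW.
rewrite !mxE; move: i j; suff Hx : forall ij : 'I_m * 'I_n,
  `|l ij.1 ij.2 - f x ij.1 ij.2| <= e by move=> i j; exact: (Hx (i, j)).
by near: x.
Unshelve. all: by end_near. Qed.

End MatrixNorm.

Section ScalarMVT.
Variable R : realType.

Lemma lip_of_derive (f df : R -> R) (a b M : R) :
  (forall x, x \in `[a, b] -> is_derive x 1 f (df x)) ->
  (forall x, x \in `[a, b] -> `|df x| <= M) ->
  forall x y, x \in `[a, b] -> y \in `[a, b] -> `|f x - f y| <= M * `|x - y|.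
Proof.
move=> fd dM.
have main x y : x \in `[a, b] -> y \in `[a, b] -> x <= y ->
    `|f y - f x| <= M * `|y - x|.
  move=> xab yab xy.
  have sub z : z \in `[x, y] -> z \in `[a, b].
    move: xab yab; rewrite !in_itv /= => /andP[ax _] /andP[_ yb] /andP[xz zy].
    by rewrite (le_trans ax xz) (le_trans zy yb).
  have fd' z : z \in `]x, y[ -> is_derive z 1 f (df z).
    by move=> zxy; apply: fd; apply: sub; apply: subset_itv_oo_cc zxy.
  have fc : {within `[x, y], continuous f}.
    apply: derivable_within_continuous => z zxy.
    by have [] := fd z (sub z zxy).
  have [c cxy ->] := MVT_segment xy fd' fc.
  by rewrite normrM ler_wpM2r// dM// sub.
move=> x y xab yab; have [xy|/ltW yx] := leP x y; last exact: main.
by rewrite distrC (distrC x); exact: main.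
Qed.

Lemma nondecr_of_derive (f df : R -> R) (a b : R) : a <= b ->
  (forall x, a < x < b -> is_derive x 1 f (df x)) ->
  (forall x, a < x < b -> 0 <= df x) ->
  {within `[a, b], continuous f} -> f a <= f b.
Proof.
rewrite le_eqVlt => /predU1P[->//|ab] fd d0 fc.
have fd' z : z \in `]a, b[ -> is_derive z 1 f (df z).
  by rewrite in_itv; exact: fd.
have [c cab e] := MVT ab fd' fc.
by rewrite -subr_ge0 e mulr_ge0 ?subr_ge0 ?(ltW ab)// d0// -in_itv.
Qed.

End ScalarMVT.

Section PointwiseDerivatives.
Variable R : realType.
Implicit Types (f g : R -> R) (x a b c : R).

Lemma is_derive1D f g x a b : is_derive x 1 f a -> is_derive x 1 g b ->
  is_derive x 1 (fun y => f y + g y) (a + b).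
Proof. by move=> df dg; exact: is_deriveD. Qed.

Lemma is_derive1B f g x a b : is_derive x 1 f a -> is_derive x 1 g b ->
  is_derive x 1 (fun y => f y - g y) (a - b).
Proof. by move=> df dg; exact: is_deriveB. Qed.

Lemma is_derive1M f g x a b : is_derive x 1 f a -> is_derive x 1 g b ->
  is_derive x 1 (fun y => f y * g y) (a * g x + f x * b).
Proof.
move=> df dg; apply: is_derive_eq (is_deriveM df dg) _.
by rewrite /GRing.scale /= addrC (mulrC a).
Qed.

Lemma is_derive1Z f c x a : is_derive x 1 f a ->
  is_derive x 1 (fun y => c * f y) (c * a).
Proof. by move=> df; exact: (is_deriveZ c df). Qed.

Lemma is_derive1_sum (I : Type) (r : seq I) (P : pred I) (F : I -> R -> R) (dF : I -> R) x :
  (forall i, is_derive x 1 (F i) (dF i)) ->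
  is_derive x 1 (fun y => \sum_(i <- r | P i) F i y) (\sum_(i <- r | P i) dF i).
Proof.
move=> dFx; elim: r => [|i r IHr].
  rewrite big_nil; under eq_fun do rewrite big_nil.
  exact: is_derive_cst.
rewrite big_cons; under eq_fun do rewrite big_cons.
by case: (P i) => //; apply: is_derive1D.
Qed.

Lemma is_derive1_expR c x :
  is_derive x 1 (fun y => expR (c * y)) (c * expR (c * x)).
Proof.
have d : is_derive x 1 (fun y : R => c * y) c.
  by apply: is_derive_eq (is_derive1Z c (is_derive_id x 1)) _; rewrite mulr1.
apply: is_derive_eq (is_derive1_comp (is_derive_expR (c * x)) d) _.
by rewrite mulrC.
Qed.

End PointwiseDerivatives.

Section FiniteLimits.
Variables (R : realType) (T : Type) (F : set_system T).
Hypothesis FF : Filter F.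
Variables (I : Type) (r : seq I) (P : pred I) (f : I -> T -> R) (a : I -> R).
Hypothesis fa : forall i, f i x @[x --> F] --> a i.

Lemma cvg_sumr : \sum_(i <- r | P i) f i x @[x --> F] --> \sum_(i <- r | P i) a i.
Proof.
elim: r => [|i s IHs].
  by under eq_fun do rewrite big_nil; rewrite big_nil; exact: cvg_cst.
under eq_fun do rewrite big_cons; rewrite big_cons.
by case: (P i) => //; apply: cvgD.
Qed.

Lemma cvg_prodr : \prod_(i <- r | P i) f i x @[x --> F] --> \prod_(i <- r | P i) a i.
Proof.
elim: r => [|i s IHs].
  by under eq_fun do rewrite big_nil; rewrite big_nil; exact: cvg_cst.
under eq_fun do rewrite big_cons; rewrite big_cons.
by case: (P i) => //; apply: cvgM.
Qed.

End FiniteLimits.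

(** * Sigmoids near the origin *)

(** Strict differentiability at 0 with derivative 1: the deviation from the
    identity has small Lipschitz constants near 0, which is what the contraction
    argument for branches consumes. *)
Definition strict1 (R : realType) (g : R -> R) : Prop :=
  g 0 = 0 /\ forall e : R, 0 < e -> exists2 r : R, 0 < r &
    forall x y, `|x| <= r -> `|y| <= r -> `|(g x - x) - (g y - y)| <= e * `|x - y|.

Section SigmoidFacts.
Variables (R : realType) (k1 k2 : R) (S : R -> R).
Hypothesis hS : sigmoid k1 k2 S.

Let s2 : R := derive1n 2 S 0.

Lemma sigmoid_bounded x : `|S x| <= k1 + k2.
Proof.
have [[k10 k20] /(_ x)/andP[a b] _ _ _] := hS.
rewrite ler_norml; apply/andP; split; lra.
Qed.

Lemma sigmoid_is_derive n (x : R) : (n < 3)%N ->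
  is_derive x 1 (derive1n n S) (derive1n n.+1 S x).
Proof.
have [_ _ _ _ [d _ _ _]] := hS => n3.
by apply: DeriveDef; [exact: d|rewrite /= derive1E].
Qed.

Lemma sigmoid_derive_continuous n : (n < 3)%N -> continuous (derive1n n S).
Proof.
move=> n3 x; apply/differentiable_continuous/derivable1_diffP.
by have [] := sigmoid_is_derive x n3.
Qed.

Lemma sigmoid_lip (K : R) : 0 <= K -> exists2 L : R, 0 <= L &
  forall x y, `|x| <= K -> `|y| <= K -> `|S x - S y| <= L * `|x - y|.
Proof.
move=> K0.
have [||c _ cM] := @EVT_max R (fun x => `|derive1n 1 S x|) (- K) K.
- by lra.
- apply: continuous_subspaceT => x.
  by apply: continuous_comp; [exact: sigmoid_derive_continuous|exact: norm_continuous].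
exists `|derive1n 1 S c|; first exact: normr_ge0.
move=> x y xK yK; apply: (@lip_of_derive R S (derive1n 1 S) (- K) K).
- by move=> z _; exact: (@sigmoid_is_derive 0).
- by move=> z; exact: cM.
- by rewrite in_itv /= -ler_norml.
- by rewrite in_itv /= -ler_norml.
Qed.

Lemma sigmoid_strict1 : strict1 S.
Proof.
have [_ _ _ _ [_ _ [S0 S1] _]] := hS.
split=> // e e0.
have /cvgrPdist_le /(_ e e0) := @sigmoid_derive_continuous 1 isT 0.
rewrite S1 => /nbhs_ballP[r /= r0 rP].
exists (r / 2); first by rewrite divr_gt0.
move=> x y xr yr.
apply: (@lip_of_derive R (fun x => S x - x) (fun x => derive1n 1 S x - 1)
  (- (r / 2)) (r / 2)).
- move=> z _; have := @sigmoid_is_derive 0 z isT => ?.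
  exact: is_deriveB.
- move=> z; rewrite in_itv /= -ler_norml => zr.
  rewrite distrC; apply: rP; rewrite /ball /= sub0r normrN.
  by apply: le_lt_trans zr _; rewrite ltr_pdivrMr// ltr_pMr// ltr1n.
- by rewrite in_itv /= -ler_norml.
- by rewrite in_itv /= -ler_norml.
Qed.

(** Differentiability of S' at 0 makes the derivative of S
    x - x - s2 / 2 * x ^+ 2 an o(x), and the mean value theorem gains the second
    power. *)
Lemma sigmoid_taylor2 (e : R) : 0 < e -> exists2 r : R, 0 < r &
  forall x, `|x| <= r -> `|S x - x - s2 / 2 * x ^+ 2| <= e * `|x| ^+ 2.
Proof.
have [_ _ _ _ [_ _ [S0 S1] _]] := hS.
move=> e0.
have D := @sigmoid_is_derive 1 0 isT.
have /cvgrPdist_le /(_ e e0) : h^-1 *: (derive1n 1 S (h *: 1 + 0) - derive1n 1 S 0)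
    @[h --> 0^'] --> s2.
  have [Dd De] := D; rewrite -[s2]De; exact: Dd.
move=> /nbhs_ballP[r r0 rP].
have S'E z : `|z| < r -> `|derive1n 1 S z - 1 - s2 * z| <= e * `|z|.
  move=> zr; have [->|z0] := eqVneq z 0.
    by rewrite S1 subrr mulr0 subrr normr0 mulr0.
  have zb : ball (0 : R) r z by rewrite /ball /= sub0r normrN.
  have := rP z zb z0; rewrite S1 addr0 [z *: 1]mulr1 => h.
  have -> : derive1n 1 S z - 1 - s2 * z = - (s2 - z^-1 *: (derive1n 1 S z - 1)) * z.
    rewrite /GRing.scale /=. by field.
  by rewrite normrM normrN ler_wpM2r.
exists (r / 2); first by rewrite divr_gt0.
move=> x xr.
have r2 : r / 2 < r by rewrite ltr_pdivrMr// ltr_pMr// ltr1n.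
have fd z : z \in `[- `|x|, `|x|] -> is_derive z 1
    (fun y => S y - y - s2 / 2 * (y * y)) (derive1n 1 S z - 1 - s2 * z).
  move=> _; apply: is_derive_eq (is_derive1B
    (is_derive1B (@sigmoid_is_derive 0 z isT) (is_derive_id z 1))
    (is_derive1Z (s2 / 2) (is_derive1M (is_derive_id z 1) (is_derive_id z 1)))) _.
  by rewrite /=; field.
have fM z : z \in `[- `|x|, `|x|] ->
    `|derive1n 1 S z - 1 - s2 * z| <= e * `|x|.
  rewrite in_itv /= -ler_norml => zx.
  rewrite (le_trans (S'E _ _)) ?ler_wpM2l// ?(ltW e0)//.
  by apply: le_lt_trans zx _; apply: le_lt_trans xr _.
have xin : x \in `[- `|x|, `|x|] by rewrite in_itv /= -ler_norml.
have oin : 0 \in `[- `|x|, `|x|] by rewrite in_itv /= oppr_le0 !normr_ge0.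
have := lip_of_derive fd fM xin oin.
by rewrite S0 mulr0 mulr0 !subr0 -(mulrA e) -!expr2.
Qed.

End SigmoidFacts.

(** * Lyapunov forms of a real matrix *)

(** With agents as rows and options as columns, this is the sum over the options
    of the bilinear form of H. *)
Definition form (R : realType) n m (H : 'M[R]_n) (X Y : 'M[R]_(n, m)) : R :=
  \tr (X^T *m H *m Y).

Section TriangularForm.
Variables (R : realType) (n : nat) (Tr Ti : 'M[R]_n) (th g : R).
Hypotheses (Tr_trig : forall i j : 'I_n, (i < j)%N -> Tr i j = 0)
           (Ti_trig : forall i j : 'I_n, (i < j)%N -> Ti i j = 0)
           (g0 : 0 < g) (gap : forall i, g <= `|Tr i i - th|).

Let be : R := `|Tr| + `|Ti|.
(* Small enough for the off-diagonal entries of a row to cost at most g / 2 in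
   total. *)
Let ep : R := g / (2 * (be * n%:R + g)).

(** Geometric weights: conjugation by their square roots shrinks the strictly
    lower entries of a triangular matrix. *)
Definition weight (i : 'I_n) : R := (ep ^+ 2) ^+ i.

Definition signed_weight (i : 'I_n) : R := Num.sg (Tr i i - th) * weight i.

Let be0 : 0 <= be. Proof. by rewrite addr_ge0. Qed.
Let D0 : 0 < be * n%:R + g. Proof. by rewrite ltr_wpDl// mulr_ge0. Qed.
Let ep0 : 0 < ep. Proof. by rewrite divr_gt0// mulr_gt0. Qed.
Let ep1 : ep <= 1.
Proof.
rewrite ler_pdivrMr ?mulr_gt0// mul1r.
have := g0; have : 0 <= be * n%:R by rewrite mulr_ge0.
by set x := be * _; lra.
Qed.
Let epg : ep * (be * n%:R) <= g / 2.
Proof.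
have -> : ep * (be * n%:R) = g / 2 * ((be * n%:R) / (be * n%:R + g)).
  by rewrite /ep invfM; ring.
rewrite ger_pMr ?divr_gt0// ler_pdivrMr// mul1r.
by rewrite lerDl ltW.
Qed.

Lemma weight_gt0 i : 0 < weight i. Proof. by rewrite !exprn_gt0. Qed.

Lemma weight_lb : exists2 c : R, 0 < c & forall i, c <= weight i.
Proof.
exists ((ep ^+ 2) ^+ n); first by rewrite !exprn_gt0.
move=> i; have h : ep ^+ 2 <= 1 by apply: exprn_ile1; [exact: ltW ep0|exact: ep1].
by apply: ler_wiXn2l => //; [exact: sqr_ge0|exact: ltnW (ltn_ord i)].
Qed.

(** The weight of a row is at most ep times the geometric mean of its own weight
    and that of any earlier row, so the strictly lower entries are negligible. *)
Let offdiag (i j : 'I_n) (x y z w : R) : (j < i)%N ->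
  weight i * `|x * z + y * w| <=
    ep * (weight i * (x ^+ 2 + y ^+ 2) + weight j * (z ^+ 2 + w ^+ 2)) / 2.
Proof.
move=> ji; rewrite /weight -!exprM !(mulnC 2) !exprM.
set k := ep ^+ i; set l := ep ^+ j.
have k0 : 0 < k by rewrite exprn_gt0.
have l0 : 0 < l by rewrite exprn_gt0.
have kl : k <= ep * l.
  by rewrite -exprS; exact: (ler_wiXn2l (ltW ep0) ep1).
have H : `|(k * x) * (l * z) + (k * y) * (l * w)| <=
   ((k * x) ^+ 2 + (k * y) ^+ 2 + ((l * z) ^+ 2 + (l * w) ^+ 2)) / 2.
  rewrite ler_norml; apply/andP; split.
    have := addr_ge0 (sqr_ge0 (k * x + l * z)) (sqr_ge0 (k * y + l * w)); lra.
  have := addr_ge0 (sqr_ge0 (k * x - l * z)) (sqr_ge0 (k * y - l * w)); lra.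
have -> : ep * (k ^+ 2 * (x ^+ 2 + y ^+ 2) + l ^+ 2 * (z ^+ 2 + w ^+ 2)) / 2 =
   ep * (((k * x) ^+ 2 + (k * y) ^+ 2 + ((l * z) ^+ 2 + (l * w) ^+ 2)) / 2).
  by field.
apply: le_trans (ler_wpM2l (ltW ep0) H).
have -> : (k * x) * (l * z) + (k * y) * (l * w) = (k * l) * (x * z + y * w) by ring.
rewrite normrM (gtr0_norm (mulr_gt0 k0 l0)) mulrA ler_wpM2r//.
by rewrite expr2 (mulrC k l) mulrA ler_wpM2r// ltW.
Qed.

(** The pair (a, b) stands for a complex vector, on which the complex triangular
    matrix with real part Tr and imaginary part Ti acts. Multiplying row i by
    the sign of Tr i i - th turns each diagonal entry into at least g times its
    weighted square, and the strictly lower entries cost at most half of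
    this. *)
Lemma triangular_form_ge (a b : 'I_n -> R) :
  g / 2 * \sum_i weight i * (a i ^+ 2 + b i ^+ 2) <=
  \sum_i signed_weight i *
    (a i * (\sum_j (Tr i j * a j - Ti i j * b j) - th * a i) +
     b i * (\sum_j (Tr i j * b j + Ti i j * a j) - th * b i)).
Proof.
pose r i := weight i * (a i ^+ 2 + b i ^+ 2).
pose t i j := Tr i j * (a i * a j + b i * b j) + Ti i j * (b i * a j + (- a i) * b j).
have tE i : signed_weight i *
    (a i * (\sum_j (Tr i j * a j - Ti i j * b j) - th * a i) +
     b i * (\sum_j (Tr i j * b j + Ti i j * a j) - th * b i)) =
   \sum_j signed_weight i * t i j - signed_weight i * th * (a i ^+ 2 + b i ^+ 2).
  rewrite -mulr_sumr -mulrA -mulrBr; congr (_ * _).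
  rewrite !mulrBr !mulr_sumr addrACA -big_split /= -opprD; congr (_ - _).
    by apply: eq_bigr => j _; rewrite /t; ring.
  by ring.
under [leRHS]eq_bigr do rewrite tE.
have r0 i : 0 <= r i.
  by rewrite mulr_ge0 ?addr_ge0 ?sqr_ge0// ltW// weight_gt0.
have tge i j : (if i == j then signed_weight i * Tr i i * (a i ^+ 2 + b i ^+ 2)
    else 0) - ep * be * (r i + r j) / 2 <= signed_weight i * t i j.
  have e0 : 0 <= ep * be * (r i + r j) / 2.
    apply: divr_ge0 => //; apply: mulr_ge0; last exact: addr_ge0.
    by apply: mulr_ge0; [exact: ltW ep0|exact: be0].
  case: ltngtP (erefl (val i == val j)) => [ij|ji|ij] _.
  - rewrite /t (Tr_trig ij) (Ti_trig ij) !mul0r addr0 mulr0.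
    by rewrite -val_eqE ltn_eqF//; lra.
  - rewrite -val_eqE gtn_eqF// sub0r lerNl.
    apply: le_trans (ler_norm _) _; rewrite normrN normrM.
    have sw : `|signed_weight i| <= weight i.
      rewrite normrM (gtr0_norm (weight_gt0 i)) ger_pMl ?weight_gt0//.
      by rewrite normr_sg; case: (_ == _) => //=; rewrite ?ler01.
    apply: le_trans (ler_wpM2r (normr_ge0 _) sw) _.
    apply: le_trans (ler_wpM2l (ltW (weight_gt0 i)) (ler_normD _ _)) _.
    rewrite !normrM mulrDr !(mulrCA (weight i)).
    have H1 := offdiag (a i) (b i) (a j) (b j) ji.
    have H2 := offdiag (b i) (- a i) (a j) (b j) ji.
    rewrite sqrrN (addrC (b i ^+ 2)) in H2.
    have -> : ep * be * (r i + r j) / 2 = `|Tr| * (ep * (r i + r j) / 2)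
       + `|Ti| * (ep * (r i + r j) / 2) by rewrite /be; ring.
    apply: lerD; apply: ler_pM => //; rewrite ?mx_entry_le//.
      by rewrite mulr_ge0// ltW// weight_gt0.
    by rewrite mulr_ge0// ltW// weight_gt0.
  - move/val_inj: ij e0 => <- e0; rewrite eqxx /t.
    have -> : signed_weight i * (Tr i i * (a i * a i + b i * b i)
       + Ti i i * (b i * a i + - a i * b i)) =
       signed_weight i * Tr i i * (a i ^+ 2 + b i ^+ 2) by ring.
    by rewrite gerBl.
have sum_ge i : signed_weight i * Tr i i * (a i ^+ 2 + b i ^+ 2)
   - \sum_j ep * be * (r i + r j) / 2 <= \sum_j signed_weight i * t i j.
  apply: le_trans (ler_sum _ (fun j _ => tge i j)).
  rewrite sumrB lerB// (bigD1 i)//= eqxx big1 ?addr0// => j.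
  by rewrite eq_sym => /negPf ->.
have rsum : \sum_i \sum_j ep * be * (r i + r j) / 2 = ep * (be * n%:R) * \sum_i r i.
  under eq_bigr do rewrite -mulr_suml -mulr_sumr big_split /= sumr_const card_ord.
  rewrite -mulr_suml -mulr_sumr big_split /= sumr_const card_ord -sumrMnl.
  under eq_bigr do rewrite -mulr_natr.
  by rewrite -mulr_suml -mulr_natr; field.
have diag i : g * r i <= signed_weight i * (Tr i i - th) * (a i ^+ 2 + b i ^+ 2).
  have -> : signed_weight i * (Tr i i - th) * (a i ^+ 2 + b i ^+ 2) =
      `|Tr i i - th| * r i by rewrite normrEsg /signed_weight /r; ring.
  by rewrite ler_wpM2r.
rewrite -[X in X * _](_ : g - g / 2 = _); last by field.
apply: le_trans (_ : g * \sum_i r i - ep * (be * n%:R) * \sum_i r i <= _).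
  by rewrite mulrBl lerB// ler_wpM2r// sumr_ge0.
rewrite mulr_sumr -rsum -sumrB; apply: ler_sum => i _.
apply: le_trans (lerB (sum_ge i) (lexx _)).
rewrite -addrA (addrC (- _)) addrA lerB//.
by apply: le_trans (diag i) _; rewrite mulrBr mulrBl.
Qed.

End TriangularForm.

Lemma formE (R : realType) n m (H : 'M[R]_n) (X Y : 'M[R]_(n, m)) :
  form H X Y = \sum_(k < m) \sum_i \sum_j X i k * H i j * Y j k.
Proof.
rewrite /form /mxtrace; apply: eq_bigr => k _; rewrite !mxE.
under eq_bigr do rewrite mxE mulr_suml.
rewrite exchange_big /=; apply: eq_bigr => i _; apply: eq_bigr => j _.
by rewrite mxE.
Qed.

Lemma form_diag (R : realType) n m (d : 'rV[R]_n) (X Y : 'M[R]_(n, m)) :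
  form (diag_mx d) X Y = \sum_(k < m) \sum_i d 0 i * (X i k * Y i k).
Proof.
rewrite formE; apply: eq_bigr => k _; apply: eq_bigr => i _.
rewrite (bigD1 i)//= big1 ?addr0 => [|j ji]; rewrite mxE.
  by rewrite eqxx mulr1n; ring.
by rewrite eq_sym (negPf ji) mulr0n mulr0 mul0r.
Qed.

Lemma form_conj (R : realType) n m p (H : 'M[R]_n) (Q : 'M[R]_(n, p)) (X Y : 'M[R]_(p, m)) :
  form (Q^T *m H *m Q) X Y = form H (Q *m X) (Q *m Y).
Proof. by rewrite /form trmx_mul !mulmxA. Qed.

Lemma formDl (R : realType) n m (H K : 'M[R]_n) (X Y : 'M[R]_(n, m)) :
  form (H + K) X Y = form H X Y + form K X Y.
Proof. by rewrite /form mulmxDr mulmxDl mxtraceD. Qed.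

Section LyapunovForm.
Variables (R : realType).
Local Notation C := R[i].
Local Notation rc := (real_complex R).

Lemma Re_sum (I : Type) (r : seq I) (P : pred I) (F : I -> C) :
  complex.Re (\sum_(i <- r | P i) F i) = \sum_(i <- r | P i) complex.Re (F i).
Proof. by apply: (big_morph (@complex.Re R)) => // -[? ?] [? ?]. Qed.

Lemma Im_sum (I : Type) (r : seq I) (P : pred I) (F : I -> C) :
  complex.Im (\sum_(i <- r | P i) F i) = \sum_(i <- r | P i) complex.Im (F i).
Proof. by apply: (big_morph (@complex.Im R)) => // -[? ?] [? ?]. Qed.

Let re m n (M : 'M[C]_(m, n)) : 'M[R]_(m, n) := map_mx (@complex.Re R) M.
Let im m n (M : 'M[C]_(m, n)) : 'M[R]_(m, n) := map_mx (@complex.Im R) M.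

Lemma re_mul m n p (M : 'M[C]_(m, n)) (N : 'M[C]_(n, p)) :
  re (M *m N) = re M *m re N - im M *m im N.
Proof.
apply/matrixP => i j; rewrite !mxE Re_sum -sumrB; apply: eq_bigr => k _.
by rewrite !mxE; case: (M i k) (N k j) => [? ?] [? ?].
Qed.

Lemma im_mul m n p (M : 'M[C]_(m, n)) (N : 'M[C]_(n, p)) :
  im (M *m N) = re M *m im N + im M *m re N.
Proof.
apply/matrixP => i j; rewrite !mxE Im_sum -big_split; apply: eq_bigr => k _.
by rewrite !mxE; case: (M i k) (N k j) => [? ?] [? ?].
Qed.

Lemma re_real m n (M : 'M[R]_(m, n)) : re (map_mx rc M) = M.
Proof. by apply/matrixP => i j; rewrite !mxE. Qed.

Lemma im_real m n (M : 'M[R]_(m, n)) : im (map_mx rc M) = 0.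
Proof. by apply/matrixP => i j; rewrite !mxE. Qed.

(** In real and imaginary parts, unitarity of the Schur basis becomes a
    decomposition of the identity, along which real forms can be transported. *)
Lemma schur_real n (A : 'M[R]_n) : exists P T : 'M[C]_n,
  [/\ (re P)^T *m re P + (im P)^T *m im P = 1%:M,
      T *m P = P *m map_mx rc A,
      forall i j : 'I_n, (i < j)%N -> T i j = 0 &
      forall i, complex_eigenvalue A (T i i)].
Proof.
case: n A => [|n] A.
  exists 0, 0; split=> //; by [apply/matrixP => -[]|case|move=> []].
have [P Pu /= trig] := Schur (map_mx rc A) isT.
have PPs : P *m map_mx Num.conj P^T = 1%:M by apply/unitarymxP.
have PsP : map_mx Num.conj P^T *m P = 1%:M by apply: mulmx1C.
pose T := P *m map_mx rc A *m map_mx Num.conj P^T.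
have TP : T *m P = P *m map_mx rc A by rewrite /T -mulmxA PsP mulmx1.
have {}trig : is_trig_mx T by move: trig; rewrite /similar_to /= conjymx.
exists P, T; split=> //.
- have := congr1 (@re _ _) PsP; rewrite re_mul.
  have -> : re (map_mx Num.conj P^T) = (re P)^T.
    by apply/matrixP => i j; rewrite !mxE; case: (P j i).
  have -> : im (map_mx Num.conj P^T) = - (im P)^T.
    by apply/matrixP => i j; rewrite !mxE; case: (P j i).
  rewrite mulNmx opprK => ->; apply/matrixP => i j; rewrite !mxE.
  by case: (i == j).
- by move=> i j ij; exact: (elimT is_trig_mxP trig).
- move=> i.
  have : eigenvalue T (T i i).
    rewrite eigenvalue_root_char char_poly_trig// rootE horner_prod.
    by rewrite (bigD1 i)//= hornerXsubC subrr mul0r.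
  move=> /eigenvalueP[v vT v0]; apply/eigenvalueP; exists (v *m P).
    by rewrite -mulmxA -TP mulmxA vT scalemxAl.
  apply: contraNneq v0 => vP.
  by rewrite -[v]mulmx1 -PPs mulmxA vP mul0mx.
Qed.

(** In a Schur basis of A, take the diagonal form with the signed weights of its
    triangular factor. The sign of a weight is that of Re mu - th for the
    corresponding eigenvalue mu, whence definiteness when th exceeds all real
    parts. *)
Lemma lyapunov_form n (A : 'M[R]_n) (th : R) :
  (forall mu, complex_eigenvalue A mu -> complex.Re mu != th) ->
  exists (H : 'M[R]_n) (c : R), [/\ 0 < c, H^T = H,
    (forall m (X : 'M[R]_(n, m)),
      th * form H X X + c * form 1%:M X X <= form H X (A *m X)) &
    (forall mu, complex_eigenvalue A mu -> complex.Re mu < th) ->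
      forall m (X : 'M[R]_(n, m)), form H X X <= - c * form 1%:M X X].
Proof.
move=> hth.
have [P [T [unitP TP trigT eigT]]] := schur_real A.
pose Tr := re T; pose Ti := im T; pose Pr := re P; pose Pi := im P.
have trigTr (i j : 'I_n) : (i < j)%N -> Tr i j = 0 by move=> ij; rewrite mxE trigT.
have trigTi (i j : 'I_n) : (i < j)%N -> Ti i j = 0 by move=> ij; rewrite mxE trigT.
have [g g0 [gap]] : exists2 g, 0 < g & (forall i, g <= `|Tr i i - th|) /\ g <= 1.
  exists (\big[Num.min/1]_i `|Tr i i - th|).
    apply: lt_bigmin => [|i _]; first exact: ltr01.
    by rewrite normr_gt0 subr_eq0 mxE hth.
  by split=> [i|]; [exact: bigmin_le_cond|exact: bigmin_le_id].
move=> g1.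
pose w := weight Tr Ti g; pose sw := signed_weight Tr Ti th g.
have w0 i : 0 < w i by exact: weight_gt0.
have [c c0 cw] : exists2 c, 0 < c & forall i, c <= w i by exact: weight_lb.
pose D : 'M[R]_n := diag_mx (\row_i sw i).
pose H := Pr^T *m D *m Pr + Pi^T *m D *m Pi.
have formH m (X Y : 'M[R]_(n, m)) : form H X Y =
    \sum_(k < m) \sum_i sw i * ((Pr *m X) i k * (Pr *m Y) i k
       + (Pi *m X) i k * (Pi *m Y) i k).
  rewrite formDl !form_conj !form_diag -big_split; apply: eq_bigr => k _.
  rewrite -big_split /=; apply: eq_bigr => i _.
  by rewrite [(\row_i0 sw i0) 0 i]mxE mulrDr.
have form1 m (X : 'M[R]_(n, m)) : form 1%:M X X =
    \sum_(k < m) \sum_i ((Pr *m X) i k ^+ 2 + (Pi *m X) i k ^+ 2).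
  have formId (Q : 'M[R]_n) : form (Q^T *m Q) X X =
      \sum_(k < m) \sum_i (Q *m X) i k ^+ 2.
    rewrite /form mulmxA -trmx_mul -mulmxA; apply: eq_bigr => k _.
    by rewrite mxE; apply: eq_bigr => i _; rewrite mxE expr2.
  rewrite -unitP formDl !formId -big_split; apply: eq_bigr => k _.
  by rewrite -big_split.
have PrA m (X : 'M[R]_(n, m)) : Pr *m (A *m X) = Tr *m (Pr *m X) - Ti *m (Pi *m X).
  have := congr1 (@re _ _) TP; rewrite !re_mul re_real im_real mulmx0 subr0.
  by rewrite !mulmxA => <-; rewrite mulmxBl.
have PiA m (X : 'M[R]_(n, m)) : Pi *m (A *m X) = Tr *m (Pi *m X) + Ti *m (Pr *m X).
  have := congr1 (@im _ _) TP; rewrite !im_mul re_real im_real mulmx0 add0r.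
  by rewrite !mulmxA => <-; rewrite mulmxDl.
exists H, (g / 2 * c); split.
- by rewrite !mulr_gt0.
- by rewrite /H linearD /= !trmx_mul !trmxK tr_diag_mx !mulmxA.
- move=> m X; rewrite -lerBrDl form1 !formH !mulr_sumr -sumrB.
  apply: ler_sum => k _.
  have := triangular_form_ge trigTr trigTi g0 gap
    (fun i => (Pr *m X) i k) (fun i => (Pi *m X) i k).
  move=> tri; apply: le_trans (le_trans _ tri) _.
    rewrite -(mulrA (g / 2)) ler_wpM2l ?divr_ge0 ?(ltW g0)// mulr_sumr.
    by apply: ler_sum => i _; rewrite ler_wpM2r ?addr_ge0 ?sqr_ge0.
  rewrite mulr_sumr -sumrB le_eqVlt; apply/orP; left; apply/eqP.
  apply: eq_bigr => i _; rewrite -/(sw i) PrA PiA !mxE.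
  have <- : \sum_j (Tr i j * (Pr *m X) j k - Ti i j * (Pi *m X) j k) =
    \sum_j Tr i j * (Pr *m X) j k - \sum_j Ti i j * (Pi *m X) j k by rewrite sumrB.
  have <- : \sum_j (Tr i j * (Pi *m X) j k + Ti i j * (Pr *m X) j k) =
    \sum_j Tr i j * (Pi *m X) j k + \sum_j Ti i j * (Pr *m X) j k by rewrite big_split.
  by ring.
- move=> hneg m X; rewrite form1 formH !mulr_sumr; apply: ler_sum => k _.
  rewrite mulr_sumr; apply: ler_sum => i _.
  have -> : sw i = - w i.
    rewrite /sw /signed_weight ltr0_sg ?mulN1r// subr_lt0 mxE; exact: hneg.
  rewrite -!expr2 ler_wpM2r ?addr_ge0 ?sqr_ge0// lerN2.
  by rewrite (le_trans _ (cw i))// ger_pMl// ler_pdivrMr// mul1r (le_trans g1)// ler1n.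
Qed.

End LyapunovForm.

(** * Global solutions of Lipschitz differential equations *)

Section GeometricLimits.
Variable R : realType.

Lemma half_expr_cvg (C e : R) : 0 < e -> exists n : nat, C * 2^-1 ^+ n < e.
Proof.
move=> e0.
have [C0|C0] := leP C 0.
  by exists 0%N; rewrite expr0 mulr1 (le_lt_trans C0).
have /cvgrPdist_lt /(_ (e / C)) : (fun n => 2^-1 ^+ n : R) @ \oo --> 0.
  by apply: cvg_expr; rewrite gtr0_norm ?invr_gt0// invf_lt1// ltr1n.
rewrite divr_gt0// => /(_ isT)[n _ /(_ n (leqnn n))] /=.
rewrite sub0r normrN gtr0_norm ?exprn_gt0// ltr_pdivlMr// mulrC => h.
by exists n.
Qed.

Lemma half_expr_le0 (x C : R) : (forall n : nat, x <= C * 2^-1 ^+ n) -> x <= 0.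
Proof.
move=> h; rewrite leNgt; apply/negP => x0.
by have [n] := half_expr_cvg C x0; rewrite ltNge h.
Qed.

(** The intervals of radius 2 * C * 2^-1 ^+ n around x n are nested. *)
Lemma geometric_limit (x : nat -> R) (C : R) :
  (forall n, `|x n.+1 - x n| <= C * 2^-1 ^+ n) ->
  exists l, forall n, `|l - x n| <= 2 * C * 2^-1 ^+ n.
Proof.
move=> h; pose q n : R := 2^-1 ^+ n.
have C0 : 0 <= C by have := h 0%N; rewrite expr0 mulr1; apply: le_trans.
have q0 n : 0 < q n by rewrite exprn_gt0// invr_gt0.
have qS n : q n.+1 = q n / 2 by rewrite /q exprS mulrC.
have h' n : - (C * q n) <= x n.+1 - x n <= C * q n by rewrite -ler_norml h.
have upS n : x n - 2 * C * q n <= x n.+1 - 2 * C * q n.+1.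
  by rewrite qS; have /andP[? _] := h' n; lra.
have dnS n : x n.+1 + 2 * C * q n.+1 <= x n + 2 * C * q n.
  by rewrite qS; have /andP[_ ?] := h' n; lra.
have up n m : (n <= m)%N -> x n - 2 * C * q n <= x m - 2 * C * q m.
  exact: (@homo_leq _ (fun n => x n - 2 * C * q n) _ lexx le_trans upS).
have dn n m : (n <= m)%N -> x m + 2 * C * q m <= x n + 2 * C * q n.
  apply: (@homo_leq _ (fun n => x n + 2 * C * q n) (fun a b => b <= a)) => //.
  by move=> a b c ab bc; apply: le_trans bc ab.
have ab n m : x n - 2 * C * q n <= x m + 2 * C * q m.
  have Cq k : 0 <= C * q k by rewrite mulr_ge0// ltW.
  apply: le_trans (up _ _ (leq_maxl n m)) _.
  apply: le_trans (dn _ _ (leq_maxr n m)).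
  by have := Cq (maxn n m); lra.
pose A := [set x n - 2 * C * q n | n in [set: nat]].
exists (sup A) => n.
have ubA m : ubound A (x m + 2 * C * q m) by move=> _ [k _ <-]; exact: ab.
have A0 : A !=set0 by exists (x 0%N - 2 * C * q 0%N), 0%N.
have le1 : x n - 2 * C * q n <= sup A.
  apply: ub_le_sup; first by exists (x 0%N + 2 * C * q 0%N); exact: ubA.
  by exists n.
have le2 : sup A <= x n + 2 * C * q n by apply: ge_sup => //; exact: ubA.
by rewrite -/(q n) ler_norml; apply/andP; split; lra.
Qed.

Lemma mx_geometric_limit m n (x : nat -> 'M[R]_(m, n)) (C : R) :
  (forall k, `|x k.+1 - x k| <= C * 2^-1 ^+ k) ->
  exists l, forall k, `|l - x k| <= 2 * C * 2^-1 ^+ k.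
Proof.
move=> h.
have C0 : 0 <= C by have := h 0%N; rewrite expr0 mulr1; apply: le_trans.
have /choice[l lP] : forall ij : 'I_m * 'I_n, exists l, forall k,
    `|l - x k ij.1 ij.2| <= 2 * C * 2^-1 ^+ k.
  move=> [i j] /=; apply: geometric_limit => k.
  by apply: le_trans (h k); have := mx_entry_le (x k.+1 - x k) i j; rewrite !mxE.
exists (\matrix_(i, j) l (i, j)) => k; apply: mx_norm_le => [|i j].
  by rewrite !mulr_ge0// exprn_ge0// invr_ge0.
by rewrite !mxE; exact: (lP (i, j)).
Qed.

End GeometricLimits.

Section MatrixDerivative.
Variables (R : realType) (m n : nat).
Implicit Types (z : R -> 'M[R]_(m, n)).

Lemma is_derive_mxP z (t : R) (dz : 'M[R]_(m, n)) :
  is_derive t 1 z dz <-> forall i j, is_derive t 1 (fun s => z s i j) (dz i j).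
Proof.
split=> [[d <-] i j|h].
  apply: DeriveDef; first by have /derivable_mxP := d; exact.
  by rewrite derive_mx// mxE.
have d : derivable z t 1 by apply/derivable_mxP => i j; have [] := h i j.
apply: DeriveDef => //; rewrite derive_mx//; apply/matrixP => i j.
by rewrite mxE; have [] := h i j.
Qed.

Lemma is_derive_continuous (V : normedModType R) (z : R -> V) (t : R) dz :
  is_derive t 1 z dz -> {for t, continuous z}.
Proof. by move=> [d _]; apply/differentiable_continuous/derivable1_diffP. Qed.

Lemma growth_bound (g dg h dh : R -> R) (t : R) : 0 <= t ->
  (forall s : R, 0 < s -> is_derive s 1 g (dg s)) ->
  (forall s : R, 0 < s -> is_derive s 1 h (dh s)) ->
  {within `[0, +oo[, continuous g} -> {within `[0, +oo[, continuous h} ->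
  (forall s : R, 0 < s -> dg s <= dh s) -> g t - g 0 <= h t - h 0.
Proof.
move=> t0 gd hd gc hc gh.
suff : h 0 - g 0 <= h t - g t by lra.
apply: (@nondecr_of_derive R (fun s => h s - g s) (fun s => dh s - dg s) 0 t t0).
- move=> s /andP[s0 _]; exact: is_derive1B (hd s s0) (gd s s0).
- by move=> s /andP[s0 _]; rewrite subr_ge0 gh.
- have sub : `[0, t] `<=` `[0, +oo[.
    by move=> s /=; rewrite !in_itv /= andbT => /andP[].
  move=> s; apply: cvgB; [exact: (continuous_subspaceW sub hc)|
    exact: (continuous_subspaceW sub gc)].
Qed.

Lemma mx_growth_bound z (dz : R -> 'M[R]_(m, n)) (h dh : R -> R) (t : R) : 0 <= t ->
  (forall s : R, 0 < s -> is_derive s 1 z (dz s)) ->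
  (forall s : R, 0 < s -> is_derive s 1 h (dh s)) ->
  {within `[0, +oo[, continuous z} -> {within `[0, +oo[, continuous h} ->
  (forall s : R, 0 < s -> `|dz s| <= dh s) -> `|z t - z 0| <= h t - h 0.
Proof.
move=> t0 zd hd zc hc zh.
have zcij i j : {within `[0, +oo[, continuous (fun s => z s i j)}.
  move=> s; apply: (cvg_comp z (fun M : 'M[R]_(m, n) => M i j) (zc s)).
  exact: coord_continuous.
have nd i j s : 0 < s -> `|dz s i j| <= dh s.
  by move=> s0; apply: le_trans (zh s s0); exact: mx_entry_le.
have zdij i j (s : R) : 0 < s -> is_derive s 1 (fun s => z s i j) (dz s i j).
  by move=> s0; apply: (is_derive_mxP _ _ _).1; exact: zd.
have hge : 0 <= h t - h 0.
  rewrite subr_ge0; apply: (@nondecr_of_derive R h dh 0 t t0).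
  - by move=> s /andP[s0 _]; exact: hd.
  - by move=> s /andP[s0 _]; apply: le_trans (zh s s0).
  - apply: continuous_subspaceW hc => s /=.
    by rewrite !in_itv /= andbT => /andP[].
apply: mx_norm_le => // i j; rewrite !mxE ler_norml; apply/andP; split.
  have nzd (s : R) : 0 < s -> is_derive s 1 (fun s => - z s i j) (- dz s i j).
    by move=> s0; exact: is_deriveN (zdij i j s s0).
  have nzc : {within `[0, +oo[, continuous (fun s => - z s i j)}.
    by move=> s; apply: cvgN; exact: zcij.
  have nzh (s : R) : 0 < s -> - dz s i j <= dh s.
    by move=> s0; apply: le_trans (nd i j s s0); rewrite -normrN ler_norm.
  have := growth_bound t0 nzd hd nzc hc nzh.
  by lra.
have zh' (s : R) : 0 < s -> dz s i j <= dh s.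
  by move=> s0; apply: le_trans (nd i j s s0); exact: ler_norm.
exact: growth_bound t0 (zdij i j) hd (zcij i j) hc zh'.
Qed.

End MatrixDerivative.

Section Picard.
Variable R : realType.
Local Notation mu := (@lebesgue_measure R).

Lemma max0_continuous : continuous (fun t : R => Num.max t 0).
Proof. by move=> t; apply: continuous_max; [exact: cvg_id|exact: cvg_cst]. Qed.

Lemma near_gt0_ge0 (t : R) : 0 < t -> \forall s \near t, 0 <= s.
Proof.
move=> t0; have h : (fun x : R => x) @ t --> t by exact: cvg_id.
exact: (cvgr_ge _ h _ t0).
Qed.

(** Integrating from -1 makes every t >= 0 an interior point of the domain of
    integration; the maximum with 0 extends the result to negative times. *)
Lemma antiderivative (g : R -> R) : continuous g ->
  exists G : R -> R, [/\ continuous G, G 0 = 0 &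
    forall t : R, 0 < t -> is_derive t 1 G (g t)].
Proof.
move=> gc; pose I (x : R) : R := (\int[mu]_(s in [set` `[(- 1)%R, x]]) g s)%R.
have Id (x : R) : -1 < x -> is_derive x 1 I (g x).
  move=> x1; have xx1 : x < x + 1 by rewrite ltrDl.
  have gi : mu.-integrable `[-1, x + 1] (EFin \o g).
    apply: continuous_compact_integrable; first exact: segment_compact.
    exact: continuous_subspaceT.
  have [d e] := continuous_FTC1_closed xx1 gi x1 (gc x).
  by apply: DeriveDef; [exact: d|rewrite -derive1E e].
exists (fun t => I (Num.max t 0) - I 0); split.
- move=> t; apply: cvgB; last exact: cvg_cst.
  apply: (@continuous_comp _ _ _ (fun t : R => Num.max t 0) I).
    exact: max0_continuous.
  apply: is_derive_continuous (Id _ _).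
  by rewrite (lt_le_trans _ (_ : 0 <= _))// ?le_max ?lexx ?orbT// ltrN10.
- by rewrite maxxx subrr.
- move=> t t0; have d : is_derive t 1 (fun s => I s - I 0) (g t).
    apply: is_derive_eq (is_derive1B (Id t _) (is_derive_cst (I 0) t 1)) _.
      by rewrite (lt_trans _ t0)// ltrN10.
    by rewrite subr0.
  apply: near_eq_is_derive d.
  near=> s; congr (I _ - _); apply/esym/max_idPl.
  by near: s; exact: near_gt0_ge0.
Unshelve. all: by end_near. Qed.

Lemma lipschitz_continuous (V W : normedModType R) (f : V -> W) (L : R) :
  0 <= L -> (forall X Y, `|f X - f Y| <= L * `|X - Y|) -> continuous f.
Proof.
move=> L0 fL X; apply/cvgrPdist_le => e e0.
have L1 : 0 < L + 1 by rewrite ltr_wpDl.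
near=> Y; rewrite (le_trans (fL _ _))//.
have YX : `|X - Y| <= e / (L + 1).
  by near: Y; apply: cvgr_dist_le; [exact: cvg_id|rewrite divr_gt0].
rewrite (le_trans (ler_wpM2l L0 YX))// mulrCA ger_pMr//.
by rewrite ler_pdivrMr// mul1r lerDl.
Unshelve. all: by end_near. Qed.

Variables m n : nat.

Lemma mx_antiderivative (g : R -> 'M[R]_(m, n)) : continuous g ->
  exists G : R -> 'M[R]_(m, n), [/\ continuous G, G 0 = 0 &
    forall t : R, 0 < t -> is_derive t 1 G (g t)].
Proof.
move=> gc.
have /choice[G GP] : forall ij : 'I_m * 'I_n, exists G : R -> R,
   [/\ continuous G, G 0 = 0 &
    forall t : R, 0 < t -> is_derive t 1 G (g t ij.1 ij.2)].
  move=> [i j]; apply: antiderivative => t.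
  apply: (cvg_comp g (fun M : 'M[R]_(m, n) => M i j) (gc t)).
  exact: coord_continuous.
exists (fun t => \matrix_(i, j) G (i, j) t); split.
- move=> t; apply/mx_cvgP => i j; rewrite mxE.
  under eq_fun do rewrite mxE; have [Gc _ _] := GP (i, j); exact: Gc.
- by apply/matrixP => i j; rewrite !mxE; have [_ -> _] := GP (i, j).
- move=> t t0; apply/is_derive_mxP => i j.
  under eq_fun do rewrite mxE; have [_ _ Gd] := GP (i, j); exact: Gd.
Qed.

Variables (f : 'M[R]_(m, n) -> 'M[R]_(m, n)) (L : R).
Hypotheses (L0 : 0 <= L) (fL : forall X Y, `|f X - f Y| <= L * `|X - Y|).

(** Picard iteration on the whole half line: measured against expR (K * t) with
    K > 2 * L, each iteration at least halves the distance of successive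
    iterates. *)
Lemma picard (z0 : 'M[R]_(m, n)) : exists z : R -> 'M[R]_(m, n),
  [/\ continuous z, z 0 = z0 & forall t : R, 0 < t -> is_derive t 1 z (f (z t))].
Proof.
(* A total choice of antiderivatives; its value at a discontinuous g is
   irrelevant. *)
have /choice[I IP] : forall g : R -> 'M[R]_(m, n), exists G : R -> 'M[R]_(m, n),
   continuous g -> [/\ continuous G, G 0 = 0 &
     forall t : R, 0 < t -> is_derive t 1 G (g t)].
  move=> g; have [gc|ngc] := pselect (continuous g); last by exists g.
  by have [G GP] := mx_antiderivative gc; exists G.
pose step (z : R -> 'M[R]_(m, n)) t := z0 + I (f \o z) t.
have stepP z : continuous z -> [/\ continuous (step z), step z 0 = z0 &
    forall t : R, 0 < t -> is_derive t 1 (step z) (f (z t))].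
  move=> zc; have [|Gc G0 Gd] := IP (f \o z).
    by move=> t; apply: continuous_comp; [exact: zc|exact: lipschitz_continuous L0 fL _].
  split.
  - by move=> t; apply: cvgD; [exact: cvg_cst|exact: Gc].
  - by rewrite /step G0 addr0.
  - move=> t t0; apply: is_derive_eq (is_deriveD (is_derive_cst z0 t 1) (Gd t t0)) _.
    by rewrite add0r.
pose Z k := iter k step (cst z0).
have Zc k : continuous (Z k).
  elim: k => [|k IHk]; first by move=> t; exact: cvg_cst.
  by have [] := stepP _ IHk.
have ZS0 k : Z k 0 = z0 by case: k => [//|k]; have [] := stepP _ (Zc k).
have ZSd k (t : R) : 0 < t -> is_derive t 1 (Z k.+1) (f (Z k t)).
  by have [_ _] := stepP _ (Zc k); exact.
pose K := 2 * L + 1.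
have K0 : 0 < K by rewrite ltr_wpDl// mulr_ge0.
have [C C0 CK] : exists2 C : R, 0 <= C & C * K = `|f z0|.
  by exists (`|f z0| / K); [rewrite divr_ge0// ltW|rewrite divfK// gt_eqF].
have expd (c t : R) : is_derive t 1 (fun t : R => c * expR (K * t)) (c * (K * expR (K * t))).
  exact: is_derive1Z (is_derive1_expR K t).
have expc c : {within `[0, +oo[, continuous (fun t : R => c * expR (K * t))}.
  by apply: continuous_subspaceT => t; exact: is_derive_continuous (expd c t).
have gb (z1 z2 d1 d2 : R -> 'M[R]_(m, n)) (c t : R) : 0 <= c -> 0 <= t ->
    (forall s : R, 0 < s -> is_derive s 1 z1 (d1 s)) -> continuous z1 ->
    (forall s : R, 0 < s -> is_derive s 1 z2 (d2 s)) -> continuous z2 ->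
    z1 0 = z2 0 ->
    (forall s : R, 0 < s -> `|d1 s - d2 s| <= c * K * expR (K * s)) ->
    `|z1 t - z2 t| <= c * expR (K * t).
  move=> c0 t0 z1d z1c z2d z2c z00 dzh.
  have zd (s : R) : 0 < s -> is_derive s 1 (fun s => z1 s - z2 s) (d1 s - d2 s).
    by move=> s0; exact: is_deriveB (z1d s s0) (z2d s s0).
  have zc : continuous (fun s => z1 s - z2 s).
    by move=> s; apply: cvgB; [exact: z1c|exact: z2c].
  have dzh' (s : R) : 0 < s -> `|d1 s - d2 s| <= c * (K * expR (K * s)).
    by rewrite mulrA; exact: dzh.
  have := mx_growth_bound t0 zd (fun s _ => expd c s) (continuous_subspaceT zc)
    (expc c) dzh'.
  by rewrite z00 subrr subr0 mulr0 expR0 mulr1 => h; rewrite (le_trans h)// gerBl.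
have LK (c : R) : 0 <= c -> L * c <= c / 2 * K.
  by move=> c0; have := mulr_ge0 L0 c0; rewrite /K; lra.
have dZ k (t : R) : 0 <= t -> `|Z k.+1 t - Z k t| <= C * 2^-1 ^+ k * expR (K * t).
  elim: k t => [|k IHk] t t0.
    rewrite expr0 mulr1.
    apply: (gb (Z 1%N) (cst z0) (fun=> f z0) (cst 0)); [exact: C0|exact: t0|..].
    - exact: Zc.
    - by move=> s; exact: cvg_cst.
    - exact: ZS0.
    - move=> s s0; rewrite subr0 CK ler_peMr//.
      by rewrite -expR0 ler_expR mulr_ge0// ltW.
  have Ck : 0 <= C * 2^-1 ^+ k.+1 by rewrite mulr_ge0// exprn_ge0// invr_ge0.
  have e0 : Z k.+2 0 = Z k.+1 0 by rewrite !ZS0.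
  apply: (gb _ _ _ _ _ _ Ck t0 (ZSd k.+1) (Zc _) (ZSd k) (Zc _) e0) => s s0.
  apply: le_trans (fL _ _) _; apply: le_trans (ler_wpM2l L0 (IHk s (ltW s0))) _.
  rewrite mulrA ler_wpM2r ?expR_ge0//.
  have -> : C * 2^-1 ^+ k.+1 = C * 2^-1 ^+ k / 2 by rewrite exprS; ring.
  by apply: LK; rewrite mulr_ge0// exprn_ge0// invr_ge0.
have /choice[l lP] : forall t : R, exists l, forall k,
    0 <= t -> `|l - Z k t| <= 2 * (C * expR (K * t)) * 2^-1 ^+ k.
  move=> t; have [t0|t0] := leP 0 t; last by exists 0.
  have [k|l lP] := @mx_geometric_limit R m n (fun k => Z k t) (C * expR (K * t)).
    by rewrite mulrAC; exact: dZ.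
  by exists l.
(* The iterates are controlled for t >= 0 only, so the limit is frozen at its
   initial value for negative times. *)
pose z t := l (Num.max t 0).
have zP k (t : R) : 0 <= t -> `|z t - Z k t| <= 2 * C * 2^-1 ^+ k * expR (K * t).
  by move=> t0; rewrite /z (max_idPl t0) [leRHS]mulrAC -(mulrA 2); exact: lP.
have zmax t : z t = z (Num.max t 0) by rewrite /z -maxA maxxx.
have zc : continuous z.
  move=> t; apply/cvgrPdist_le => e e0.
  have e3 : 0 < e / 3 by rewrite divr_gt0.
  pose M := expR (K * (`|t| + 1)).
  have [k kP] := half_expr_cvg (2 * C * M) e3.
  have bnd (s : R) : `|s| <= `|t| + 1 -> `|z s - Z k (Num.max s 0)| <= e / 3.
    move=> st; rewrite zmax; have s0 : 0 <= Num.max s 0 by rewrite le_max lexx orbT.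
    apply: le_trans (zP k _ s0) _; apply: le_trans (ltW kP).
    rewrite [leRHS](mulrAC _ M); apply: ler_wpM2l.
      by rewrite !mulr_ge0// exprn_ge0// invr_ge0.
    rewrite /M ler_expR ler_wpM2l ?(ltW K0)// ge_max addr_ge0// andbT.
    by apply: le_trans st; exact: ler_norm.
  have ZMc : {for t, continuous (fun s : R => Z k (Num.max s 0))}.
    apply: (@continuous_comp _ _ _ (fun t : R => Num.max t 0) (Z k)).
      exact: max0_continuous.
    exact: Zc.
  near=> s.
  have h1 : `|Z k (Num.max t 0) - Z k (Num.max s 0)| <= e / 3.
    by near: s; exact: (cvgrPdist_le _ _).1 ZMc _ e3.
  have h2 := bnd t _; have h3 := bnd s _.
  rewrite (_ : z t - z s = (z t - Z k (Num.max t 0)) +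
    (Z k (Num.max t 0) - Z k (Num.max s 0)) - (z s - Z k (Num.max s 0))); last first.
    by rewrite opprB !subrKA.
  rewrite (le_trans (ler_normB _ _))// (_ : e = e / 3 + e / 3 + e / 3); last by field.
  apply: lerD; last first.
    apply: h3; have ts : `|t - s| <= 1.
      by near: s; apply: cvgr_dist_le; [exact: cvg_id|exact: ltr01].
    rewrite -[s](subrK t) addrC (le_trans (ler_normD _ _))// lerD2l distrC//.
  rewrite (le_trans (ler_normD _ _))// lerD// h2// lerDl.
  exact: ler01.
have [wc w0 wd] := stepP z zc.
(* The limit is a fixed point of the iteration. *)
have wz (t : R) : 0 <= t -> step z t = z t.
  move=> t0; apply/eqP; rewrite -subr_eq0 -normr_le0.
  apply: (@half_expr_le0 R _ (3 * C * expR (K * t))) => k.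
  have h1 : `|step z t - Z k.+1 t| <= C * 2^-1 ^+ k * expR (K * t).
    have Ck : 0 <= C * 2^-1 ^+ k by rewrite mulr_ge0// exprn_ge0// invr_ge0.
    have e0 : step z 0 = Z k.+1 0 by rewrite ZS0 w0.
    apply: (gb _ _ _ _ _ _ Ck t0 wd wc (ZSd k) (Zc _) e0) => s s0.
    apply: le_trans (fL _ _) _; apply: le_trans (ler_wpM2l L0 (zP k s (ltW s0))) _.
    rewrite mulrA ler_wpM2r ?expR_ge0//.
    have -> : C * 2^-1 ^+ k = 2 * C * 2^-1 ^+ k / 2 by field.
    by apply: LK; rewrite !mulr_ge0// exprn_ge0// invr_ge0.
  have h2 := zP k.+1 t t0.
  rewrite (_ : step z t - z t = (step z t - Z k.+1 t) - (z t - Z k.+1 t)); last first.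
    by rewrite opprB subrKA.
  apply: le_trans (ler_normB _ _) _; apply: le_trans (lerD h1 h2) _.
  have q0 : 0 <= C * expR (K * t) * 2^-1 ^+ k.
    by rewrite mulr_ge0 ?exprn_ge0 ?invr_ge0// mulr_ge0// expR_ge0.
  rewrite exprS; lra.
exists z; split=> //.
  by rewrite -wz// w0.
move=> t t0; apply: near_eq_is_derive (wd t t0).
near=> s; apply: wz; near: s; exact: near_gt0_ge0.
Unshelve. all: by end_near. Qed.

End Picard.

(** * The opinion dynamics as a matrix equation *)

(** Sigmoids acting entrywise on linearly mixed opinions; by [fieldE] this is
    all that the projection lets through of the saturated terms. *)
Definition response (R : realType) n m (g1 g2 : R -> R) (A B : 'M[R]_n)
    (X : 'M[R]_(n, m)) : 'M[R]_(n, m) :=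
  map_mx g1 (A *m X) - map_mx g2 (B *m X).

Definition gainS (R : realType) n (p : params R n) : 'M[R]_n :=
  (palpha p)%:M + pGamma p.
Definition gainD (R : realType) n (p : params R n) : 'M[R]_n :=
  (pbeta p)%:M + pDelta p.

Section Response.
Variables (R : realType) (n m : nat) (g1 g2 : R -> R) (A B : 'M[R]_n).
Hypotheses (hg1 : strict1 g1) (hg2 : strict1 g2).
Local Notation E := 'M[R]_(n, m).

(** The nonlinear part of the response when both nonlinearities have derivative
    1 at 0. *)
Definition remainder (X : E) : E := response g1 g2 A B X - (A - B) *m X.

Lemma remainder0 : remainder 0 = 0.
Proof.
have [g10 _] := hg1; have [g20 _] := hg2.
rewrite /remainder /response !mulmx0 subr0; apply/matrixP => i j.
by rewrite !mxE g10 g20 subr0.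
Qed.

Let bigbound (D : 'M[R]_n) (r : R) : 0 < r -> exists2 d : R, 0 < d &
  forall X : E, `|X| <= d -> `|D *m X| <= r.
Proof.
move=> r0; pose c := n%:R * `|D| + 1.
have c0 : 0 < c by rewrite ltr_wpDl// mulr_ge0.
exists (r / c); first by rewrite divr_gt0.
move=> X Xr; apply: le_trans (mx_norm_mul _ _) _.
have h : n%:R * `|D| <= c by rewrite lerDl.
rewrite (le_trans (ler_pM _ _ h Xr))// ?mulr_ge0//.
by rewrite mulrC divfK// gt_eqF.
Qed.

Lemma remainder_lip (e : R) : 0 < e -> exists2 d : R, 0 < d &
  forall X Y : E, `|X| <= d -> `|Y| <= d ->
    `|remainder X - remainder Y| <= e * `|X - Y|.
Proof.
move=> e0; pose c := n%:R * `|A| + n%:R * `|B| + 1.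
have nA : 0 <= n%:R * `|A| by rewrite mulr_ge0.
have nB : 0 <= n%:R * `|B| by rewrite mulr_ge0.
have c0 : 0 < c by rewrite ltr_wpDl// addr_ge0.
have ec0 : 0 < e / c by rewrite divr_gt0.
have [r1 r10 h1] := hg1.2 _ ec0; have [r2 r20 h2] := hg2.2 _ ec0.
have [d1 d10 k1] := bigbound A r10; have [d2 d20 k2] := bigbound B r20.
exists (Num.min d1 d2); first by rewrite lt_min d10.
move=> X Y; rewrite !le_min => /andP[X1 X2] /andP[Y1 Y2].
have small i j (D : 'M[R]_n) r : `|D *m X| <= r -> `|(D *m X) i j| <= r.
  by apply: le_trans; exact: mx_entry_le.
have smallY i j (D : 'M[R]_n) r : `|D *m Y| <= r -> `|(D *m Y) i j| <= r.
  by apply: le_trans; exact: mx_entry_le.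
have dist (D : 'M[R]_n) i j : `|(D *m X) i j - (D *m Y) i j| <= n%:R * `|D| * `|X - Y|.
  apply: le_trans (mx_norm_mul _ _); rewrite mulmxBr.
  by have := mx_entry_le (D *m X - D *m Y) i j; rewrite !mxE.
apply: mx_norm_le => [|i j]; first by rewrite mulr_ge0// ltW.
have -> : (remainder X - remainder Y) i j =
   ((g1 ((A *m X) i j) - (A *m X) i j) - (g1 ((A *m Y) i j) - (A *m Y) i j)) -
   ((g2 ((B *m X) i j) - (B *m X) i j) - (g2 ((B *m Y) i j) - (B *m Y) i j)).
  rewrite /remainder /response !mulmxBl.
  move: (A *m X) (B *m X) (A *m Y) (B *m Y) => a b a' b'.
  by rewrite !mxE; ring.
apply: le_trans (ler_normB _ _) _.
apply: le_trans (lerD (h1 _ _ (small _ _ _ _ (k1 X X1)) (smallY _ _ _ _ (k1 Y Y1)))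
  (h2 _ _ (small _ _ _ _ (k2 X X2)) (smallY _ _ _ _ (k2 Y Y2)))) _.
rewrite -mulrDr; apply: le_trans (ler_wpM2l (ltW ec0) (lerD (dist _ _ _) (dist _ _ _))) _.
rewrite -mulrDl mulrA ler_wpM2r// mulrAC ler_pdivrMr// ler_wpM2l ?(ltW e0)//.
by rewrite lerDl.
Qed.

Lemma remainder_small (e : R) : 0 < e -> exists2 d : R, 0 < d &
  forall X : E, `|X| <= d -> `|remainder X| <= e * `|X|.
Proof.
move=> e0; have [d d0 h] := remainder_lip e0; exists d => // X Xd.
have := h X 0 Xd; rewrite normr0 remainder0 !subr0; apply; exact: ltW.
Qed.

Lemma responseE (X : E) : response g1 g2 A B X = (A - B) *m X + remainder X.
Proof. by rewrite /remainder addrC subrK. Qed.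

End Response.

Section Projection.
Variables (R : realType) (Na No : nat).
Local Notation P := (P0 R No).
Local Notation E := 'M[R]_(Na, No).

Lemma P0_tr : P^T = P.
Proof. by rewrite /P0 linearB /= linearZ /= trmx_mul trmxK trmx1. Qed.

Lemma VP (Z : E) : V Z <-> Z *m ones R No = 0.
Proof.
split=> [VZ|Z1 i]; first by apply/row_matrixP => i; rewrite row_mul row0; exact: VZ.
by rewrite /ones_perp /= -row_mul Z1 row0.
Qed.

Lemma mulmx_P0 (Z : E) : V Z -> Z *m P = Z.
Proof.
by move=> /VP Z1; rewrite /P0 mulmxBr mulmx1 -scalemxAr mulmxA Z1 mul0mx scaler0 subr0.
Qed.

Hypothesis No0 : (0 < No)%N.

Lemma ones_norm : (ones R No)^T *m ones R No = (No%:R)%:M.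
Proof.
apply/matrixP => i j; rewrite !mxE !ord1.
under eq_bigr do rewrite !mxE mulr1.
by rewrite sumr_const card_ord mulr1n.
Qed.

Lemma P0_ones : P *m ones R No = 0.
Proof.
rewrite /P0 mulmxBl mul1mx -scalemxAl -mulmxA ones_norm mul_mx_scalar scalerA.
by rewrite mulVf ?pnatr_eq0 ?gt_eqF// scale1r subrr.
Qed.

Lemma ones_P0 : (ones R No)^T *m P = 0.
Proof. by apply: trmx_inj; rewrite trmx_mul trmxK P0_tr P0_ones trmx0. Qed.

Lemma V_mul_P0 (Z : E) : V (Z *m P).
Proof. by apply/VP; rewrite -mulmxA P0_ones mulmx0. Qed.

End Projection.

Section Field.
Variables (R : realType) (Na No : nat) (S1 S2 : R -> R) (p : params R Na).
Local Notation P := (P0 R No).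
Local Notation E := 'M[R]_(Na, No).
Hypotheses (No0 : (0 < No)%N).
Hypotheses (Gam0 : forall i, pGamma p i i = 0) (Del0 : forall i, pDelta p i i = 0).

Local Notation resp := (response S1 S2 (gainS p) (gainD p)).

(** The sum over the other options differs from the sum over all options by the
    own option term; the sum over all options is constant along a row, and the
    projection kills it. *)
Lemma fieldE (u : R) (Z : E) :
  field S1 S2 p u Z = (- pd p *: Z + u *: resp Z) *m P.
Proof.
have off (M : 'M[R]_Na) (a : R) i j : M i i = 0 ->
    a * Z i j + \sum_(k < Na | k != i) M i k * Z k j = ((a%:M + M) *m Z) i j.
  move=> Mii; rewrite mulmxDl mul_scalar_mx ![in RHS]mxE; congr (_ + _).
  by rewrite [RHS](bigD1 i)//= Mii mul0r add0r.
pose T := map_mx S2 (gainD p *m Z).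
have drE : drive S1 S2 p u Z =
    (- pd p *: Z + u *: resp Z) + u *: (T *m ones R No *m (ones R No)^T).
  apply/matrixP => i j; rewrite ![in LHS]mxE (off _ _ _ _ (Gam0 i)).
  under eq_bigr do rewrite (off _ _ _ _ (Del0 i)).
  have -> : \sum_(l < No | l != j) S2 ((((pbeta p)%:M + pDelta p) *m Z) i l) =
     (T *m ones R No *m (ones R No)^T) i j - T i j.
    have -> : (T *m ones R No *m (ones R No)^T) i j = \sum_l T i l.
      rewrite mxE big_ord1 [_^T 0 j]mxE [const_mx _ _ _]mxE mulr1 mxE.
      by apply: eq_bigr => l _; rewrite [const_mx _ _ _]mxE mulr1.
    rewrite [in RHS](bigD1 j)//= addrAC subrr add0r.
    by apply: eq_bigr => l _; rewrite [T i l]mxE.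
  rewrite /response -/T -/(gainS p).
  move: T (gainS p *m Z) (T *m ones R No *m (ones R No)^T) => T X C.
  by rewrite !mxE; ring.
rewrite /field P0_tr drE mulmxDl -[X in _ + X]scalemxAl -mulmxA ones_P0//.
by rewrite mulmx0 scaler0 addr0.
Qed.

Definition lin (u : R) : 'M[R]_Na := (- pd p)%:M + u *: (gainS p - gainD p).

Lemma field_remainder (u : R) (Z : E) : field S1 S2 p u Z =
  lin u *m Z *m P + u *: (remainder S1 S2 (gainS p) (gainD p) Z *m P).
Proof.
rewrite fieldE responseE scalerDr addrA mulmxDl -(scalemxAl u); congr (_ *m _ + _).
by rewrite /lin [in RHS]mulmxDl mul_scalar_mx -[in RHS]scalemxAl.
Qed.

Hypotheses (hS1 : strict1 S1) (hS2 : strict1 S2).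

(** By [field_remainder] the field is this linear map up to a remainder of order
    o(|X|). *)
Lemma neutral_jacobianE (u : R) (X : E) :
  neutral_jacobian S1 S2 p u X = lin u *m X *m P.
Proof.
pose df (X : E) : E := lin u *m X *m P.
have dfl : linear df.
  by move=> a Y Z; rewrite /df (mulmxDr (lin u)) -(scalemxAr a) (mulmxDl _ _ P) -(scalemxAl a).
pose dfL := GRing.isLinear.Build R E E _ df dfl.
pose F : {linear E -> E} := HB.pack df dfL.
suff : neutral_jacobian S1 S2 p u = F :> (E -> E) by move=> ->.
have f0 : field S1 S2 p u 0 = 0 :> E.
  by rewrite field_remainder remainder0// mulmx0 !mul0mx scaler0 addr0.
apply: diff_unique.
  apply: (@lipschitz_continuous R E E F (Na%:R * `|lin u| * (No%:R * `|P|))).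
    by rewrite !mulr_ge0.
  move=> Y Z; rewrite -linearB /=.
  apply: le_trans (mx_norm_mul _ _) _.
  have := ler_wpM2r (normr_ge0 P) (ler_wpM2l (ler0n R No) (mx_norm_mul (lin u) (Y - Z))).
  by move=> h; apply: le_trans h _; rewrite le_eqVlt; apply/orP; left; apply/eqP; ring.
apply/eqaddoP => e e0.
pose c := `|u| * (No%:R * `|P|) + 1.
have c0 : 0 < c by rewrite ltr_wpDl// !mulr_ge0.
have [d d0 h] := @remainder_small R Na No S1 S2 (gainS p) (gainD p) hS1 hS2 _ (divr_gt0 e0 c0).
near=> Y.
rewrite /= !fctE /= f0 addr0 add0r field_remainder addrAC subrr add0r normrZ.
have Yd : `|Y| <= d.
  by near: Y; exact: (@nbhs0_le R E d d0).
have h1 := h Y Yd.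
have h2 := mx_norm_mul (remainder S1 S2 (gainS p) (gainD p) Y) P.
apply: le_trans (ler_wpM2l (normr_ge0 u) h2) _.
have h3 : `|u| * (No%:R * `|P|) <= c by rewrite lerDl.
rewrite (_ : _ * (_ * _ * _) = `|u| * (No%:R * `|P|) *
  `|remainder S1 S2 (gainS p) (gainD p) Y|); last by ring.
apply: le_trans (ler_pM _ _ h3 h1) _.
- by rewrite !mulr_ge0.
- by [].
- by rewrite mulrA (mulrC c) divfK// gt_eqF.
Unshelve. all: by end_near. Qed.

End Field.

(** * Energy estimates *)

Section Energy.
Variables (R : realType) (n m : nat) (H : 'M[R]_n).
Local Notation E := 'M[R]_(n, m).

Lemma formDr (X Y Z : E) : form H X (Y + Z) = form H X Y + form H X Z.
Proof. by rewrite /form mulmxDr mxtraceD. Qed.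

Lemma formZr (a : R) (X Y : E) : form H X (a *: Y) = a * form H X Y.
Proof. by rewrite /form -scalemxAr mxtraceZ. Qed.

Lemma formC (X Y : E) : H^T = H -> form H X Y = form H Y X.
Proof. by move=> HT; rewrite /form -mxtrace_tr !trmx_mul trmxK HT mulmxA. Qed.

Lemma form_bound : exists2 c : R, 0 < c &
  forall X Y : E, `|form H X Y| <= c * `|X| * `|Y|.
Proof.
exists (m%:R * (n%:R * (n%:R * `|H|)) + 1); first by rewrite ltr_wpDl// !mulr_ge0.
move=> X Y; rewrite formE.
apply: (@le_trans _ _ (m%:R * (n%:R * (n%:R * `|H|)) * `|X| * `|Y|)); last first.
  by rewrite !ler_wpM2r// lerDl.
apply: (@le_trans _ _ (\sum_(k < m) \sum_(i < n) \sum_(j < n) `|X| * `|H| * `|Y|)).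
  rewrite (le_trans (ler_norm_sum _ _ _))//; apply: ler_sum => k _.
  rewrite (le_trans (ler_norm_sum _ _ _))//; apply: ler_sum => i _.
  rewrite (le_trans (ler_norm_sum _ _ _))//; apply: ler_sum => j _.
  by rewrite !normrM !ler_pM ?mx_entry_le// mulr_ge0.
rewrite !sumr_const !card_ord -!mulrnA -[leLHS]mulr_natl !natrM.
by rewrite le_eqVlt; apply/orP; left; apply/eqP; ring.
Qed.

Lemma form1_ge (X : E) : `|X| ^+ 2 <= form 1%:M X X.
Proof.
have nn : 0 <= form 1%:M X X.
  rewrite -diag_const_mx form_diag sumr_ge0// => k _; rewrite sumr_ge0// => i _.
  by rewrite mxE mul1r -expr2 sqr_ge0.
have [->|X0] := eqVneq X 0; first by rewrite normr0 expr0n /= /form mulmx0 mxtrace0.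
have [i [k ->]] := mx_norm_attained X0.
rewrite -diag_const_mx form_diag (bigD1 k)//= (bigD1 i)//= mxE mul1r real_normK ?num_real//.
rewrite -addrA -expr2 lerDl addr_ge0// sumr_ge0// => j _.
  by rewrite mxE mul1r -expr2 sqr_ge0.
by rewrite sumr_ge0// => l _; rewrite mxE mul1r -expr2 sqr_ge0.
Qed.

Lemma is_derive_form (z : R -> E) (t : R) (dz : E) : H^T = H ->
  is_derive t 1 z dz ->
  is_derive t 1 (fun s => form H (z s) (z s)) (2 * form H (z t) dz).
Proof.
move=> HT /is_derive_mxP zd.
under eq_fun do rewrite formE.
have -> : 2 * form H (z t) dz = form H dz (z t) + form H (z t) dz.
  by rewrite (formC _ _ HT) mulr_natl mulr2n.
rewrite !formE -big_split; apply: is_derive1_sum => k.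
rewrite -big_split; apply: is_derive1_sum => i.
rewrite -big_split; apply: is_derive1_sum => j.
have e : is_derive t 1 (fun s => z s i k * H i j) (dz i k * H i j).
  apply: is_derive_eq (is_derive1M (zd i k) (is_derive_cst (H i j) t 1)) _.
  by rewrite mulr0 addr0.
exact: is_derive1M e (zd j k).
Qed.

Lemma form_continuous (T : topologicalType) (A : set T) (z : T -> E) :
  {within A, continuous z} -> {within A, continuous (fun s => form H (z s) (z s))}.
Proof.
move=> zc x; rewrite /continuous_at; under eq_fun do rewrite formE; rewrite /=.
have c i j : z s i j @[s --> (x : subspace A)] --> z x i j by apply: (mx_cvgP _ _ _).1; exact: zc.
apply: cvg_sumr => k; apply: cvg_sumr => i; apply: cvg_sumr => j.
apply: cvgM; last exact: c.
by apply: cvgM; [exact: c|exact: cvg_cst].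
Qed.

End Energy.
Arguments form_continuous {R n m} H {T A z}.

Section HalfLine.
Variable R : realType.

Lemma half_line_extension (T : topologicalType) (z : R -> T) :
  {within `[0, +oo[, continuous z} -> continuous (fun t : R => z (Num.max t 0)).
Proof.
move=> /subspace_continuousP zc t.
have A0 (s : R) : `[0, +oo[%classic (Num.max s 0).
  by rewrite /= in_itv /= andbT le_max lexx orbT.
apply: (cvg_comp (fun t : R => Num.max t 0) z _ (zc _ (A0 t))).
move=> P PP.
have H : nbhs t [set s : R | `[0, +oo[%classic (Num.max s 0) -> P (Num.max s 0)].
  exact: max0_continuous PP.
change (nbhs t [set s : R | P (Num.max s 0)]).
by apply: filterS H => s /= h; apply: h; exact: A0.
Qed.

(** At the first time at which phi reaches m, phi has been nonincreasing since
    time 0 and is thus at most phi 0 < m. *)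
Lemma barrier (phi dphi : R -> R) (m : R) :
  {within `[0, +oo[, continuous phi} ->
  (forall t : R, 0 < t -> is_derive t 1 phi (dphi t)) ->
  (forall t : R, 0 < t -> phi t < m -> dphi t <= 0) ->
  phi 0 < m -> forall t : R, 0 <= t -> phi t < m.
Proof.
move=> phic phid dneg phi0 t1 t10; rewrite ltNge; apply/negP => mt1.
pose psi (t : R) := phi (Num.max t 0).
have psic : continuous psi := half_line_extension phic.
have psiE (t : R) : 0 <= t -> psi t = phi t by move=> t0; rewrite /psi (max_idPl t0).
pose K := `[0, t1]%classic `&` [set t | m <= psi t].
have cK : compact K.
  apply: compact_closedI; first exact: segment_compact.
  apply: (@preimage_closed _ _ psi [set x | m <= x]); last exact: closed_ge.
  by move=> t _; exact: psic.
have K0 : K !=set0.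
  by exists t1; split; rewrite /= ?in_itv /= ?t10 ?lexx ?psiE.
have [|T /set_mem[]] := @compact_EVT_min _ R id K K0 cK.
  by apply: continuous_subspaceT => t; exact: cvg_id.
rewrite /= in_itv /= => /andP[T0 Tt1] mT Tmin.
have below (s : R) : 0 <= s -> s < T -> phi s < m.
  move=> s0 sT; rewrite ltNge; apply/negP => ms.
  have : T <= s.
    apply: Tmin; rewrite inE; split; rewrite /= ?psiE// in_itv /= s0.
    by rewrite (le_trans (ltW sT)).
  by rewrite leNgt sT.
have nd (s : R) : 0 < s < T -> is_derive s 1 (fun s => - phi s) (- dphi s).
  by move=> /andP[s0 _]; exact: is_deriveN (phid s s0).
have nc : {within `[0, T], continuous (fun s => - phi s)}.
  move=> s; apply: cvgN; apply: (continuous_subspaceW _ phic) => x /=.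
  by rewrite !in_itv /= andbT => /andP[].
have npos (s : R) : 0 < s < T -> 0 <= - dphi s.
  by move=> /andP[s0 sT]; rewrite oppr_ge0 dneg// below// ltW.
have := nondecr_of_derive T0 nd npos nc.
rewrite lerN2 => h; move: mT; rewrite psiE// leNgt => /negP; apply.
exact: le_lt_trans h phi0.
Qed.

(** The product phi t * expR (- a * t) is nonincreasing. *)
Lemma decay_bound (phi dphi : R -> R) (a : R) :
  {within `[0, +oo[, continuous phi} ->
  (forall t : R, 0 < t -> is_derive t 1 phi (dphi t)) ->
  (forall t : R, 0 < t -> dphi t <= a * phi t) ->
  forall t : R, 0 <= t -> phi t <= phi 0 * expR (a * t).
Proof.
move=> phic phid le t t0.
pose psi (s : R) := - (phi s * expR (- a * s)).
have psid (s : R) : 0 < s < t -> is_derive s 1 psi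
    (- (dphi s * expR (- a * s) + phi s * (- a * expR (- a * s)))).
  move=> /andP[s0 _]; apply: is_deriveN.
  exact: is_derive1M (phid s s0) (is_derive1_expR (- a) s).
have psi0 (s : R) : 0 < s < t ->
    0 <= - (dphi s * expR (- a * s) + phi s * (- a * expR (- a * s))).
  move=> /andP[s0 _].
  have -> : - (dphi s * expR (- a * s) + phi s * (- a * expR (- a * s))) =
    (a * phi s - dphi s) * expR (- a * s) by ring.
  by rewrite mulr_ge0 ?expR_ge0// subr_ge0 le.
have psic : {within `[0, t], continuous psi}.
  move=> s; apply: cvgN; apply: cvgM.
    apply: (continuous_subspaceW _ phic) => x /=.
    by rewrite !in_itv /= andbT => /andP[].
  apply: continuous_subspaceT => x.
  exact: is_derive_continuous (is_derive1_expR (- a) x).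
have := nondecr_of_derive t0 psid psi0 psic.
rewrite /psi lerN2 mulr0 expR0 mulr1 mulNr expRN => h.
by rewrite -ler_pdivrMr ?expR_gt0.
Qed.

End HalfLine.

(** * Global existence for the opinion dynamics *)

Section GlobalSolutions.
Variables (R : realType) (Na No : nat) (S1 S2 : R -> R) (p : params R Na).
Local Notation P := (P0 R No).
Local Notation E := 'M[R]_(Na, No).
Hypotheses (No0 : (0 < No)%N) (d0 : 0 < pd p).
Hypotheses (Gam0 : forall i, pGamma p i i = 0) (Del0 : forall i, pDelta p i i = 0).
Variable k : R.
Hypotheses (S1k : forall x, `|S1 x| <= k) (S2k : forall x, `|S2 x| <= k).
Hypothesis S1lip : forall K : R, 0 <= K -> exists2 L : R, 0 <= L &
  forall x y, `|x| <= K -> `|y| <= K -> `|S1 x - S1 y| <= L * `|x - y|.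
Hypothesis S2lip : forall K : R, 0 <= K -> exists2 L : R, 0 <= L &
  forall x y, `|x| <= K -> `|y| <= K -> `|S2 x - S2 y| <= L * `|x - y|.

Lemma is_derive_mulmxr m n q (z : R -> 'M[R]_(m, n)) (D : 'M[R]_(n, q)) (t : R) dz :
  is_derive t 1 z dz -> is_derive t 1 (fun s => z s *m D) (dz *m D).
Proof.
move=> /is_derive_mxP zd; apply/is_derive_mxP => i j.
under eq_fun do rewrite mxE; rewrite mxE; apply: is_derive1_sum => l.
apply: is_derive_eq (is_derive1M (zd i l) (is_derive_cst (D l j) t 1)) _.
by rewrite mulr0 addr0.
Qed.

Lemma mulmxr_continuous m n q (D : 'M[R]_(n, q)) : continuous (fun X : 'M[R]_(m, n) => X *m D).
Proof.
apply: (@lipschitz_continuous R _ _ _ (n%:R * `|D|)); first by rewrite mulr_ge0.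
by move=> X Y; rewrite -mulmxBl mulrAC; exact: mx_norm_mul.
Qed.

Definition clip (K x : R) : R := Num.max (- K) (Num.min K x).

Lemma clip_le (K x : R) : 0 <= K -> `|clip K x| <= K.
Proof.
move=> K0; rewrite ler_norml /clip le_max lexx /= ge_max ge_min lexx /=.
by rewrite andbT (le_trans _ K0)// oppr_le0.
Qed.

Lemma clip_id (K x : R) : `|x| <= K -> clip K x = x.
Proof.
by rewrite ler_norml => /andP[a b]; rewrite /clip (min_idPr b) (max_idPr a).
Qed.

Lemma clip_lip (K x y : R) : 0 <= K -> `|clip K x - clip K y| <= `|x - y|.
Proof.
move=> K0; rewrite /clip.
wlog xy : x y / x <= y => [hw|].
  by have [/hw//|/ltW/hw] := leP x y; rewrite distrC (distrC x).
have yx0 : 0 <= y - x by rewrite subr_ge0.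
have mono : Num.min K x <= Num.min K y by rewrite le_min !ge_min lexx /= xy orbT.
have step : Num.min K y <= Num.min K x + (y - x).
  case: (leP K x) => _; rewrite ge_min; last by rewrite subrKC lexx orbT.
  by rewrite lerDl yx0.
have cmono : Num.max (- K) (Num.min K x) <= Num.max (- K) (Num.min K y).
  by rewrite ge_max !le_max lexx mono orbT.
have cstep : Num.max (- K) (Num.min K y) <= Num.max (- K) (Num.min K x) + (y - x).
  rewrite ge_max; apply/andP; split.
    by rewrite -[leLHS]addr0 lerD// le_max lexx.
  by apply: le_trans step _; rewrite lerD2r le_max lexx orbT.
by rewrite distrC ger0_norm ?subr_ge0// distrC ger0_norm// lerBlDl.
Qed.

Lemma response_lip (g1 g2 : R -> R) (A B : 'M[R]_Na) (L : R) : 0 <= L ->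
  (forall x y, `|g1 x - g1 y| <= L * `|x - y|) ->
  (forall x y, `|g2 x - g2 y| <= L * `|x - y|) ->
  forall X Y : E, `|response g1 g2 A B X - response g1 g2 A B Y| <=
    L * (Na%:R * `|A| + Na%:R * `|B|) * `|X - Y|.
Proof.
move=> L0 h1 h2 X Y; apply: mx_norm_le => [|i j].
  by rewrite !mulr_ge0// addr_ge0// mulr_ge0.
have dist (D : 'M[R]_Na) : `|(D *m X) i j - (D *m Y) i j| <= Na%:R * `|D| * `|X - Y|.
  apply: le_trans (mx_norm_mul _ _); rewrite mulmxBr.
  by have := mx_entry_le (D *m X - D *m Y) i j; rewrite !mxE.
have -> : (response g1 g2 A B X - response g1 g2 A B Y) i j =
  (g1 ((A *m X) i j) - g1 ((A *m Y) i j)) - (g2 ((B *m X) i j) - g2 ((B *m Y) i j)).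
  rewrite /response; move: (A *m X) (B *m X) (A *m Y) (B *m Y) => a b a' b'.
  by rewrite !mxE; ring.
apply: le_trans (ler_normB _ _) _; apply: le_trans (lerD (h1 _ _) (h2 _ _)) _.
rewrite -mulrDr -mulrA ler_wpM2l// mulrDl; exact: lerD.
Qed.

(** The sigmoids are bounded but only locally Lipschitz. The damping -d Z keeps
    a trajectory within |Z0| + D / d of the origin, where D bounds the saturated
    terms, so the arguments of the sigmoids stay below some K. Clipping them at
    K makes the field globally Lipschitz and does not change it along the
    trajectory. *)
Lemma global_solution (u : R) (Z0 : E) : 0 <= u -> V Z0 ->
  exists2 z : R -> E, solution S1 S2 p u z & z 0 = Z0.
Proof.
move=> u0 VZ0.
pose D := u * (No%:R * (k + k) * `|P|).
have k0 : 0 <= k by apply: le_trans (S1k 0).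
have D0 : 0 <= D by rewrite !mulr_ge0// addr_ge0.
pose b := `|Z0| + D / pd p.
have b0 : 0 <= b by rewrite addr_ge0// divr_ge0// ltW.
pose K := Na%:R * `|gainS p| * b + Na%:R * `|gainD p| * b.
have Kl : Na%:R * `|gainS p| * b <= K by rewrite lerDl !mulr_ge0.
have Kr : Na%:R * `|gainD p| * b <= K by rewrite lerDr !mulr_ge0.
have K0 : 0 <= K by apply: le_trans Kl; rewrite !mulr_ge0.
have [L1 L10 l1] := S1lip K0; have [L2 L20 l2] := S2lip K0.
pose g1 := S1 \o clip K; pose g2 := S2 \o clip K; pose L := L1 + L2.
have L0 : 0 <= L by rewrite addr_ge0.
have g1l x y : `|g1 x - g1 y| <= L * `|x - y|.
  apply: le_trans (l1 _ _ (clip_le _ K0) (clip_le _ K0)) _.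
  by rewrite ler_pM ?clip_lip// lerDl.
have g2l x y : `|g2 x - g2 y| <= L * `|x - y|.
  apply: le_trans (l2 _ _ (clip_le _ K0) (clip_le _ K0)) _.
  by rewrite ler_pM ?clip_lip// lerDr.
pose r := response g1 g2 (gainS p) (gainD p) : E -> E.
pose f (Z : E) : E := (- pd p *: Z + u *: r Z) *m P.
pose Lr := L * (Na%:R * `|gainS p| + Na%:R * `|gainD p|).
have Lr0 : 0 <= Lr by rewrite !mulr_ge0// addr_ge0// mulr_ge0.
pose Lf := No%:R * (pd p + u * Lr) * `|P|.
have Lf0 : 0 <= Lf by rewrite !mulr_ge0// addr_ge0 ?mulr_ge0// ltW.
have fl X Y : `|f X - f Y| <= Lf * `|X - Y|.
  rewrite /f -mulmxBl; apply: le_trans (mx_norm_mul _ _) _.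
  rewrite (_ : Lf * `|X - Y| = No%:R * ((pd p + u * Lr) * `|X - Y|) * `|P|); last first.
    by rewrite /Lf; ring.
  rewrite ler_wpM2r// ler_wpM2l// opprD addrACA -!scalerBr.
  apply: le_trans (ler_normD _ _) _.
  rewrite !normrZ normrN (gtr0_norm d0) (ger0_norm u0) mulrDl lerD2l -mulrA.
  rewrite ler_wpM2l//; exact: response_lip.
have [z [zc zZ0 zd]] := picard Lf0 fl Z0.
(* The clipped field takes values in V, so the row sums are conserved. *)
have Vz t : 0 <= t -> V (z t).
  move=> t0; apply/VP; apply/eqP; rewrite -normr_le0.
  have d1 (s : R) : 0 < s -> is_derive s 1 (fun s => z s *m ones R No) (f (z s) *m ones R No).
    by move=> s0; apply: is_derive_mulmxr; exact: zd.
  have c1 : {within `[0, +oo[, continuous (fun s => z s *m ones R No)}.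
    apply: continuous_subspaceT => s.
    by apply: (@continuous_comp _ _ _ z (fun X => X *m ones R No)); [exact: zc|exact: mulmxr_continuous].
  have n1 (s : R) : 0 < s -> `|f (z s) *m ones R No| <= 0.
    by move=> _; rewrite /f -mulmxA P0_ones// mulmx0 normr0.
  have := mx_growth_bound t0 d1 (fun s _ => is_derive_cst (0 : R) s 1) c1 _ n1.
  rewrite zZ0 ((VP _).1 VZ0) !subr0; apply.
  by apply: continuous_subspaceT => s; exact: cvg_cst.
have rb Z : `|u *: (r Z *m P)| <= D.
  rewrite normrZ (ger0_norm u0) ler_wpM2l//.
  apply: le_trans (mx_norm_mul _ _) _; rewrite ler_wpM2r// ler_wpM2l//.
  apply: mx_norm_le => [|i j]; first by rewrite addr_ge0.
  rewrite !mxE; apply: le_trans (ler_normB _ _) _.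
  by apply: lerD; [exact: S1k|exact: S2k].
(* Variation of constants: expR (d * t) *: z t has a derivative bounded by
   D * expR (d * t), clipped or not. *)
have zb t : 0 <= t -> `|z t| <= b.
  move=> t0; pose y s := expR (pd p * s) *: z s.
  have yd (s : R) : 0 < s -> is_derive s 1 y (expR (pd p * s) *: (u *: (r (z s) *m P))).
    move=> s0; apply/is_derive_mxP => i j; rewrite /y.
    under eq_fun do rewrite mxE.
    have /is_derive_mxP zdij := zd s s0.
    apply: is_derive_eq (is_derive1M (is_derive1_expR (pd p) s) (zdij i j)) _.
    have -> : f (z s) = - pd p *: z s + u *: (r (z s) *m P).
      by rewrite /f mulmxDl -!scalemxAl (mulmx_P0 (Vz _ (ltW s0))).
    by rewrite !mxE; move: (\sum_(_ < _) _) => x; ring.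
  have hd (s : R) : 0 < s -> is_derive s 1 (fun s => D / pd p * expR (pd p * s))
      (D / pd p * (pd p * expR (pd p * s))).
    by move=> s0; exact: is_derive1Z (is_derive1_expR _ _).
  have yc : {within `[0, +oo[, continuous y}.
    apply: continuous_subspaceT => s; apply: cvgZ; last exact: zc.
    exact: is_derive_continuous (is_derive1_expR (pd p) s).
  have hc : {within `[0, +oo[, continuous (fun s => D / pd p * expR (pd p * s))}.
    apply: continuous_subspaceT => s; apply: cvgMr.
    exact: is_derive_continuous (is_derive1_expR (pd p) s).
  have yb (s : R) : 0 < s -> `|expR (pd p * s) *: (u *: (r (z s) *m P))| <=
      D / pd p * (pd p * expR (pd p * s)).
    move=> s0; rewrite normrZ (ger0_norm (expR_ge0 _)) mulrA divfK ?gt_eqF//.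
    by rewrite mulrC ler_wpM2r ?expR_ge0.
  have := mx_growth_bound t0 yd hd yc hc yb.
  rewrite /y mulr0 expR0 scale1r mulr1 zZ0 => h.
  have e1 : 1 <= expR (pd p * t) by rewrite -expR0 ler_expR mulr_ge0// ltW.
  have h2 : expR (pd p * t) * `|z t| <= expR (pd p * t) * b.
    rewrite -[expR _](ger0_norm (expR_ge0 _)) -normrZ (ger0_norm (expR_ge0 _)).
    rewrite -[_ *: _](subrK Z0) (le_trans (ler_normD _ _))//.
    have Dd : 0 <= D / pd p by rewrite divr_ge0// ltW.
    have := ler_wpM2r (normr_ge0 Z0) e1; rewrite /b.
    by move: h Dd; set x := expR _; set y1 := D / _; lra.
  by rewrite -(ler_pM2l (expR_gt0 (pd p * t))).
have fz t : 0 <= t -> f (z t) = field S1 S2 p u (z t).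
  move=> t0; rewrite fieldE// /f; congr ((_ + _ *: _) *m _).
  have zbt := zb t t0.
  have cl (A : 'M[R]_Na) i j : Na%:R * `|A| * b <= K -> clip K ((A *m z t) i j) = (A *m z t) i j.
    move=> AK; apply: clip_id; apply: le_trans AK; apply: le_trans (mx_entry_le _ _ _) _.
    by apply: le_trans (mx_norm_mul _ _) _; rewrite ler_wpM2l// mulr_ge0.
  apply/matrixP => i j; rewrite /r /response.
  have := cl _ i j Kl; have := cl _ i j Kr.
  move: (gainS p *m z t) (gainD p *m z t) => X Y hY hX.
  by rewrite !mxE /g1 /g2 /= hX hY.
exists z => //; split=> //.
- exact: continuous_subspaceT.
- by move=> t t0; rewrite -fz ?ltW//; exact: zd.
Qed.

End GlobalSolutions.

(** * Stability and instability of the neutral point *)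

Section RealEigenvectors.
Variables (R : realType) (n : nat) (M : 'M[R]_n) (lam : R).

Lemma real_eigenvalueP : complex_eigenvalue M (real_complex R lam) <-> root (char_poly M) lam.
Proof.
rewrite /complex_eigenvalue eigenvalue_root_char -map_char_poly.
by rewrite fmorph_root.
Qed.

Lemma real_eigenvector : complex_eigenvalue M (real_complex R lam) ->
  exists2 v : 'cV[R]_n, M *m v = lam *: v & v != 0.
Proof.
move=> /real_eigenvalueP.
have -> : char_poly M = char_poly M^T.
  rewrite /char_poly -det_tr; congr (\det _); apply/matrixP => i j.
  by rewrite !mxE eq_sym.
rewrite -eigenvalue_root_char => /eigenvalueP[w wM w0].
exists w^T; last by rewrite -trmx0 (inj_eq trmx_inj).
by apply: trmx_inj; rewrite trmx_mul trmxK wM linearZ /= trmxK.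
Qed.

Lemma eigenvalue_reals : exists s : seq R,
  forall mu, complex_eigenvalue M mu -> complex.Re mu \in s.
Proof.
have [r rP] := closed_field_poly_normal (char_poly (map_mx (real_complex R) M)).
exists [seq complex.Re x | x <- r] => mu.
rewrite /complex_eigenvalue eigenvalue_root_char rP rootZ ?lead_coef_eq0 ?monic_neq0 ?char_poly_monic//.
by rewrite root_prod_XsubC => h; exact: map_f.
Qed.

End RealEigenvectors.

Lemma avoid_seq (R : realFieldType) (s : seq R) (a b : R) : a < b ->
  exists2 c, a < c < b & c \notin s.
Proof.
elim: s a => [|x s IHs] a ab.
  by exists ((a + b) / 2); rewrite ?midf_lt.
have [c /andP[ac cb] cs] := IHs a ab.
have [xc|xc] := eqVneq c x; last by exists c; rewrite ?ac// inE negb_or xc.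
have [c' /andP[cc' c'b] c's] := IHs c cb.
exists c'; rewrite ?(lt_trans ac)// inE negb_or c's andbT -xc.
by rewrite gt_eqF.
Qed.

Section Stability.
Variables (R : realType) (Na No : nat) (S1 S2 : R -> R) (p : params R Na) (lam : R).
Local Notation P := (P0 R No).
Local Notation E := 'M[R]_(Na, No).
Local Notation M := (pGamma p - pDelta p).
Hypotheses (No0 : (0 < No)%N) (adm : admissible p lam).
Hypotheses (hS1 : strict1 S1) (hS2 : strict1 S2).

Let d0 : 0 < pd p. Proof. by have [[]] := adm. Qed.
Let Gam0 : forall i, pGamma p i i = 0. Proof. by have [_ []] := adm. Qed.
Let Del0 : forall i, pDelta p i i = 0. Proof. by have [_ []] := adm. Qed.
Let gap0 : 0 < palpha p - pbeta p + lam. Proof. by have [] := adm. Qed.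

Lemma lin_mul m (u : R) (Z : 'M[R]_(Na, m)) :
  lin p u *m Z = (- pd p + u * (palpha p - pbeta p)) *: Z + u *: (M *m Z).
Proof.
rewrite /lin /gainS /gainD.
have -> : (palpha p)%:M + pGamma p - ((pbeta p)%:M + pDelta p) =
    (palpha p - pbeta p)%:M + M.
  by rewrite opprD addrACA -raddfB.
rewrite mulmxDl mul_scalar_mx -scalemxAl mulmxDl mul_scalar_mx scalerDr addrA.
by rewrite scalerA -scalerDl.
Qed.

(** Growth rate under the linearized dynamics of a mode whose eigenvalue for the
    coupling matrix has real part th. *)
Definition growth_rate (u th : R) : R := - pd p + u * (palpha p - pbeta p + th).

Lemma field_V (u : R) (Z : E) : V Z -> field S1 S2 p u Z =
  lin p u *m Z + u *: (remainder S1 S2 (gainS p) (gainD p) Z *m P).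
Proof. by move=> VZ; rewrite field_remainder// -mulmxA mulmx_P0. Qed.

(** Near 0 the nonlinear remainder is o(|Z|) and is absorbed by the definite
    term of the Lyapunov inequality, so the nonlinear flow obeys the growth
    inequality of the linear one. *)
Lemma energy_growth (H : 'M[R]_Na) (c th u : R) : 0 < c -> 0 < u ->
  (forall m (X : 'M[R]_(Na, m)),
      th * form H X X + c * form 1%:M X X <= form H X (M *m X)) ->
  exists2 rho : R, 0 < rho & forall Z : E, V Z -> `|Z| <= rho ->
    growth_rate u th * form H Z Z <= form H Z (field S1 S2 p u Z).
Proof.
move=> c0 u0 hH.
have [cH cH0 bH] := form_bound No H.
pose B := cH * (No%:R * `|P| + 1).
have B0 : 0 < B by rewrite mulr_gt0// ltr_wpDl// mulr_ge0.
have [rho rho0 hr] := @remainder_small R Na No S1 S2 (gainS p) (gainD p) hS1 hS2 _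
  (divr_gt0 c0 B0).
exists rho => // Z VZ Zr.
rewrite field_V// lin_mul !formDr !formZr.
have h1 := hH _ Z; have h2 := hr Z Zr.
have h3 := bH Z (remainder S1 S2 (gainS p) (gainD p) Z *m P).
have h4 := mx_norm_mul (remainder S1 S2 (gainS p) (gainD p) Z) P.
have h5 := form1_ge Z.
have h6 : cH * `|Z| * `|remainder S1 S2 (gainS p) (gainD p) Z *m P| <= c * `|Z| ^+ 2.
  have le1 : `|remainder S1 S2 (gainS p) (gainD p) Z *m P| <=
      (No%:R * `|P| + 1) * (c / B * `|Z|).
    apply: le_trans h4 _; rewrite mulrAC.
    by apply: ler_pM; rewrite ?mulr_ge0 ?lerDl.
  apply: le_trans (ler_wpM2l _ le1) _; first by rewrite mulr_ge0// ltW.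
  rewrite le_eqVlt; apply/orP; left; apply/eqP.
  have n0 : No%:R * `|P| + 1 != 0 by rewrite gt_eqF// ltr_wpDl// mulr_ge0.
  by rewrite /B; field; rewrite n0 gt_eqF.
have h7 : - (c * `|Z| ^+ 2) <= form H Z (remainder S1 S2 (gainS p) (gainD p) Z *m P).
  by have := le_trans h3 h6; rewrite ler_norml => /andP[].
have h8 : u * (th * form H Z Z) <=
    u * (form H Z (M *m Z) + form H Z (remainder S1 S2 (gainS p) (gainD p) Z *m P)).
  rewrite ler_pM2l//; have := ler_wpM2l (ltW c0) h5; lra.
rewrite /growth_rate; lra.
Qed.

(** For th slightly above lam the Lyapunov form is negative definite and its
    growth rate is still negative. The energy - form H Z Z then decays
    exponentially as long as the trajectory is in the ball of [energy_growth],
    which it cannot leave by [barrier]. *)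
Lemma stable_below (u : R) : 0 < u < ustar p lam -> loc_exp_stable No S1 S2 p u.
Proof.
move=> /andP[u0 us].
have [_ _ [_ leadle _] _] := adm.
have : - pd p + u * (palpha p - pbeta p + lam) < 0.
  by rewrite addrC subr_lt0 -ltr_pdivlMr.
move=> neg.
(* This choice halves the growth rate of lam. *)
pose th := lam - (- pd p + u * (palpha p - pbeta p + lam)) / (2 * u).
have lamth : lam < th by rewrite ltrBrDl gtrDr pmulr_llt0// invr_gt0 mulr_gt0.
have rate : growth_rate u th = (- pd p + u * (palpha p - pbeta p + lam)) / 2.
  by rewrite /growth_rate /th; field; rewrite gt_eqF.
have sneg : growth_rate u th < 0 by rewrite rate pmulr_llt0// invr_gt0.
have leadlt mu : complex_eigenvalue M mu -> complex.Re mu < th.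
  by move=> /leadle h; exact: le_lt_trans h lamth.
have [|H [c [c0 HT hH /(_ leadlt) Hneg]]] := @lyapunov_form R Na M th.
  by move=> mu /leadlt h; rewrite lt_eqF.
have [rho rho0 hrho] := energy_growth c0 u0 hH.
have [cH cH0 bH] := form_bound No H.
set s := growth_rate u th in sneg hrho.
(* C ^+ 2 exceeds the condition number cH / c of the energy. *)
pose C := cH / c + 1.
have C1 : 1 <= C by rewrite lerDr divr_ge0// ltW.
have C0 : 0 < C by apply: lt_le_trans C1.
have CcH : cH < c * C ^+ 2.
  apply: lt_le_trans (_ : c * C <= _).
    by rewrite mulrDr mulrCA divff ?gt_eqF// mulr1 mulr1 ltrDl.
  by rewrite ler_pM2l// expr2 ler_peMl// ltW.
exists (rho / C), C, (- s); split=> //; [by rewrite divr_gt0|by rewrite oppr_gt0|].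
move=> z [zc Vz zd] z0.
pose W t := - form H (z t) (z t).
have Wge t : c * `|z t| ^+ 2 <= W t.
  rewrite /W lerNr; apply: le_trans (Hneg _ _) _.
  by rewrite mulNr lerN2 ler_pM2l// form1_ge.
have Wd (t : R) : 0 < t -> is_derive t 1 W (- (2 * form H (z t) (field S1 S2 p u (z t)))).
  by move=> t0; apply: is_deriveN; apply: is_derive_form => //; exact: zd.
have Wc : {within `[0, +oo[, continuous W}.
  have fc := form_continuous H zc; move=> t; apply: cvgN; exact: fc.
have Wsmall t : W t < c * rho ^+ 2 -> `|z t| <= rho.
  move=> h; have := le_lt_trans (Wge t) h; rewrite ltr_pM2l// => h2.
  by rewrite -(@ler_pXn2r _ 2) ?nnegrE// ?(ltW rho0)// ltW.
have Wdle (t : R) : 0 < t -> W t < c * rho ^+ 2 ->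
    - (2 * form H (z t) (field S1 S2 p u (z t))) <= 2 * s * W t.
  move=> t0 /Wsmall zr; have := hrho _ (Vz t (ltW t0)) zr.
  by rewrite /W; lra.
have W0 : W 0 <= cH * `|z 0| ^+ 2.
  apply: le_trans (ler_norm _) _; rewrite normrN expr2 mulrA; exact: bH.
have W0lt : W 0 < c * rho ^+ 2.
  apply: le_lt_trans W0 _.
  apply: le_lt_trans (_ : c * C ^+ 2 * `|z 0| ^+ 2 < _).
    by rewrite ler_wpM2r// ?sqr_ge0// ltW.
  rewrite -mulrA -exprMn ltr_pM2l// ltr_pXn2r ?nnegrE ?mulr_ge0 ?(ltW C0) ?(ltW rho0)//.
  by rewrite mulrC -ltr_pdivlMr.
have Wbelow : forall t : R, 0 <= t -> W t < c * rho ^+ 2.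
  apply: (barrier Wc Wd) => // t t0 Wt.
  apply: le_trans (Wdle t t0 Wt) _.
  rewrite nmulr_rle0 ?pmulr_rlt0//; apply: le_trans (Wge t).
  by rewrite mulr_ge0 ?sqr_ge0 ?ltW.
have Wdecay : forall t : R, 0 <= t -> W t <= W 0 * expR (2 * s * t).
  apply: (decay_bound Wc Wd) => t t0; apply: Wdle => //; apply: Wbelow; exact: ltW.
move=> t t0; rewrite opprK.
rewrite -(@ler_pXn2r _ 2) ?nnegrE// ?mulr_ge0 ?expR_ge0 ?(ltW C0)//.
rewrite -(ler_pM2l c0); apply: le_trans (Wge t) _; apply: le_trans (Wdecay t t0) _.
have -> : 2 * s * t = s * t + s * t by ring.
rewrite expRD.
apply: le_trans (ler_wpM2r _ W0) _; first by rewrite mulr_ge0 ?expR_ge0.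
have -> : c * (C * expR (s * t) * `|z 0|) ^+ 2 =
  c * C ^+ 2 * (`|z 0| ^+ 2 * (expR (s * t) * expR (s * t))) by ring.
rewrite -(mulrA cH); apply: ler_wpM2r; last exact: ltW.
by rewrite mulr_ge0 ?sqr_ge0// mulr_ge0 ?expR_ge0.
Qed.

Hypothesis No2 : (1 < No)%N.
Hypothesis global : forall (u : R) (Z0 : E), 0 <= u -> V Z0 ->
  exists2 z : R -> E, solution S1 S2 p u z & z 0 = Z0.

Lemma ones_perp_neq0 : exists2 e : 'rV[R]_No, ones_perp e & e != 0.
Proof.
pose i0 := Ordinal No0; pose i1 := Ordinal No2.
exists (delta_mx 0 i0 - delta_mx 0 i1).
  rewrite /ones_perp /= mulmxBl -!rowE; apply/matrixP => i j.
  by rewrite !mxE subrr.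
apply/eqP => /matrixP /(_ 0 i0); rewrite !mxE !eqxx /= subr0.
by move/eqP; rewrite oner_eq0.
Qed.

Lemma V_tens m (x : 'M[R]_(Na, m)) (y : 'M[R]_(m, No)) : V y -> V (x *m y).
Proof. by move=> /VP y1; apply/VP; rewrite -mulmxA y1 mulmx0. Qed.

Lemma ones_perpV (y : 'rV[R]_No) : ones_perp y <-> V (y : 'M[R]_(1, No)).
Proof. by split=> [h|/VP//]; apply/VP. Qed.

(** For th slightly below lam and distinct from the real parts of all
    eigenvalues, the growth rate s is still positive and the Lyapunov form is
    positive on a leading eigenvector tensored with a nonzero pattern. A
    solution that starts there and stays in the ball of [energy_growth] has a
    form growing like expR (2 * s * t), which contradicts boundedness. *)
Lemma unstable_above (u : R) : ustar p lam < u -> unstable No S1 S2 p u.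
Proof.
move=> us stab.
have [_ _ [eiglam _ _] _] := adm.
have us0 : 0 < ustar p lam by rewrite divr_gt0.
have u0 : 0 < u by apply: lt_trans us.
have pos : 0 < - pd p + u * (palpha p - pbeta p + lam).
  by rewrite addrC subr_gt0 -ltr_pdivrMr.
have [sq sqP] := eigenvalue_reals M.
(* The growth rate vanishes at th0. *)
pose th0 := lam - (- pd p + u * (palpha p - pbeta p + lam)) / u.
have th0lam : th0 < lam by rewrite ltrBlDr ltrDl divr_gt0.
have [th /andP[thl thr] thn] := avoid_seq sq th0lam.
have spos : 0 < growth_rate u th.
  have : u * th0 < u * th by rewrite ltr_pM2l.
  have -> : u * th0 = u * lam - (- pd p + u * (palpha p - pbeta p + lam)).
    by rewrite /th0; field; rewrite gt_eqF.
  by rewrite /growth_rate; lra.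
have [|H [c [c0 HT hH _]]] := @lyapunov_form R Na M th.
  by move=> mu /sqP h; apply: contraNneq thn => <-.
have [rho rho0 hrho] := energy_growth c0 u0 hH.
have [cH cH0 bH] := form_bound No H.
set s := growth_rate u th in spos hrho.
have [v Mv v0] := real_eigenvector eiglam.
have [e ep e0] := ones_perp_neq0.
pose X : E := v *m e.
have X0 : X != 0.
  have /matrix0Pn[i [j vij]] := v0; have /matrix0Pn[k [l ekl]] := e0.
  apply/matrix0Pn; exists i, l; rewrite mxE big_ord1 mulf_neq0//.
    by move: vij; rewrite (ord1 j).
  by move: ekl; rewrite (ord1 k).
have VX : V X by apply: V_tens; apply/ones_perpV.
have QX : 0 < form H X X.
  have := hH _ X; rewrite mulmxA Mv -scalemxAl formZr => h.
  have Xn : 0 < `|X| by rewrite normr_gt0.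
  have : 0 < (lam - th) * form H X X.
    apply: lt_le_trans (_ : c * form 1%:M X X <= _); last by lra.
    by rewrite mulr_gt0// (lt_le_trans _ (form1_ge X))// exprn_gt0.
  by rewrite pmulr_rgt0// subr_gt0.
have [delta delta0 hd] := stab rho rho0.
pose a := delta / 2 / `|X|.
have Xn : 0 < `|X| by rewrite normr_gt0.
have a0 : 0 < a by rewrite !divr_gt0.
have VaX : V (a *: X) by apply/VP; rewrite -scalemxAl (VP _).1// scaler0.
have [z [zc Vz zd] zz0] := global (ltW u0) VaX.
have zsmall : forall t : R, 0 <= t -> `|z t| < rho.
  apply: hd; first by split.
  rewrite zz0 normrZ gtr0_norm// divfK ?gt_eqF//.
  by rewrite ltr_pdivrMr// ltr_pMr// ltr1n.
pose W t := - form H (z t) (z t).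
have Wd (t : R) : 0 < t -> is_derive t 1 W (- (2 * form H (z t) (field S1 S2 p u (z t)))).
  by move=> t0; apply: is_deriveN; apply: is_derive_form => //; exact: zd.
have Wc : {within `[0, +oo[, continuous W}.
  have fc := form_continuous H zc; move=> t; apply: cvgN; exact: fc.
have Wdle (t : R) : 0 < t ->
    - (2 * form H (z t) (field S1 S2 p u (z t))) <= 2 * s * W t.
  move=> t0; have := hrho _ (Vz t (ltW t0)) (ltW (zsmall t (ltW t0))).
  by rewrite /W; lra.
have Wdecay := decay_bound Wc Wd Wdle.
have W0 : W 0 < 0.
  rewrite /W oppr_lt0 zz0 formZr (formC _ _ HT) formZr.
  exact: mulr_gt0 a0 (mulr_gt0 a0 QX).
have Wlow t : 0 <= t -> - (cH * rho ^+ 2) <= W t.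
  move=> t0; rewrite lerN2; apply: le_trans (ler_norm _) _; apply: le_trans (bH _ _) _.
  by rewrite -mulrA ler_pM2l// expr2 ler_pM ?(ltW (zsmall _ _)).
(* At this time the lower bound 1 + x <= expR x already takes the form beyond
   its maximum cH * rho ^+ 2 on the ball. *)
pose t := cH * rho ^+ 2 / (- W 0 * (2 * s)).
have nW0 : 0 < - W 0 by rewrite oppr_gt0.
have t0 : 0 <= t by rewrite divr_ge0 ?mulr_ge0 ?sqr_ge0 ?ltW// ?ltW.
have := le_trans (Wlow t t0) (Wdecay t t0).
have h1 : 1 + 2 * s * t <= expR (2 * s * t) by exact: expR_ge1Dx.
have h2 : - W 0 * (1 + 2 * s * t) = - W 0 + cH * rho ^+ 2.
  by rewrite /t; move: (W 0) W0 => w w0; field; rewrite (gt_eqF spos) (lt_eqF w0).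
have := ler_wpM2l (ltW nW0) h1; rewrite h2.
by lra.
Qed.

End Stability.

(** * Simple eigenvalues and the adjugate *)

Section SimpleEigenvalue.
Variables (F : fieldType) (n : nat).
Implicit Types (A : 'M[F]_n).

(** A nonzero cofactor is the determinant of an invertible minor of size
    n.-1. *)
Lemma adj_neq0_rank A : \adj A != 0 -> (n.-1 <= \rank A)%N.
Proof.
move=> /matrix0Pn[j [i nz]].
have d0 : \det (row' i (col' j A)) != 0.
  by apply: contraNneq nz => d; rewrite mxE /cofactor d mulr0.
have : row' i (col' j A) \in unitmx by rewrite unitmxE unitfE.
rewrite -row_free_unit /row_free => /eqP <-.
apply: leq_trans (mxrankS (rowsub_sub _ _)) _.
rewrite -mxrank_tr -(mxrank_tr A) tr_col'; exact: mxrankS (rowsub_sub _ _).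
Qed.

Variables (M : 'M[F]_n) (lam : F) (v : 'cV[F]_n).
Hypotheses (Mv : M *m v = lam *: v) (v0 : v != 0).
Hypothesis simple : mup lam (char_poly M) = 1%N.

Let det_lam0 : \det (lam%:M - M) = 0.
Proof.
apply/eqP; apply: contraNT v0 => d.
have u : lam%:M - M \in unitmx by rewrite unitmxE unitfE.
by rewrite -(mulKmx u v) mulmxBl mul_scalar_mx Mv subrr mulmx0.
Qed.

Lemma char_poly_simple : exists2 g : {poly F},
  char_poly M = ('X - lam%:P) * g & g.[lam] != 0.
Proof.
have c0 : char_poly M != 0 by rewrite monic_neq0 ?char_poly_monic.
have : 'X - lam%:P %| char_poly M by rewrite XsubC_dvd// simple.
move=> /dvdpP[g cg]; exists g; first by rewrite cg mulrC.
apply/negP => gl.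
have : (('X - lam%:P) ^+ 2 %| char_poly M).
  by rewrite cg expr2 dvdp_mul2r ?polyXsubC_eq0// dvdp_XsubCl.
by rewrite -mup_geq// simple.
Qed.

(** Apply \adj (X - M) *m (X - M) = chi to v, on which X - M acts as X - lam.
    Dividing by X - lam and evaluating at lam leaves the value at lam of
    chi / (X - lam), nonzero because the root is simple. *)
Lemma adj_eigenvector : exists2 c : F, c != 0 & \adj (lam%:M - M) *m v = c *: v.
Proof.
have [g cg gl] := char_poly_simple; exists g.[lam] => //.
pose vP := map_mx polyC v : 'cV_n.
have hv : char_poly_mx M *m vP = ('X - lam%:P) *: vP.
  rewrite /char_poly_mx mulmxBl mul_scalar_mx -map_mxM Mv scalerBl; congr (_ - _).
  by rewrite map_mxZ.
have : ('X - lam%:P) *: (\adj (char_poly_mx M) *m vP) = ('X - lam%:P) *: (g *: vP).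
  by rewrite scalerA -cg /char_poly -[RHS]mul_scalar_mx -mul_adj_mx -mulmxA hv scalemxAr.
move=> h0; have h : \adj (char_poly_mx M) *m vP = g *: vP.
  apply/matrixP => i j; move/matrixP: h0 => /(_ i j).
  move: (\adj _ *m _) (g *: vP) => X Y; rewrite !mxE.
  by apply: mulfI; rewrite polyXsubC_eq0.
have := congr1 (map_mx (horner_eval lam)) h.
rewrite map_mxM map_mx_adj map_mxZ /=.
have -> : map_mx (horner_eval lam) vP = v.
  by apply/matrixP => i j; rewrite !mxE /= /horner_eval hornerC.
have -> // : map_mx (horner_eval lam) (char_poly_mx M) = lam%:M - M.
apply/matrixP => i j; rewrite !mxE /horner_eval.
by rewrite hornerD hornerN hornerC hornerMn hornerX.
Qed.

Lemma adj_lam_neq0 : \adj (lam%:M - M) != 0.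
Proof.
have [c c0 e] := adj_eigenvector.
apply: contraNneq v0 => a0; move: e; rewrite a0 mul0mx => /esym/eqP.
by rewrite scaler_eq0 (negPf c0).
Qed.

(** The adjugate of lam - M is nonzero, so this matrix has corank one. *)
Lemma eigenvector_unique (x : 'cV[F]_n) : M *m x = lam *: x -> exists c, x = c *: v.
Proof.
move=> Mx.
have kerP (y : 'cV[F]_n) : M *m y = lam *: y -> (y^T <= kermx (lam%:M - M)^T)%MS.
  move=> My; apply/sub_kermxP; rewrite -trmx_mul mulmxBl mul_scalar_mx My subrr.
  exact: trmx0.
have vT0 : \rank v^T = 1%N.
  by apply/eqP; rewrite rank_rV -trmx0 (inj_eq trmx_inj) v0.
have n0 : (0 < n)%N.
  by have /matrix0Pn[i _] := v0; exact: leq_ltn_trans (ltn_ord i).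
have rk : \rank (kermx (lam%:M - M)^T) = 1%N.
  apply/eqP; rewrite eqn_leq -{2}vT0 (mxrankS (kerP _ Mv)) andbT.
  rewrite mxrank_ker mxrank_tr leq_subLR addnC -leq_subLR subn1.
  exact: adj_neq0_rank adj_lam_neq0.
have : (kermx (lam%:M - M)^T <= v^T)%MS.
  by rewrite -(geq_leqif (mxrank_leqif_sup (kerP _ Mv))) rk vT0.
move=> /(submx_trans (kerP _ Mx)) /sub_rVP[c xv]; exists c.
by apply: trmx_inj; rewrite xv linearZ.
Qed.

(** The rows of the adjugate of lam - M are left eigenvectors, and by
    [adj_eigenvector] some row does not annihilate v. *)
Lemma left_eigenvector : exists2 w : 'rV[F]_n, w *m M = lam *: w & w *m v = 1%:M.
Proof.
have [c c0 e] := adj_eigenvector.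
have /matrix0Pn[i [j vij]] := v0; rewrite (ord1 j) in vij.
pose r := row i (\adj (lam%:M - M)).
have rv : r *m v = (c * v i 0)%:M.
  by rewrite -row_mul e; apply/matrixP => k l; rewrite !mxE !ord1 mulr1n.
have rM : r *m M = lam *: r.
  have h : r *m (lam%:M - M) = 0.
    rewrite -row_mul mul_adj_mx det_lam0.
    by apply/matrixP => k l; rewrite !mxE mul0rn.
  move: h; rewrite mulmxBr mul_mx_scalar => /eqP; rewrite subr_eq0 => /eqP.
  by move=> ->.
exists ((c * v i 0)^-1 *: r).
  by rewrite -scalemxAl rM scalerA mulrC -scalerA.
rewrite -scalemxAl rv -[_%:M]scalemx1 scalerA mulVf ?mulf_neq0// scale1r.
by [].
Qed.

Variable w : 'rV[F]_n.
Hypotheses (wM : w *m M = lam *: w) (wv : w *m v = 1%:M).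

(** Adding the spectral projector moves the eigenvalue lam away from itself: a
    vector x in the kernel has w *m x = 0, hence is a multiple of v on which w
    vanishes. *)
Lemma deflated_unit : M - lam%:M + v *m w \in unitmx.
Proof.
have wA : w *m (M - lam%:M + v *m w) = w.
  by rewrite mulmxDr mulmxBr wM mul_mx_scalar subrr add0r mulmxA wv mul1mx.
rewrite -unitmx_tr unitmxE unitfE; apply/det0P => -[x x0 xA].
have {}xA : (M - lam%:M + v *m w) *m x^T = 0.
  by apply: trmx_inj; rewrite trmx_mul trmxK xA trmx0.
have wx : w *m x^T = 0 by rewrite -wA -mulmxA xA mulmx0.
have Mx : M *m x^T = lam *: x^T.
  move: xA; rewrite mulmxDl -mulmxA wx mulmx0 addr0 mulmxBl mul_scalar_mx.
  by move=> /eqP; rewrite subr_eq0 => /eqP.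
have [c xc] := eigenvector_unique Mx.
have c0 : c = 0.
  by move: wx; rewrite xc -scalemxAr wv => /matrixP/(_ 0 0); rewrite !mxE mulr1.
by move: x0; rewrite -(trmxK x) xc c0 scale0r trmx0 eqxx.
Qed.

(** The rows of Q := \adj (lam - M) - c v w are left eigenvectors that
    annihilate v, so the invertible matrix of [deflated_unit] annihilates
    them. *)
Lemma adj_rank1 : exists2 c : F, c != 0 & \adj (lam%:M - M) = c *: (v *m w).
Proof.
have [c c0 e] := adj_eigenvector; exists c => //.
set B := \adj _ in e *.
have BM : B *m M = lam *: B.
  have := mul_adj_mx (lam%:M - M); rewrite det_lam0 raddf0 mulmxBr mul_mx_scalar.
  by move=> /eqP; rewrite subr_eq0 => /eqP.
suff : B - c *: (v *m w) = 0 by move/eqP; rewrite subr_eq0 => /eqP.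
set Q := (X in X = 0).
have QM : Q *m M = lam *: Q.
  by rewrite /Q mulmxBl BM -scalemxAl -mulmxA wM -scalemxAr scalerA mulrC -scalerA scalerBr.
have Qv : Q *m v = 0.
  by rewrite /Q mulmxBl e -scalemxAl -mulmxA wv mulmx1 subrr.
rewrite -[LHS](mulmxK deflated_unit) mulmxDr mulmxBr QM mul_mx_scalar subrr add0r.
by rewrite mulmxA Qv !mul0mx.
Qed.

End SimpleEigenvalue.

(** * Bifurcation from a simple eigenvalue *)

Section WithinContinuity.
Variables (R : realType) (W : normedModType R) (A : set R) (f : R -> W).

Lemma within_continuous_dist :
  (forall x, A x -> forall e : R, 0 < e -> exists2 r : R, 0 < r &
    forall y, A y -> `|x - y| < r -> `|f x - f y| <= e) ->
  {within A, continuous f}.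
Proof.
move=> h; apply/subspace_continuousP => x Ax; apply/cvgrPdist_le => e e0.
have [r r0 hr] := h x Ax e e0.
by apply/nbhs_ballP; exists r => // y xy Ay; exact: hr.
Qed.

Lemma within_continuous_lip (L : R) : 0 <= L ->
  (forall x y, A x -> A y -> `|f x - f y| <= L * `|x - y|) ->
  {within A, continuous f}.
Proof.
move=> L0 h; apply: within_continuous_dist => x Ax e e0.
have L1 : 0 < L + 1 by rewrite ltr_wpDl.
exists (e / (L + 1)); first by rewrite divr_gt0.
move=> y Ay xy; apply: le_trans (h x y Ax Ay) _.
rewrite ltr_pdivlMr// in xy; apply: le_trans (ltW xy).
by rewrite mulrC ler_wpM2l// lerDl.
Qed.

End WithinContinuity.

Section SimpleBifurcation.
Variables (R : realType) (n : nat) (L : 'M[R]_n) (kap : R).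
Variables (v : 'cV[R]_n) (w : 'rV[R]_n).
Hypotheses (Lv : L *m v = kap *: v) (wL : w *m L = kap *: w) (wv : w *m v = 1%:M).
Hypothesis unitA : L - kap%:M + v *m w \in unitmx.
Local Notation E := 'cV[R]_n.
Variable G : E -> E.
Hypotheses (G0 : G 0 = 0)
  (Glip : forall e : R, 0 < e -> exists2 d : R, 0 < d &
     forall X Y : E, `|X| <= d -> `|Y| <= d -> `|G X - G Y| <= e * `|X - Y|).

Let K := invmx (L - kap%:M + v *m w).
Let ev (X : E) : R := (w *m X) 0 0.
Variables cw cK a : R.

Let evE (X : E) : w *m X = (ev X)%:M.
Proof. by apply/matrixP => i j; rewrite !ord1 [RHS]mxE mulr1n. Qed.

Let evB X Y : ev X - ev Y = ev (X - Y).
Proof. by rewrite /ev mulmxBr !mxE. Qed.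

Hypotheses (ev_le : forall X, `|ev X| <= cw * `|X|)
  (K_le : forall X : E, `|K *m X| <= cK * `|X|)
  (cw0 : 0 <= cw) (cK0 : 0 <= cK) (va1 : `|v| + 1 <= a).

Let va : `|v| <= a. Proof. by apply: le_trans va1; rewrite lerDl. Qed.
Let a1 : 1 <= a. Proof. by apply: le_trans va1; rewrite lerDr. Qed.
Let a0 : 0 < a. Proof. exact: lt_le_trans a1. Qed.

Let pt (s : R) (h : E) : E := s *: v + h.
(** The shift of the eigenvalue that solves the component of the equation along
    v. The convention on inverses gives it the value 0 at s = 0, which is its
    limit. *)
Let rate (s : R) (h : E) : R := ev (G (pt s h)) / s.
(** Lyapunov-Schmidt: the equation for the component h transverse to v, in fixed
    point form. *)
Let Phi (s : R) (h : E) : E :=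
  K *m (rate s h *: h - G (pt s h) + ev (G (pt s h)) *: v).

Section Contraction.
Variables (ep d : R).
Hypotheses (ep0 : 0 < ep) (d0 : 0 < d).
Hypothesis Gd : forall X Y : E, `|X| <= d -> `|Y| <= d -> `|G X - G Y| <= ep * `|X - Y|.
Variable s0 : R.
Hypothesis s0d : s0 * a <= d.

Let dom (s : R) (h : E) := 0 <= s <= s0 /\ `|h| <= s.

Let pt_le s h : dom s h -> `|pt s h| <= s * a.
Proof.
move=> [/andP[s0' _] hs]; apply: le_trans (ler_normD _ _) _.
rewrite normrZ ger0_norm//; apply: le_trans (ler_wpM2l s0' va1).
by rewrite mulrDr mulr1 lerD2l.
Qed.

Let pt_d s h : dom s h -> `|pt s h| <= d.
Proof.
move=> D; apply: le_trans (pt_le D) _; apply: le_trans s0d.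
by case: D => /andP[_ ss] _; rewrite ler_wpM2r// ltW.
Qed.

Let Gpt s h : dom s h -> `|G (pt s h)| <= ep * (s * a).
Proof.
move=> D; have := Gd (pt_d D) (_ : `|0 : E| <= d); rewrite normr0 G0 !subr0.
move=> /(_ (ltW d0)) h1; apply: le_trans h1 _.
by rewrite ler_wpM2l ?(ltW ep0)// pt_le.
Qed.

Let dpt s h s' h' : dom s h -> dom s' h' ->
  `|G (pt s h) - G (pt s' h')| <= ep * a * (`|s - s'| + `|h - h'|).
Proof.
move=> D D'; apply: le_trans (Gd (pt_d D) (pt_d D')) _.
rewrite -mulrA ler_wpM2l ?(ltW ep0)// /pt opprD addrACA -scalerBl.
apply: le_trans (ler_normD _ _) _; rewrite normrZ mulrDr mulrC lerD//.
  by rewrite ler_wpM2r.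
by rewrite ler_peMl.
Qed.

Let rate_le s h : dom s h -> `|rate s h| <= cw * ep * a.
Proof.
move=> D; have [/andP[s1 _] _] := D.
rewrite /rate normrM normfV (ger0_norm s1).
have [->|sn0] := eqVneq s 0.
  by rewrite invr0 mulr0 !mulr_ge0// ltW.
rewrite ler_pdivrMr ?lt_neqAle ?(eq_sym 0) ?sn0//.
apply: le_trans (ev_le _) _; rewrite -!mulrA ler_wpM2l//.
by rewrite (mulrC a s); exact: Gpt.
Qed.

(** Although the rate alone need not be Lipschitz at s = 0, its product with h
    is, because |h| <= s on the domain. *)
Let rate_mul_le s h s' h' : dom s h -> dom s' h' ->
  `|rate s h *: h - rate s' h' *: h'| <= 2 * (cw * ep * a) * (`|s - s'| + `|h - h'|).
Proof.
move=> D D'.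
have cc : 0 <= cw * ep * a by rewrite !mulr_ge0// ltW.
have [/andP[s1 _] hs] := D; have [/andP[s1' _] hs'] := D'.
have zero (t : R) (k : E) : `|k| <= t -> t = 0 -> k = 0.
  by move=> kt t0; apply/eqP; rewrite -normr_le0 -t0.
have [s'0|s'n0] := eqVneq s' 0.
  rewrite (zero _ _ hs' s'0) scaler0 !subr0 normrZ.
  apply: le_trans (ler_wpM2r (normr_ge0 _) (rate_le D)) _.
  rewrite [leRHS]mulrAC mulrC -mulrA [leRHS]mulrA.
  have := mulr_ge0 cc (normr_ge0 (s - s')); have := mulr_ge0 cc (normr_ge0 h); lra.
have [sz|sn0] := eqVneq s 0.
  rewrite (zero _ _ hs sz) scaler0 !sub0r !normrN normrZ.
  apply: le_trans (ler_wpM2r (normr_ge0 _) (rate_le D')) _.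
  have := mulr_ge0 cc (normr_ge0 (s - s')); have := mulr_ge0 cc (normr_ge0 h'); lra.
have sp : 0 < s by rewrite lt_neqAle eq_sym sn0.
have sp' : 0 < s' by rewrite lt_neqAle eq_sym s'n0.
have -> : rate s h *: h - rate s' h' *: h' =
    (ev (G (pt s h)) - ev (G (pt s' h'))) *: (s^-1 *: h) +
    rate s' h' *: ((h - h') + ((s' - s) / s) *: h).
  rewrite /rate; move: (ev (G (pt s h))) (ev (G (pt s' h'))) => e e'.
  apply/matrixP => i j; rewrite !mxE; field.
  by rewrite sn0 s'n0.
have hs1 : `|s^-1 *: h| <= 1.
  by rewrite normrZ gtr0_norm ?invr_gt0// mulrC ler_pdivrMr// mul1r.
have h2 : `|((s' - s) / s) *: h| <= `|s - s'|.
  rewrite -scalerA normrZ distrC -[leRHS]mulr1 ler_wpM2l//.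
rewrite (_ : 2 * _ * _ = cw * ep * a * (`|s - s'| + `|h - h'|) +
  cw * ep * a * (`|s - s'| + `|h - h'|)); last by ring.
apply: le_trans (ler_normD _ _) _; apply: lerD; rewrite normrZ.
  rewrite -[leRHS]mulr1; apply: ler_pM => //.
  by rewrite evB; apply: le_trans (ev_le _) _; rewrite -!mulrA ler_wpM2l// mulrA dpt.
apply: ler_pM => //; first exact: rate_le.
by apply: le_trans (ler_normD _ _) _; rewrite addrC lerD.
Qed.

Variable C : R.
Hypothesis CE : C = cK * (2 * cw + 1 + cw * `|v|) * a.

Let Phi_lip s h s' h' : dom s h -> dom s' h' ->
  `|Phi s h - Phi s' h'| <= C * ep * (`|s - s'| + `|h - h'|).
Proof.
move=> D D'; rewrite /Phi -mulmxBr; apply: le_trans (K_le _) _.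
rewrite CE -!mulrA ler_wpM2l//.
set D1 := `|s - s'| + _.
have -> : (rate s h *: h - G (pt s h) + ev (G (pt s h)) *: v) -
   (rate s' h' *: h' - G (pt s' h') + ev (G (pt s' h')) *: v) =
  (rate s h *: h - rate s' h' *: h') - (G (pt s h) - G (pt s' h')) +
  (ev (G (pt s h)) - ev (G (pt s' h'))) *: v.
  rewrite scalerBl; apply/matrixP => i j; rewrite !mxE; ring.
apply: le_trans (ler_normD _ _) _.
apply: le_trans (lerD (ler_normB _ _) (lexx _)) _.
have e1 := rate_mul_le D D'; have e2 := dpt D D'.
have e3 : `|(ev (G (pt s h)) - ev (G (pt s' h'))) *: v| <= cw * (ep * a * D1) * `|v|.
  rewrite normrZ ler_wpM2r// evB; apply: le_trans (ev_le _) _.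
  by rewrite ler_wpM2l.
apply: le_trans (lerD (lerD e1 e2) e3) _.
rewrite -/D1 le_eqVlt; apply/orP; left; apply/eqP; ring.
Qed.

Hypotheses (Cep : C * ep <= 2^-1) (cwep : cw * ep * a <= 2^-1) (s00 : 0 <= s0).

Let Phi00 : Phi 0 0 = 0.
Proof.
rewrite /Phi /rate /pt scale0r addr0 G0 /ev mulmx0 mxE mul0r scale0r.
by rewrite scale0r subrr add0r mulmx0.
Qed.

Let Phi_half s h s' h' : dom s h -> dom s' h' ->
  `|Phi s h - Phi s' h'| <= 2^-1 * (`|s - s'| + `|h - h'|).
Proof.
move=> D D'; apply: le_trans (Phi_lip D D') _.
by rewrite ler_wpM2r// addr_ge0.
Qed.

Let dom0 : dom 0 0. Proof. by split; rewrite ?lexx ?normr0. Qed.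

Let Phi_dom s h : dom s h -> dom s (Phi s h).
Proof.
move=> D; have [ss hs] := D; split=> //.
have := Phi_half D dom0; rewrite Phi00 !subr0.
have /andP[s1 _] := ss; rewrite (ger0_norm s1); lra.
Qed.

Let fixed s : 0 <= s <= s0 -> exists2 h : E, dom s h & h = Phi s h.
Proof.
move=> ss; have /andP[s1 _] := ss.
pose x k := iter k (Phi s) 0.
have xd k : dom s (x k).
  by elim: k => [|k IHk]; [split=> //=; rewrite normr0|exact: Phi_dom].
have xs k : `|x k.+1 - x k| <= s * 2^-1 ^+ k.
  elim: k => [|k IHk].
    by rewrite expr0 mulr1 subr0; have [] := xd 1%N.
  have := Phi_half (xd k.+1) (xd k); rewrite subrr normr0 add0r => h.
  by apply: le_trans h _; rewrite exprS mulrCA ler_wpM2l// invr_ge0.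
have [l lP] := mx_geometric_limit xs.
have ld : dom s l.
  split=> //; rewrite -subr_le0; apply: (@half_expr_le0 R _ (2 * s)) => k.
  have := lP k; have [_ xk] := xd k.
  have : `|l| <= `|l - x k| + `|x k| by rewrite -{1}(subrK (x k) l) ler_normD.
  lra.
exists l => //; apply/eqP; rewrite -subr_eq0 -normr_le0.
apply: (@half_expr_le0 R _ (2 * s)) => k.
have -> : l - Phi s l = (l - x k.+1) + (Phi s (x k) - Phi s l) by rewrite subrKA.
apply: le_trans (ler_normD _ _) _.
have := Phi_half (xd k) ld; rewrite subrr normr0 add0r (distrC (x k)).
have := lP k; have := lP k.+1; rewrite exprS.
by move=> h1 h2 h3; lra.
Qed.

(** Applying w to the fixed point equation gives ev h = rate s h * ev h with
    |rate s h| < 1, so h is transverse to v. *)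
Let solves s h : 0 < s -> dom s h -> h = Phi s h ->
  pt s h != 0 /\ L *m pt s h + G (pt s h) = (kap + rate s h) *: pt s h.
Proof.
move=> s1 D hfix.
have Ah : (L - kap%:M + v *m w) *m h =
    rate s h *: h - G (pt s h) + ev (G (pt s h)) *: v.
  by rewrite {1}hfix /Phi mulKVmx.
have wA : w *m (L - kap%:M + v *m w) = w.
  by rewrite mulmxDr mulmxBr wL mul_mx_scalar subrr add0r mulmxA wv mul1mx.
have wh : ev h = 0.
  have : w *m h = rate s h *: (w *m h).
    rewrite -{1}wA -mulmxA Ah mulmxDr mulmxBr -!scalemxAr wv (evE (G _)) scalemx1 addrNK.
    by [].
  move=> /matrixP/(_ 0 0); rewrite [RHS]mxE -/(ev h) => e.
  have : (1 - rate s h) * ev h = 0 by rewrite mulrBl mul1r -e subrr.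
  move/eqP; rewrite mulf_eq0 => /orP[|/eqP//]; rewrite subr_eq0 => /eqP r1.
  by have := le_trans (rate_le D) cwep; rewrite -r1 normr1; lra.
have evr : ev (G (pt s h)) = rate s h * s by rewrite /rate divfK// gt_eqF.
split.
  apply/eqP => p0; have : ev (pt s h) = s.
    rewrite /ev /pt mulmxDr mxE -/(ev h) wh addr0 -scalemxAr wv !mxE mulr1n.
    exact: mulr1.
  by rewrite p0 /ev mulmx0 mxE => s0'; move: s1; rewrite -s0' ltxx.
have Lh : L *m h = kap *: h + (rate s h *: h - G (pt s h) + ev (G (pt s h)) *: v).
  rewrite -Ah mulmxDl mulmxBl mul_scalar_mx -mulmxA evE wh.
  by rewrite raddf0 mulmx0 addr0 addrC subrK.
rewrite {1}/pt mulmxDr -scalemxAr Lv Lh evr.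
by rewrite /pt; apply/matrixP => i j; rewrite !mxE; ring.
Qed.

(** The map [Phi s] halves distances and depends on s with constant 1/2, so its
    fixed point h s is a Lipschitz function of s, and s v + h s is the branch.
    Continuity of the eigenvalue at s = 0 uses that G is o(|X|), not just
    ep-Lipschitz. *)
Lemma branch_contraction : 0 < s0 -> exists (x : R -> E) (kp : R -> R),
  [/\ {within `[0, 1], continuous x}, {within `[0, 1], continuous kp},
      x 0 = 0, kp 0 = kap &
      (forall t : R, 0 <= t <= 1 -> `|kp t - kap| <= cw * ep * a) /\
      forall t : R, 0 < t <= 1 -> x t != 0 /\ L *m x t + G (x t) = kp t *: x t].
Proof.
move=> s0p.
have /choice[h hP] : forall s : R, exists h : E,
    0 <= s <= s0 -> dom s h /\ h = Phi s h.
  move=> s; have [ss|ss] := boolP (0 <= s <= s0); last by exists 0.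
  by have [h D e] := fixed ss; exists h.
have sc t : 0 <= t <= 1 -> 0 <= s0 * t <= s0.
  by move=> /andP[t0 t1]; rewrite mulr_ge0//= -[leRHS]mulr1 ler_wpM2l.
pose x t := pt (s0 * t) (h (s0 * t)).
pose kp t := kap + rate (s0 * t) (h (s0 * t)).
have hlip s s' : 0 <= s <= s0 -> 0 <= s' <= s0 -> `|h s - h s'| <= `|s - s'|.
  move=> ss ss'; have [D e] := hP s ss; have [D' e'] := hP s' ss'.
  by have := Phi_half D D'; rewrite -e -e'; lra.
have h00 : h 0 = 0.
  have [|[_ h0] _] := hP 0; first by rewrite lexx.
  by apply/eqP; rewrite -normr_le0.
have xlip t t' : 0 <= t <= 1 -> 0 <= t' <= 1 -> `|x t - x t'| <= 2 * a * s0 * `|t - t'|.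
  move=> tt tt'; rewrite /x /pt opprD addrACA -scalerBl.
  apply: le_trans (ler_normD _ _) _.
  have := hlip _ _ (sc t tt) (sc t' tt'); rewrite -mulrBr (normrZ _ v) normrM (ger0_norm s00).
  have q0 : 0 <= s0 * `|t - t'| by rewrite mulr_ge0.
  have := ler_wpM2l q0 va; have : s0 * `|t - t'| * 1 <= s0 * `|t - t'| * a.
    by rewrite ler_wpM2l.
  lra.
have itvE (t : R) : `[0, 1]%classic t -> 0 <= t <= 1 by rewrite /= in_itv.
have x_le t : 0 <= t <= 1 -> `|x t| <= s0 * t * a.
  by move=> tt; apply: pt_le; have [] := hP _ (sc t tt).
have x_d t : 0 <= t <= 1 -> `|x t| <= d.
  by move=> tt; apply: pt_d; have [] := hP _ (sc t tt).
exists x, kp; split.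
- apply: (within_continuous_lip (L := 2 * a * s0)).
    by rewrite !mulr_ge0// ltW.
  by move=> t t' /itvE tt /itvE tt'; exact: xlip.
- apply/subspace_continuousP => t /itvE tt.
  apply: cvgD; first exact: cvg_cst.
  have [t0|t0] := eqVneq t 0; last first.
    apply: cvgM; last first.
      apply: cvgV; first by rewrite mulf_neq0// gt_eqF.
      by apply: cvg_within_filter; apply: cvgMr; exact: cvg_id.
    have /subspace_continuousP/(_ t) : {within `[0, 1], continuous (fun t => ev (G (x t)))}.
      apply: (within_continuous_lip (L := cw * (ep * (2 * a * s0)))).
        by rewrite !mulr_ge0// ltW.
      move=> y z /itvE yy /itvE zz; rewrite evB; apply: le_trans (ev_le _) _.
      rewrite -mulrA ler_wpM2l// -mulrA; apply: le_trans (Gd (x_d _ yy) (x_d _ zz)) _.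
      by rewrite ler_wpM2l ?(ltW ep0)// xlip.
    by apply; rewrite /= in_itv.
  rewrite t0; apply/cvgrPdist_le => e e0.
  have r0 : rate (s0 * 0) (h (s0 * 0)) = 0 by rewrite /rate mulr0 invr0 mulr0.
  have ca : 0 < cw * a + 1 by rewrite ltr_wpDl// mulr_ge0// ltW.
  have [d' d'0 Gd'] := Glip (divr_gt0 e0 ca).
  have s0a : 0 < s0 * a by rewrite mulr_gt0.
  apply/nbhs_ballP; exists (d' / (s0 * a)); first by rewrite /= divr_gt0.
  move=> y; rewrite /ball /= sub0r normrN => yd /itvE yy.
  rewrite r0 sub0r normrN.
  have [->|y0] := eqVneq y 0; first by rewrite r0 normr0 ltW.
  have /andP[y1 _] := yy; have yp : 0 < y by rewrite lt_neqAle eq_sym y0.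
  have xd' : `|x y| <= d'.
    apply: le_trans (x_le y yy) _; rewrite mulrAC mulrC -ler_pdivlMr//.
    by move: yd; rewrite gtr0_norm// => /ltW.
  have Gx : `|G (x y)| <= e / (cw * a + 1) * `|x y|.
    have := Gd' (x y) 0 xd'; rewrite normr0 G0 !subr0; apply; exact: ltW.
  rewrite /rate normrM normfV (gtr0_norm (mulr_gt0 s0p yp)) ler_pdivrMr ?mulr_gt0//.
  apply: le_trans (ev_le _) _; apply: le_trans (ler_wpM2l cw0 Gx) _.
  have e1 : 0 <= e / (cw * a + 1) by rewrite divr_ge0// ltW.
  apply: le_trans (ler_wpM2l cw0 (ler_wpM2l e1 (x_le y yy))) _.
  rewrite (_ : cw * (e / (cw * a + 1) * (s0 * y * a)) = e * (s0 * y) * (cw * a / (cw * a + 1))); last by field; rewrite gt_eqF.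
  rewrite ger_pMr ?mulr_gt0// ler_pdivrMr// mul1r lerDl.
  exact: ler01.
- by rewrite /x mulr0 h00 /pt scale0r addr0.
- by rewrite /kp mulr0 /rate invr0 mulr0 addr0.
- split=> [t tt|t /andP[t0 t1]].
    by rewrite /kp addrC addKr; apply: rate_le; have [] := hP _ (sc t tt).
  have tt : 0 <= t <= 1 by rewrite ltW.
  have [D e] := hP _ (sc t tt).
  by apply: solves => //; rewrite mulr_gt0.
Qed.

End Contraction.

End SimpleBifurcation.

(** Bifurcation from a simple eigenvalue in the manner of Crandall and
    Rabinowitz, with the eigenvalue as parameter. The Lipschitz constant ep of G
    on a small ball is taken so small that both the contraction constant and the
    deviation of the eigenvalue are under control. *)
Lemma simple_branch (R : realType) n (L : 'M[R]_n) (kap : R) (v : 'cV[R]_n)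
    (w : 'rV[R]_n) (G : 'cV[R]_n -> 'cV[R]_n) (e : R) :
  L *m v = kap *: v -> w *m L = kap *: w -> w *m v = 1%:M ->
  L - kap%:M + v *m w \in unitmx -> G 0 = 0 ->
  (forall e : R, 0 < e -> exists2 d : R, 0 < d &
     forall X Y, `|X| <= d -> `|Y| <= d -> `|G X - G Y| <= e * `|X - Y|) ->
  0 < e -> exists (x : R -> 'cV[R]_n) (kp : R -> R),
  [/\ {within `[0, 1], continuous x}, {within `[0, 1], continuous kp},
      x 0 = 0, kp 0 = kap &
      (forall t : R, 0 <= t <= 1 -> `|kp t - kap| <= e) /\
      forall t : R, 0 < t <= 1 -> x t != 0 /\ L *m x t + G (x t) = kp t *: x t].
Proof.
move=> Lv wL wv uA G0 Glip e0.
pose K := invmx (L - kap%:M + v *m w).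
have [cw cw0 wle] : exists2 cw : R, 0 <= cw & forall X : 'cV[R]_n, `|(w *m X) 0 0| <= cw * `|X|.
  exists (n%:R * `|w|); first exact: mulr_ge0.
  by move=> X; apply: le_trans (mx_norm_mul w X); exact: mx_entry_le.
have [cK cK0 Kle] : exists2 cK : R, 0 <= cK & forall X : 'cV[R]_n, `|K *m X| <= cK * `|X|.
  by exists (n%:R * `|K|); [exact: mulr_ge0|move=> X; exact: mx_norm_mul].
have [a a0 va] : exists2 a : R, 0 < a & `|v| + 1 <= a.
  by exists (`|v| + 1) => //; rewrite ltr_wpDl.
have [C C0 CE] : exists2 C : R, 0 <= C & C = cK * (2 * cw + 1 + cw * `|v|) * a.
  exists (cK * (2 * cw + 1 + cw * `|v|) * a) => //.
  by rewrite !mulr_ge0 ?(ltW a0)// !addr_ge0 ?mulr_ge0.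
have D0 : 0 < C + cw * a + 1 by rewrite ltr_wpDl// addr_ge0// mulr_ge0// ltW.
pose m := Num.min e 2^-1.
have m0 : 0 < m by rewrite lt_min e0 invr_gt0 ltr0n.
pose ep := m / (C + cw * a + 1).
have ep0 : 0 < ep by rewrite divr_gt0.
have epm (b : R) : 0 <= b -> b <= C + cw * a + 1 -> b * ep <= m.
  by move=> b0 bD; rewrite /ep mulrCA ger_pMr// ler_pdivrMr// mul1r.
have cwa : 0 <= cw * a by rewrite mulr_ge0// ltW.
have Cep : C * ep <= m by apply: epm => //; rewrite -addrA lerDl addr_ge0.
have cep : cw * ep * a <= m by rewrite mulrAC; apply: epm => //; lra.
have [d d0 Gd] := Glip ep ep0.
have s0a : d / a * a <= d by rewrite divfK ?gt_eqF.
have s0 : 0 < d / a by rewrite divr_gt0.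
have mh : m <= 2^-1 by rewrite /m ge_min lexx orbT.
have me : m <= e by rewrite /m ge_min lexx.
have [x [kp [xc kc x0 k0 [kle sol]]]] := branch_contraction Lv wL wv uA G0 Glip wle
  Kle cw0 cK0 va ep0 d0 Gd s0a CE (le_trans Cep mh) (le_trans cep mh) (ltW s0) s0.
exists x, kp; split=> //; split=> // t tt.
by apply: le_trans (kle t tt) _; apply: le_trans cep me.
Qed.

(** * The bifurcation at the critical attention *)

Section Symmetrization.
Variables (R : realType) (N : nat) (S : R -> R).
Hypotheses (N0 : (0 < N)%N) (hS : strict1 S).

(** On the pattern (N - 1, -1, ..., -1) scaled by a, the entrywise response has
    two values; their difference is N times this number, as the difference of
    the entries of the pattern is N. *)
Definition consensus (a : R) : R := (S ((N%:R - 1) * a) - S (- a)) / N%:R.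

Lemma strict1_consensus : strict1 consensus.
Proof.
have Nn0 : N%:R != 0 :> R by rewrite pnatr_eq0 -lt0n.
have Np : 0 < N%:R :> R by rewrite ltr0n.
have N1 : 1 <= N%:R :> R by rewrite ler1n.
have [S0 h] := hS; split; first by rewrite /consensus mulr0 oppr0 subrr mul0r.
move=> e e0; have [r r0 hr] := h e e0.
exists (r / N%:R); first by rewrite divr_gt0.
have sm (b x : R) : 0 <= b <= N%:R -> `|x| <= r / N%:R -> `|b * x| <= r.
  move=> /andP[b0 bN] xr; rewrite normrM ger0_norm//.
  by apply: le_trans (ler_pM b0 (normr_ge0 x) bN xr) _; rewrite mulrC divfK.
move=> x y xr yr.
have b1 : 0 <= (N%:R - 1 : R) <= N%:R by apply/andP; split; lra.
have x1 := sm _ x b1 xr; have y1 := sm _ y b1 yr.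
have rN : r / N%:R <= r by rewrite ler_pdivrMr// ler_peMr// ltW.
have x2 : `|- x| <= r by rewrite normrN (le_trans xr).
have y2 : `|- y| <= r by rewrite normrN (le_trans yr).
have h1 := hr _ _ x1 y1; have h2 := hr _ _ x2 y2.
have d1 : `|(N%:R - 1) * x - (N%:R - 1) * y| = (N%:R - 1) * `|x - y|.
  by rewrite -mulrBr normrM ger0_norm//; case/andP: b1.
have d2 : `|- x - - y| = `|x - y| by rewrite -opprD normrN.
rewrite d1 in h1; rewrite d2 in h2.
have -> : consensus x - x - (consensus y - y) =
  ((S ((N%:R - 1) * x) - (N%:R - 1) * x - (S ((N%:R - 1) * y) - (N%:R - 1) * y)) -
   (S (- x) - - x - (S (- y) - - y))) / N%:R.
  by rewrite /consensus; field.
rewrite normrM normfV (gtr0_norm Np) ler_pdivrMr//.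
apply: le_trans (ler_normB _ _) _; apply: le_trans (lerD h1 h2) _.
by rewrite le_eqVlt; apply/orP; left; apply/eqP; ring.
Qed.

End Symmetrization.

Section AxialPattern.
Variables (R : realType) (Na No : nat).
Hypothesis No2 : (1 < No)%N.
Let No0 : (0 < No)%N. Proof. exact: ltnW. Qed.
Let i0 : 'I_No := Ordinal No0.
Let i1 : 'I_No := Ordinal No2.
Local Notation P := (P0 R No).

(** Spans the mean-zero patterns that are invariant under the permutations of
    all options but the first. *)
Definition pattern : 'rV[R]_No := No%:R *: delta_mx 0 i0 - const_mx 1.

Let Nn0 : No%:R != 0 :> R. Proof. by rewrite pnatr_eq0 -lt0n. Qed.

Lemma patternE : pattern = No%:R *: (delta_mx 0 i0 *m P).
Proof.
rewrite /P0 mulmxBr mulmx1 -scalemxAr scalerBr scalerA mulfV// scale1r.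
congr (_ - _); rewrite mulmxA; apply/matrixP => i j.
rewrite !mxE big_ord1 !mxE (bigD1 i0)//= big1 ?addr0 => [|k ki].
  by rewrite !mxE ord1 !eqxx !mul1r.
by rewrite !mxE (negPf ki) andbF mul0r.
Qed.

Lemma pattern_perp : ones_perp pattern.
Proof.
by rewrite /ones_perp /= patternE -scalemxAl -mulmxA P0_ones// mulmx0 scaler0.
Qed.

Lemma mul_pattern_neq0 (x : 'cV[R]_Na) : x != 0 -> x *m pattern != 0.
Proof.
move=> /matrix0Pn[i [j xij]]; apply/matrix0Pn; exists i, i1.
rewrite mxE big_ord1 !mxE; rewrite (ord1 j) in xij.
by rewrite (_ : i1 == i0 = false)// mulr0 sub0r mulrN1 oppr_eq0.
Qed.

(** An entrywise map keeps the columns other than the first equal to one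
    another, and after projection only the difference to the first column
    counts. *)
Lemma map_pattern (S : R -> R) (y : 'cV[R]_Na) :
  map_mx S (y *m pattern) *m P = map_mx (consensus No S) y *m pattern.
Proof.
have -> : map_mx S (y *m pattern) = map_mx (fun a => S (- a)) y *m (ones R No)^T +
    map_mx (consensus No S) y *m (No%:R *: delta_mx 0 i0).
  apply/matrixP => i j; rewrite !mxE !big_ord1 !mxE eqxx /= mulr1.
  case: (j == i0); last by rewrite mulr0 sub0r mulrN1 !mulr0 addr0.
  by rewrite !mulr1 (mulrC (y i 0)) /consensus divfK// [RHS]addrC subrK.
by rewrite mulmxDl -mulmxA ones_P0// mulmx0 add0r -mulmxA -scalemxAl -patternE.
Qed.

End AxialPattern.

Section Bifurcation.
Variables (R : realType) (Na No : nat) (S1 S2 : R -> R) (p : params R Na) (lam : R).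
Local Notation P := (P0 R No).
Local Notation E := 'M[R]_(Na, No).
Local Notation M := (pGamma p - pDelta p).
Hypotheses (No2 : (1 < No)%N) (adm : admissible p lam).
Hypotheses (hS1 : strict1 S1) (hS2 : strict1 S2).
Hypothesis simple : simple_eigenvalue M lam.

Let No0 : (0 < No)%N. Proof. exact: ltnW. Qed.
Let d0 : 0 < pd p. Proof. by have [[]] := adm. Qed.
Let Gam0 : forall i, pGamma p i i = 0. Proof. by have [_ []] := adm. Qed.
Let Del0 : forall i, pDelta p i i = 0. Proof. by have [_ []] := adm. Qed.
Let kap : R := palpha p - pbeta p + lam.
Let kap0 : 0 < kap. Proof. by have [] := adm. Qed.
Let us0 : 0 < ustar p lam. Proof. by rewrite divr_gt0. Qed.

Lemma gain_diff : gainS p - gainD p = (palpha p - pbeta p)%:M + M.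
Proof. by rewrite /gainS /gainD opprD addrACA -raddfB. Qed.

Lemma lin_ustar m (X : 'M[R]_(Na, m)) :
  lin p (ustar p lam) *m X = ustar p lam *: (M *m X - lam *: X).
Proof.
rewrite lin_mul; have -> : - pd p = - (ustar p lam * kap).
  by rewrite /ustar -/kap divfK// gt_eqF.
rewrite scalerBr addrC; congr (_ + _); rewrite scalerA -scaleNr; congr (_ *: _).
by rewrite /kap; ring.
Qed.

Lemma ker_jacobian_ustar (X : E) :
  ker_jacobian S1 S2 p (ustar p lam) X <-> V X /\ M *m X = lam *: X.
Proof.
rewrite /ker_jacobian /=; split=> -[VX].
  rewrite neutral_jacobianE// -mulmxA mulmx_P0// lin_ustar => /eqP.
  by rewrite scaler_eq0 gt_eqF//= subr_eq0 => /eqP.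
move=> MX; split=> //=.
by rewrite neutral_jacobianE// -mulmxA mulmx_P0// lin_ustar MX subrr scaler0.
Qed.

(** The invertible matrix M - lam + v w takes the value v w X both at X and at v
    w X. *)
Lemma ker_jacobianE (v : 'cV[R]_Na) : right_unit_eigenvector M lam v ->
  ker_jacobian S1 S2 p (ustar p lam) = tens_line (line v) (@ones_perp R No).
Proof.
move=> [Mv v1].
have v0 : v != 0.
  apply/eqP => v0; move: v1; rewrite v0 big1 => [/eqP|i _].
    by rewrite eq_sym oner_eq0.
  by rewrite mxE expr0n.
have [w wM wv] := left_eigenvector Mv v0 simple.
have unitA := deflated_unit Mv v0 simple wM wv.
apply/seteqP; split=> X.
  move=> /ker_jacobian_ustar[VX MX]; exists v, (w *m X); split.
  - by exists 1; rewrite scale1r.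
  - by apply/ones_perpV; exact: V_tens.
  - apply/eqP; rewrite -subr_eq0; apply/eqP.
    have Av : (M - lam%:M + v *m w) *m v = v.
      rewrite mulmxDl mulmxBl Mv mul_scalar_mx subrr add0r.
      by rewrite -mulmxA wv mulmx1.
    have AX : (M - lam%:M + v *m w) *m X = v *m (w *m X).
      by rewrite mulmxDl mulmxBl MX mul_scalar_mx subrr add0r mulmxA.
    by rewrite -[LHS](mulKmx unitA) mulmxBr AX (mulmxA _ v) Av subrr mulmx0.
move=> [x [y [[c ->] yp ->]]]; apply/ker_jacobian_ustar; split.
  by apply: V_tens; apply/ones_perpV.
by rewrite mulmxA -scalemxAr Mv scalerA mulrC -scalerA -!scalemxAl.
Qed.

(** On the states x (x) pattern the equilibrium equation becomes a nonlinear
    eigenvalue problem for x, with eigenvalue d / u; its linearization has the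
    simple eigenvalue alpha - beta + lam = d / ustar, and [simple_branch]
    applies. *)
Lemma opinion_bifurcation : opinion_forming_bifurcation No S1 S2 p (ustar p lam).
Proof.
have [_ _ [eiglam _ _] _] := adm.
have [v Mv v0] := real_eigenvector eiglam.
have [w wM wv] := left_eigenvector Mv v0 simple.
have unitA := deflated_unit Mv v0 simple wM wv.
pose e := pattern R No2.
have Ve (x : 'cV[R]_Na) : V (x *m e).
  by apply: V_tens; apply/ones_perpV; exact: pattern_perp.
have eq0 u : equilibrium S1 S2 p u (0 : E).
  split; first by apply/VP; rewrite mul0mx.
  by rewrite field_remainder// remainder0// mulmx0 !mul0mx scaler0 addr0.
split=> //.
  exists (v *m e); last exact: mul_pattern_neq0.
  by apply/ker_jacobian_ustar; split=> //; rewrite mulmxA Mv -scalemxAl.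
pose L := gainS p - gainD p.
have hc1 : strict1 (consensus No S1) := strict1_consensus No0 hS1.
have hc2 : strict1 (consensus No S2) := strict1_consensus No0 hS2.
pose G := remainder (m := 1) (consensus No S1) (consensus No S2) (gainS p) (gainD p).
have Lk : L - kap%:M = M - lam%:M.
  have -> : kap%:M = (palpha p - pbeta p)%:M + lam%:M :> 'M[R]_Na.
    by apply/matrixP => i j; rewrite !mxE mulrnDl.
  by rewrite /L gain_diff opprD addrACA subrr add0r.
have Lv : L *m v = kap *: v.
  by rewrite /L gain_diff mulmxDl mul_scalar_mx Mv -scalerDl.
have wL : w *m L = kap *: w.
  by rewrite /L gain_diff mulmxDr mul_mx_scalar wM -scalerDl.
have uA : L - kap%:M + v *m w \in unitmx by rewrite Lk.
have G0 : G 0 = 0 by exact: remainder0.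
have Glip := @remainder_lip R Na 1 _ _ (gainS p) (gainD p) hc1 hc2.
(* Within kap / 2 of kap the eigenvalue stays positive, so that u = d / kp is
   defined. *)
have kap2 : 0 < kap / 2 by rewrite divr_gt0.
have [x [kp [xc kc x0 k0 [kle sol]]]] := simple_branch Lv wL wv uA G0 Glip kap2.
have kpos t : 0 <= t <= 1 -> 0 < kp t.
  by move=> /kle; rewrite ler_norml => /andP[h _]; move: kap0 h; lra.
have itvE (t : R) : `[0, 1]%classic t -> 0 <= t <= 1 by rewrite /= in_itv.
exists (fun t => x t *m e), (fun t => pd p / kp t); split.
- apply: (@within_continuous_comp _ _ _ _ x (fun X => X *m e) _ xc).
  by move=> X _; exact: mulmxr_continuous.
- apply/subspace_continuousP => t tt; apply: cvgM; first exact: cvg_cst.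
  apply: cvgV; first by rewrite gt_eqF// kpos// itvE.
  by move/subspace_continuousP : kc; apply.
- by rewrite x0 mul0mx.
- by rewrite k0.
- move=> t /andP[t0 t1].
  have [xn0 eqn] : x t != 0 /\ L *m x t + G (x t) = kp t *: x t by apply: sol; rewrite t0.
  split; last exact: mul_pattern_neq0.
  split=> //; rewrite fieldE// mulmxDl -!scalemxAl (mulmx_P0 (Ve _)).
  rewrite /response mulmxBl !mulmxA !map_pattern -mulmxBl.
  have -> : map_mx (consensus No S1) (gainS p *m x t) -
     map_mx (consensus No S2) (gainD p *m x t) = kp t *: x t.
    by rewrite -eqn /G /remainder [RHS]addrC subrK.
  have kt : kp t != 0 by rewrite gt_eqF// kpos// (ltW t0) t1.
  rewrite -scalemxAl scalerA divfK//.
  by rewrite scaleNr addNr.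
Qed.

End Bifurcation.

(** * Limits with two clusters *)

Section RightNear.
Variable R : realType.

Lemma right_nearP (Q : R -> Prop) : (\forall t \near 0^'+, Q t) <->
  exists2 r : R, 0 < r & forall t, 0 < t < r -> Q t.
Proof.
split=> [/nbhs_ballP[r /= r0 h]|[r r0 h]].
  exists r => // t /andP[t0 tr]; apply: h => //.
  by rewrite /ball /= sub0r normrN gtr0_norm.
apply/nbhs_ballP; exists r => // t; rewrite /ball /= sub0r normrN => tr t0.
by apply: h; rewrite t0 -(gtr0_norm t0).
Qed.

End RightNear.

Section Clusters.
Variables (R : realType) (n : nat).
Implicit Types y : 'rV[R]_n.

(** A mean-zero vector has coordinates of both signs, so its norm is at most the
    largest difference of two coordinates, and up to 2 * eps this is the
    distance between the two clusters. *)
Lemma cluster_spread y (rho eps : R) j k : \sum_l y 0 l = 0 -> rho <= `|y| ->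
  (forall l, `|y 0 j - y 0 l| <= eps \/ `|y 0 k - y 0 l| <= eps) ->
  rho <= `|y 0 j - y 0 k| + 2 * eps.
Proof.
move=> sum0 ry close; apply: le_trans ry _.
have e0 : 0 <= eps by case: (close j) => h; apply: le_trans h.
have dist l m : `|y 0 l - y 0 m| <= `|y 0 j - y 0 k| + 2 * eps.
  have := close l; have := close m; move: (y 0 j) (y 0 k) (y 0 l) (y 0 m) => a b c d.
  have := ler_norm (a - b); have := ler_norm (b - a); rewrite (distrC b a).
  have := normr_ge0 (a - b).
  rewrite !ler_norml => ? ? ? [] /andP[? ?] [] /andP[? ?]; apply/andP; split; lra.
apply: mx_norm_le => [|i m]; first by rewrite addr_ge0// mulr_ge0.
rewrite (ord1 i); have [ym|ym] := leP 0 (y 0 m).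
  have [l yl] : exists l, y 0 l <= 0.
    apply: contrapT => /forallNP h; have : 0 < \sum_l y 0 l.
      rewrite (bigD1 m)//= ltr_pwDl//; first by rewrite ltNge; exact/negP.
      by rewrite sumr_ge0// => l _; rewrite ltW// ltNge; exact/negP.
    by rewrite sum0 ltxx.
  by apply: le_trans (dist m l); rewrite ger0_norm// ger0_norm; lra.
have [l yl] : exists l, 0 <= y 0 l.
  apply: contrapT => /forallNP h; have : 0 < \sum_l - y 0 l.
    rewrite (bigD1 m)//= ltr_pwDl// ?oppr_gt0// sumr_ge0// => l _.
    by rewrite oppr_ge0 ltW// ltNge; exact/negP.
  by rewrite sumrN sum0 oppr0 ltxx.
by apply: le_trans (dist l m); rewrite ltr0_norm// ger0_norm; lra.
Qed.

Variables (y : R -> 'rV[R]_n) (rho : R).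
Hypotheses (rho0 : 0 < rho)
  (ysum : forall t, 0 < t <= 1 -> \sum_l y t 0 l = 0)
  (yc : forall j, {within `]0, 1], continuous (fun t => y t 0 j)})
  (ylow : \forall t \near 0^'+, rho <= `|y t|)
  (ytriple : forall j k l (e : R), 0 < e -> \forall t \near 0^'+,
     `|(y t 0 j - y t 0 k) * (y t 0 k - y t 0 l) * (y t 0 l - y t 0 j)| <= e).

Let g j k t := `|y t 0 j - y t 0 k|.

(** If two coordinates are at least b apart, then any third one is close to one
    of them by [ytriple], and [cluster_spread] applies. Hence the distance of two
    coordinates is eventually small or almost at least rho. *)
Let gap (b eps : R) : 0 < b -> 0 < eps -> \forall t \near 0^'+,
  forall jk : 'I_n * 'I_n, b <= g jk.1 jk.2 t -> rho <= g jk.1 jk.2 t + 2 * eps.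
Proof.
move=> b0 e0.
have be : 0 < b * eps ^+ 2 by rewrite mulr_gt0// exprn_gt0.
have T : \forall t \near 0^'+, forall q : 'I_n * 'I_n * 'I_n,
    `|(y t 0 q.1.1 - y t 0 q.1.2) * (y t 0 q.1.2 - y t 0 q.2) *
      (y t 0 q.2 - y t 0 q.1.1)| <= b * eps ^+ 2.
  by apply: filter_forall => -[[j k] l]; exact: ytriple.
near=> t => -[j k] /= bg.
have t01 : 0 < t <= 1.
  by apply/andP; split; near: t; [exact: nbhs_right_gt|exact: nbhs_right_le].
have H : forall q : 'I_n * 'I_n * 'I_n,
    `|(y t 0 q.1.1 - y t 0 q.1.2) * (y t 0 q.1.2 - y t 0 q.2) *
      (y t 0 q.2 - y t 0 q.1.1)| <= b * eps ^+ 2 by near: t.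
apply: cluster_spread; [exact: ysum|by near: t|].
move=> l; have := H (j, k, l); rewrite /= !normrM => h.
have {}h : `|y t 0 k - y t 0 l| * `|y t 0 l - y t 0 j| <= eps ^+ 2.
  rewrite -(ler_pM2l b0); apply: le_trans h; rewrite -[leRHS]mulrA.
  by rewrite ler_wpM2r// mulr_ge0.
have [kl|kl] := leP `|y t 0 k - y t 0 l| eps; first by right.
left; rewrite distrC leNgt; apply/negP => lj.
by move: h; rewrite leNgt expr2 ltr_pM// ltW.
Unshelve. all: by end_near. Qed.

Let small j k := \forall t \near 0^'+, g j k t < rho / 2.

Let small_cvg j k : small j k -> forall e : R, 0 < e -> \forall t \near 0^'+, g j k t <= e.
Proof.
move=> sjk e e0; have r8 : 0 < rho / 8 by rewrite divr_gt0.
have G := gap e0 r8.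
near=> t.
have h1 : g j k t < rho / 2 by near: t.
have h2 : forall jk : 'I_n * 'I_n, e <= g jk.1 jk.2 t -> rho <= g jk.1 jk.2 t + 2 * (rho / 8).
  by near: t.
rewrite leNgt; apply/negP => /ltW/(h2 (j, k)) /=; move: rho0 h1; lra.
Unshelve. all: by end_near. Qed.

(** A continuous distance cannot cross the forbidden value rho / 2, so it is
    eventually always below or always above it. *)
Let large j k : ~ small j k -> \forall t \near 0^'+, rho / 2 < g j k t.
Proof.
move=> nsmall; have r8 : 0 < rho / 8 by rewrite divr_gt0.
have r2 : 0 < rho / 2 by rewrite divr_gt0.
have /right_nearP[r r0 hr] := gap r2 r8.
pose r1 := Num.min r 1.
have r10 : 0 < r1 by rewrite lt_min r0 ltr01.
have neq t : 0 < t < r1 -> g j k t != rho / 2.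
  rewrite lt_min => /and3P[t0 tr _]; apply/eqP => gt.
  by have := hr t _ (j, k); rewrite t0 tr /= gt => /(_ isT (lexx _)); move: rho0; lra.
have gcont : {within `]0, 1], continuous (g j k)}.
  by move=> x; apply: cvg_norm; apply: cvgB; exact: yc.
have gc (a b : R) : 0 < a -> b < r1 -> {within `[a, b], continuous (g j k)}.
  move=> a0 br; have sub : `[a, b] `<=` `]0, 1].
    move=> x /=; rewrite !in_itv /= => /andP[ax xb]; rewrite (lt_le_trans a0)//=.
    by apply: le_trans xb _; apply: ltW; apply: lt_le_trans br _; rewrite /r1 ge_min lexx orbT.
  exact: continuous_subspaceW sub gcont.
have nocross (a b : R) : 0 < a < r1 -> 0 < b < r1 -> g j k a < rho / 2 ->
    rho / 2 < g j k b -> False.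
  move=> /andP[a0 ar] /andP[b0 br] ga gb.
  have cross (a' b' : R) : a' <= b' -> 0 < a' -> b' < r1 ->
      Num.min (g j k a') (g j k b') <= rho / 2 <= Num.max (g j k a') (g j k b') -> False.
    move=> ab a0' br' mm.
    have [c] := IVT ab (gc _ _ a0' br') mm; rewrite in_itv /= => /andP[ac cb] /eqP.
    by apply/negP; apply: neq; rewrite (lt_le_trans a0')//= (le_lt_trans cb).
  have [ab|/ltW ba] := leP a b.
    by apply: (cross _ _ ab a0 br); rewrite ge_min le_max (ltW ga) (ltW gb) orbT.
  by apply: (cross _ _ ba b0 ar); rewrite ge_min le_max (ltW ga) (ltW gb) !orbT.
apply/right_nearP; exists r1 => // t tr; rewrite lt_neqAle eq_sym neq//= leNgt.
apply/negP => gt; apply: nsmall; apply/right_nearP; exists r1 => // s sr.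
rewrite lt_neqAle neq//= leNgt; apply/negP => gs; exact: nocross tr sr gt gs.
Qed.

(** The relation that the distance of two coordinates tends to 0 is an
    equivalence relation with exactly two classes: one class would contradict
    the lower bound on the norm, three the smallness of the triple products. A
    mean-zero vector that is constant on two classes of sizes k and m is
    determined up to a scalar. *)
Lemma axial_limit : exists (ax : 'rV[R]_n) (c : R -> R),
  [/\ ones_perp ax, ax != 0 &
      forall e : R, 0 < e -> \forall t \near 0^'+, `|y t - c t *: ax| <= e].
Proof.
have r8 : 0 < rho / 8 by rewrite divr_gt0.
have small_tri j k l : ~ small j k -> ~ small j l -> small k l.
  move=> jk jl; apply: contrapT => kl.
  have q0 : 0 < (rho / 2) ^+ 3 by rewrite exprn_gt0// divr_gt0.
  near ((0 : R)^'+) => t.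
  have h1 : rho / 2 < g j k t by near: t; exact: large.
  have h2 : rho / 2 < g j l t by near: t; exact: large.
  have h3 : rho / 2 < g k l t by near: t; exact: large.
  have : `|(y t 0 j - y t 0 k) * (y t 0 k - y t 0 l) * (y t 0 l - y t 0 j)| <=
      (rho / 2) ^+ 3 by near: t; exact: ytriple.
  have r2 : 0 <= rho / 2 by rewrite divr_ge0// ltW.
  have p1 := ltr_pM r2 r2 h1 h3; have p2 := ltr_pM (mulr_ge0 r2 r2) r2 p1 h2.
  rewrite !normrM (distrC (y t 0 l) (y t 0 j)) => hle.
  have := lt_le_trans p2 hle; rewrite [ltRHS](_ : _ = rho / 2 * (rho / 2) * (rho / 2)); last by ring.
  by rewrite ltxx.
have nonzero : exists t, 0 < t <= 1 /\ rho <= `|y t|.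
  near ((0 : R)^'+) => t; exists t; split; last by near: t.
  by apply/andP; split; near: t; [exact: nbhs_right_gt|exact: nbhs_right_le].
have [t0 [_ yt0]] := nonzero.
have /matrix0Pn[i0 [j0 _]] : y t0 != 0.
  by rewrite -normr_gt0 (lt_le_trans rho0).
have refl j : small j j by near=> t; rewrite /g subrr normr0 divr_gt0.
pose I := [set j : 'I_n | `[< small j0 j >]].
have Ij j : j \in I <-> small j0 j by rewrite inE; split=> [/asboolP|/asboolP].
have [j1 j1I] : exists j1, ~ small j0 j1.
  apply: contrapT => /forallNP all.
  have alls j : small j0 j by apply: contrapT; exact: all.
  have A : \forall t \near 0^'+, forall j, g j0 j t <= rho / 8.
    by apply: filter_forall => j; apply: small_cvg.
  near ((0 : R)^'+) => t.
  have At : forall j, g j0 j t <= rho / 8 by near: t.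
  have t01 : 0 < t <= 1.
    by apply/andP; split; near: t; [exact: nbhs_right_gt|exact: nbhs_right_le].
  have rt : rho <= `|y t| by near: t.
  have := @cluster_spread (y t) rho (rho / 8) j0 j0 (ysum t01) rt (fun l => or_introl (At l)).
  rewrite subrr normr0; move: rho0; lra.
pose k : R := #|I|%:R; pose m : R := n%:R - k.
have m0 : 0 < m.
  rewrite subr_gt0 ltr_nat -[X in (_ < X)%N](card_ord n) -(cardC (mem I)).
  rewrite -addn1 leq_add2l; apply/card_gt0P; exists j1.
  by apply/negP => /Ij.
pose ax : 'rV[R]_n := \row_j (if j \in I then m else - k).
have mC : #|[predC I]|%:R = m.
  by rewrite /m /k -[X in X%:R - _](card_ord n) -(cardC (mem I)) natrD addrAC subrr add0r.
have sumI (a b : R) : \sum_(j < n) (if j \in I then a else b) = k * a + m * b.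
  rewrite (bigID (mem I)) /=.
  have -> : \sum_(i < n | i \in I) (if i \in I then a else b) = k * a.
    transitivity (\sum_(i in I) a); first by apply: eq_bigr => i ->.
    by rewrite sumr_const -mulr_natl.
  have -> : \sum_(i < n | i \notin I) (if i \in I then a else b) = m * b.
    transitivity (\sum_(i in [predC I]) b).
      by apply: eq_big => [i|i /negPf ->]; rewrite ?inE.
    by rewrite sumr_const -mulr_natl mC.
  by [].
exists ax, (fun t => y t 0 j0 / m); split.
- rewrite /ones_perp /=; apply/matrixP => i j; rewrite !mxE.
  rewrite (eq_bigr (fun j => if j \in I then m else - k)) => [|l _].
    by rewrite sumI mulrN mulrC subrr.
  by rewrite !mxE mulr1.
- apply/matrix0Pn; exists 0, j0; rewrite mxE.
  by have -> : j0 \in I by [apply/Ij; exact: refl]; rewrite gt_eqF.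
(* Small enough for n * eta / m + eta <= e. *)
move=> e e0; pose eta := e / (n%:R + 1) / (1 + m^-1).
have m1 : 0 < 1 + m^-1 by rewrite addr_gt0// invr_gt0.
have n1 : 0 < n%:R + 1 :> R by rewrite ltr_wpDl.
have eta0 : 0 < eta by rewrite !divr_gt0.
pose rep j := if j \in I then j0 else j1.
have reps j : small (rep j) j.
  rewrite /rep; case: ifPn => [/Ij//|jI]; apply: (small_tri j0) => //.
  by move=> /Ij; rewrite (negPf jI).
have A : \forall t \near 0^'+, forall j, g (rep j) j t <= eta.
  by apply: filter_forall => j; apply: small_cvg.
near=> t.
have At : forall j, g (rep j) j t <= eta by near: t.
have t01 : 0 < t <= 1.
  by apply/andP; split; near: t; [exact: nbhs_right_gt|exact: nbhs_right_le].
(* The weighted sum of the two cluster values is almost the sum of all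
   coordinates, which is 0. *)
have bal : `|k * y t 0 j0 + m * y t 0 j1| <= n%:R * eta.
  have -> : k * y t 0 j0 + m * y t 0 j1 =
      \sum_j ((if j \in I then y t 0 j0 else y t 0 j1) - y t 0 j).
    by rewrite sumrB sumI (ysum t01) subr0.
  apply: le_trans (ler_norm_sum _ _ _) _.
  rewrite mulr_natl -[X in eta *+ X]card_ord -sumr_const; apply: ler_sum => j _.
  by have := At j; rewrite /g /rep; case: ifP.
have etae : eta <= e / (n%:R + 1).
  rewrite /eta ler_pdivrMr// ler_peMr ?divr_ge0 ?(ltW e0) ?(ltW n1)//.
  by rewrite lerDl invr_ge0 ltW.
have ne : n%:R * eta / m + eta <= e.
  have mi : 0 < m^-1 by rewrite invr_gt0.
  have -> : e = (n%:R + 1) * (1 + m^-1) * eta by rewrite [RHS]mulrC (mulrC (_ + 1)) mulrA divfK ?gt_eqF// divfK ?gt_eqF.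
  have nn : 0 <= n%:R :> R by [].
  have := mulr_ge0 nn (ltW eta0); have := mulr_gt0 mi eta0; lra.
apply: mx_norm_le => [|i j]; first exact: ltW.
rewrite (ord1 i) !mxE; have := At j; rewrite /g /rep; case: ifPn => jI h.
  rewrite divfK ?gt_eqF// distrC; apply: le_trans h _; apply: le_trans etae _.
  by rewrite ler_pdivrMr// ler_peMr ?(ltW e0)// lerDr.
have -> : y t 0 j - y t 0 j0 / m * - k =
   (k * y t 0 j0 + m * y t 0 j1) / m - (y t 0 j1 - y t 0 j).
  by field; rewrite gt_eqF.
apply: le_trans (ler_normB _ _) _; apply: le_trans ne; apply: lerD => //.
by rewrite normrM normfV (gtr0_norm m0) ler_pM2r ?invr_gt0.
Unshelve. all: by end_near. Qed.

End Clusters.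

(** * Tangent directions of branches *)

Definition taylor2 (R : realType) (s : R) (S : R -> R) : Prop :=
  forall e : R, 0 < e -> exists2 r : R, 0 < r &
    forall x, `|x| <= r -> `|S x - x - s / 2 * x ^+ 2| <= e * `|x| ^+ 2.

Section QuadraticRemainder.
Variables (R : realType) (n m : nat) (g1 g2 : R -> R) (A B : 'M[R]_n) (s1 s2 : R).
Hypotheses (h1 : taylor2 s1 g1) (h2 : taylor2 s2 g2).
Local Notation E := 'M[R]_(n, m).

Definition half_square (X : E) i j : R :=
  (s1 * (A *m X) i j ^+ 2 - s2 * (B *m X) i j ^+ 2) / 2.

Lemma remainder_quadratic (c e : R) : 0 < e -> 0 < c ->
  (forall X : E, `|A *m X| <= c * `|X|) -> (forall X : E, `|B *m X| <= c * `|X|) ->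
  exists2 d : R, 0 < d & forall X : E, `|X| <= d -> forall i j,
    `|remainder g1 g2 A B X i j - half_square X i j| <= e * `|X| ^+ 2.
Proof.
move=> e0 c0 Ac Bc.
have ec : 0 < e / (2 * c ^+ 2) by rewrite divr_gt0// mulr_gt0// exprn_gt0.
have [r1 r10 k1] := h1 ec; have [r2 r20 k2] := h2 ec.
exists (Num.min r1 r2 / c); first by rewrite divr_gt0// lt_min r10.
move=> X; rewrite ler_pdivlMr// le_min => /andP[X1 X2] i j.
have est (D : 'M[R]_n) (g : R -> R) (s r : R) : (forall X : E, `|D *m X| <= c * `|X|) ->
    (forall x, `|x| <= r -> `|g x - x - s / 2 * x ^+ 2| <= e / (2 * c ^+ 2) * `|x| ^+ 2) ->
    `|X| * c <= r ->
    `|g ((D *m X) i j) - (D *m X) i j - s / 2 * (D *m X) i j ^+ 2| <= e / 2 * `|X| ^+ 2.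
  move=> Dc k Xr; have le1 : `|(D *m X) i j| <= c * `|X|.
    by apply: le_trans (Dc X); exact: mx_entry_le.
  apply: le_trans (k _ _) _; first by rewrite (le_trans le1)// mulrC.
  have le2 : `|(D *m X) i j| ^+ 2 <= (c * `|X|) ^+ 2.
    by rewrite ler_pXn2r// nnegrE mulr_ge0// ltW.
  apply: le_trans (ler_wpM2l (ltW ec) le2) _.
  rewrite le_eqVlt; apply/orP; left; apply/eqP; field.
  by rewrite gt_eqF.
have e1 := est A g1 s1 r1 Ac k1 X1; have e2 := est B g2 s2 r2 Bc k2 X2.
have -> : remainder g1 g2 A B X i j - half_square X i j =
  (g1 ((A *m X) i j) - (A *m X) i j - s1 / 2 * (A *m X) i j ^+ 2) -
  (g2 ((B *m X) i j) - (B *m X) i j - s2 / 2 * (B *m X) i j ^+ 2).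
  rewrite /remainder /response /half_square mulmxBl; move: (A *m X) (B *m X) => a b.
  by rewrite !mxE; field.
apply: le_trans (ler_normB _ _) _; apply: le_trans (lerD e1 e2) _.
by rewrite -mulrDl -splitr.
Qed.

End QuadraticRemainder.

Section Tangency.
Variables (R : realType) (Na No : nat) (S1 S2 : R -> R) (p : params R Na) (lam : R).
Local Notation P := (P0 R No).
Local Notation E := 'M[R]_(Na, No).
Local Notation M := (pGamma p - pDelta p).
Hypotheses (No2 : (1 < No)%N) (adm : admissible p lam).
Hypotheses (hS1 : strict1 S1) (hS2 : strict1 S2).
Variables (s1 s2 : R).
Hypotheses (tS1 : taylor2 s1 S1) (tS2 : taylor2 s2 S2).
Variables (v : 'cV[R]_Na) (w : 'rV[R]_Na).
Hypotheses (Mv : M *m v = lam *: v) (wM : w *m M = lam *: w) (wv : w *m v = 1%:M).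
Hypothesis unitA : M - lam%:M + v *m w \in unitmx.

(** Twice the quadratic coefficient of the equation for Y = w *m Z obtained by
    projecting the equilibrium equation along v. *)
Definition quad_coef : R := \sum_i w 0 i *
  (s1 * (gainS p *m v) i 0 ^+ 2 - s2 * (gainD p *m v) i 0 ^+ 2).

Hypothesis quad0 : quad_coef != 0.

Let No0 : (0 < No)%N. Proof. exact: ltnW. Qed.
Let d0 : 0 < pd p. Proof. by have [[]] := adm. Qed.
Let Gam0 : forall i, pGamma p i i = 0. Proof. by have [_ []] := adm. Qed.
Let Del0 : forall i, pDelta p i i = 0. Proof. by have [_ []] := adm. Qed.
Let kap : R := palpha p - pbeta p + lam.
Let kap0 : 0 < kap. Proof. by have [] := adm. Qed.
Let us0 : 0 < ustar p lam. Proof. by rewrite divr_gt0. Qed.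
Local Notation rem := (remainder S1 S2 (gainS p) (gainD p)).

Variables (Z : R -> E) (ub : R -> R).
Hypothesis branch : bifurcation_branch S1 S2 p (ustar p lam) Z ub.

Let VZ t : 0 < t <= 1 -> V (Z t). Proof. by have [_ _ _ _ h] := branch => /h[[]]. Qed.
Let Zn t : 0 < t <= 1 -> 0 < `|Z t|.
Proof. by have [_ _ _ _ h] := branch => /h[_]; rewrite normr_gt0. Qed.

Let near01 : \forall t \near (0 : R)^'+, 0 < t <= 1.
Proof.
near=> t; apply/andP; split; near: t; [exact: nbhs_right_gt|exact: nbhs_right_le].
Unshelve. all: by end_near. Qed.

Let Z_small (e : R) : 0 < e -> \forall t \near 0^'+, `|Z t| <= e.
Proof.
have [zc _ z0 _ _] := branch => e0.
have [_ Z0 _] := (continuous_within_itvP Z ltr01).1 zc.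
rewrite z0 in Z0.
near=> t; rewrite -normrN -sub0r; near: t.
exact: (cvgrPdist_le _ _).1 Z0 e e0.
Unshelve. all: by end_near. Qed.

(* Shift of the eigenvalue along the branch; it tends to 0, at no known rate
   relative to Z. *)
Let shift t : R := pd p / ub t - kap.

Let shift_small (e : R) : 0 < e -> \forall t \near 0^'+, `|shift t| <= e.
Proof.
have [_ uc _ u0 _] := branch => e0.
have [_ U0 _] := (continuous_within_itvP ub ltr01).1 uc.
rewrite u0 in U0.
have : shift t @[t --> 0^'+] --> pd p / ustar p lam - kap.
  apply: cvgB; last exact: cvg_cst.
  apply: cvgM; first exact: cvg_cst.
  by apply: cvgV => //; rewrite gt_eqF.
have -> : pd p / ustar p lam - kap = 0.
  by rewrite /ustar -/kap invf_div mulrCA divff ?gt_eqF// mulr1 subrr.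
move=> s0; near=> t; rewrite -normrN -sub0r; near: t.
exact: (cvgrPdist_le _ _).1 s0 e e0.
Unshelve. all: by end_near. Qed.

Let ub_pos : \forall t \near 0^'+, 0 < ub t.
Proof.
have [_ uc _ u0 _] := branch.
have [_ U0 _] := (continuous_within_itvP ub ltr01).1 uc.
by rewrite u0 in U0; exact: (cvgr_gt _ U0 _ us0).
Qed.

Let eqn t : 0 < t <= 1 -> 0 < ub t ->
  M *m Z t - lam *: Z t = shift t *: Z t - rem (Z t) *m P.
Proof.
move=> t01 u0; have [_ _ _ _ /(_ t t01)[[_]]] := branch.
rewrite (@field_V R Na No S1 S2 p lam No0 adm (ub t) (Z t) (VZ t01)) lin_mul => + _.
move: (M *m Z t) (rem (Z t) *m P) (Z t) => X Y W h.
apply: (@scalerI _ _ (ub t)); first by rewrite gt_eqF.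
apply/eqP; rewrite -subr_eq0 -h; apply/eqP/matrixP => i j; rewrite !mxE /shift /kap.
by field; rewrite gt_eqF.
Qed.

Let Y t : 'rV[R]_No := w *m Z t.

Let proj_eqn t : 0 < t <= 1 -> 0 < ub t -> shift t *: Y t = w *m rem (Z t) *m P.
Proof.
move=> t01 u0; have := congr1 (mulmx w) (eqn t01 u0).
have -> : w *m (M *m Z t - lam *: Z t) = 0.
  by rewrite (mulmxBr w) mulmxA wM -scalemxAl -scalemxAr subrr.
rewrite (mulmxBr w) -scalemxAr mulmxA -/(Y t).
by move=> /esym/eqP; rewrite subr_eq0 => /eqP.
Qed.

(** The invertible matrix M - lam + v w maps the component of Z transverse to v
    to shift Z - rem Z P, which is o(|Z|). *)
Let transverse_small (e : R) : 0 < e -> \forall t \near 0^'+,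
  `|Z t - v *m Y t| <= e * `|Z t|.
Proof.
move=> e0; pose K := invmx (M - lam%:M + v *m w).
pose c := Na%:R * `|K| * (1 + No%:R * `|P|) + 1.
have c0 : 0 < c by rewrite ltr_wpDl// !mulr_ge0// addr_ge0// mulr_ge0.
have ec : 0 < e / c by rewrite divr_gt0.
have [d dd0 hd] := @remainder_small R Na No S1 S2 (gainS p) (gainD p) hS1 hS2 _ ec.
near=> t.
have t01 : 0 < t <= 1 by near: t.
have u0 : 0 < ub t by near: t.
have sh : `|shift t| <= e / c by near: t; exact: shift_small.
have Zd : `|Z t| <= d by near: t; exact: Z_small.
have AZ : (M - lam%:M + v *m w) *m (Z t - v *m Y t) = shift t *: Z t - rem (Z t) *m P.
  have Av : (M - lam%:M + v *m w) *m v = v.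
    by rewrite mulmxDl mulmxBl Mv mul_scalar_mx subrr add0r -mulmxA wv mulmx1.
  rewrite mulmxBr (mulmxA _ v) Av mulmxDl mulmxBl mul_scalar_mx eqn//.
  by rewrite -mulmxA addrK.
rewrite -[X in `|X|](mulKmx unitA) AZ.
apply: le_trans (mx_norm_mul _ _) _.
have h1 : `|shift t *: Z t - rem (Z t) *m P| <= (1 + No%:R * `|P|) * (e / c * `|Z t|).
  apply: le_trans (ler_normB _ _) _; rewrite mulrDl mul1r; apply: lerD.
    by rewrite normrZ ler_wpM2r.
  apply: le_trans (mx_norm_mul _ _) _; rewrite mulrAC ler_wpM2l// ?mulr_ge0//.
  exact: hd.
apply: le_trans (ler_wpM2l _ h1) _; first by rewrite mulr_ge0.
rewrite (_ : _ * (_ * (e / c * _)) =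
  e * `|Z t| * (Na%:R * `|K| * (1 + No%:R * `|P|) / c)); last by ring.
rewrite ler_piMr ?mulr_ge0 ?(ltW e0)// ler_pdivrMr// mul1r /c lerDl.
exact: ler01.
Unshelve. all: by end_near. Qed.

Let c : R := Na%:R * (`|gainS p| + `|gainD p|) + 1.
Let c0 : 0 < c. Proof. by rewrite ltr_wpDl// mulr_ge0// addr_ge0. Qed.
Let cS m (X : 'M[R]_(Na, m)) : `|gainS p *m X| <= c * `|X|.
Proof.
apply: le_trans (mx_norm_mul _ _) _; rewrite ler_wpM2r// /c mulrDr -addrA lerDl.
by rewrite addr_ge0// mulr_ge0.
Qed.
Let cD m (X : 'M[R]_(Na, m)) : `|gainD p *m X| <= c * `|X|.
Proof.
apply: le_trans (mx_norm_mul _ _) _; rewrite ler_wpM2r// /c mulrDr addrAC lerDr.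
by rewrite addr_ge0// mulr_ge0.
Qed.

Let sq_diff (D : 'M[R]_Na) t (e : R) i j : (forall m (X : 'M[R]_(Na, m)), `|D *m X| <= c * `|X|) ->
  0 <= e <= 1 -> `|Z t - v *m Y t| <= e * `|Z t| ->
  `|(D *m Z t) i j ^+ 2 - (D *m v) i 0 ^+ 2 * Y t 0 j ^+ 2| <= 3 * c ^+ 2 * e * `|Z t| ^+ 2.
Proof.
move=> Dc /andP[e0 e1] h.
have eY : (D *m v) i 0 * Y t 0 j = (D *m (v *m Y t)) i j.
  by rewrite mulmxA [RHS]mxE big_ord1.
rewrite -exprMn eY subr_sqr normrM.
have a1 : `|(D *m Z t) i j - (D *m (v *m Y t)) i j| <= c * (e * `|Z t|).
  apply: le_trans (_ : `|D *m (Z t - v *m Y t)| <= _).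
    by rewrite mulmxBr; have := mx_entry_le (D *m Z t - D *m (v *m Y t)) i j; rewrite !mxE.
  by apply: le_trans (Dc _ _) _; rewrite ler_wpM2l// ltW.
have vY : `|v *m Y t| <= 2 * `|Z t|.
  rewrite -[v *m Y t](subKr (Z t)); apply: le_trans (ler_normB _ _) _.
  have := ler_wpM2r (normr_ge0 (Z t)) e1; move: h; lra.
have a2 : `|(D *m Z t) i j + (D *m (v *m Y t)) i j| <= c * (3 * `|Z t|).
  apply: le_trans (ler_normD _ _) _.
  have b1 : `|(D *m Z t) i j| <= c * `|Z t| by apply: le_trans (Dc _ _); exact: mx_entry_le.
  have b2 : `|(D *m (v *m Y t)) i j| <= c * (2 * `|Z t|).
    apply: le_trans (mx_entry_le _ _ _) _; apply: le_trans (Dc _ _) _.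
    by rewrite ler_wpM2l// ltW.
  by apply: le_trans (lerD b1 b2) _; lra.
apply: le_trans (ler_pM _ _ a1 a2) _ => //.
by rewrite le_eqVlt; apply/orP; left; apply/eqP; ring.
Qed.

(** The reduced equation to second order: up to o(|Z|^2), the projection of the
    remainder is a multiple of the coordinatewise square of the critical mode. *)
Let reduced_quadratic (e : R) : 0 < e -> \forall t \near 0^'+, forall j,
  `|(w *m rem (Z t)) 0 j - quad_coef / 2 * Y t 0 j ^+ 2| <= e * `|Z t| ^+ 2.
Proof.
move=> e0; pose b := Na%:R * `|w| * (1 + (`|s1| + `|s2|) * (3 * c ^+ 2)) + 1.
have b0 : 0 < b.
  by rewrite ltr_wpDl// !mulr_ge0// addr_ge0// !mulr_ge0// ?addr_ge0// exprn_ge0// ltW.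
have eb : 0 < Num.min (e / b) 1 by rewrite lt_min divr_gt0//= ltr01.
set e' := Num.min (e / b) 1 in eb.
have e'1 : 0 <= e' <= 1 by rewrite (ltW eb) /e' ge_min lexx orbT.
have [d dd0 hd] := remainder_quadratic tS1 tS2 eb c0 (@cS No) (@cD No).
near=> t => j.
have Zd : `|Z t| <= d by near: t; exact: Z_small.
have tr : `|Z t - v *m Y t| <= e' * `|Z t| by near: t; exact: transverse_small.
have -> : (w *m rem (Z t)) 0 j - quad_coef / 2 * Y t 0 j ^+ 2 =
  \sum_i w 0 i * (rem (Z t) i j - (s1 * (gainS p *m v) i 0 ^+ 2
    - s2 * (gainD p *m v) i 0 ^+ 2) / 2 * Y t 0 j ^+ 2).
  rewrite mxE /quad_coef 2!mulr_suml -sumrB; apply: eq_bigr => i _; ring.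
apply: le_trans (ler_norm_sum _ _ _) _.
apply: le_trans (_ : \sum_(i < Na) `|w| * ((1 + (`|s1| + `|s2|) * (3 * c ^+ 2)) * e' * `|Z t| ^+ 2) <= _).
  apply: ler_sum => i _; rewrite normrM; apply: ler_pM => //; first exact: mx_entry_le.
  have k1 := hd _ Zd i j.
  have k2 := sq_diff i j cS e'1 tr; have k3 := sq_diff i j cD e'1 tr.
  have -> : rem (Z t) i j - (s1 * (gainS p *m v) i 0 ^+ 2
      - s2 * (gainD p *m v) i 0 ^+ 2) / 2 * Y t 0 j ^+ 2 =
    (rem (Z t) i j - half_square (gainS p) (gainD p) s1 s2 (Z t) i j) +
    (s1 / 2 * ((gainS p *m Z t) i j ^+ 2 - (gainS p *m v) i 0 ^+ 2 * Y t 0 j ^+ 2) -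
     s2 / 2 * ((gainD p *m Z t) i j ^+ 2 - (gainD p *m v) i 0 ^+ 2 * Y t 0 j ^+ 2)).
    rewrite /half_square; move: (rem (Z t) i j) ((gainS p *m Z t) i j) ((gainD p *m Z t) i j)
      ((gainS p *m v) i 0) ((gainD p *m v) i 0) (Y t 0 j) => x1 x2 x3 x4 x5 x6.
    by field.
  apply: le_trans (ler_normD _ _) _.
  rewrite (_ : (1 + _) * _ * _ = e' * `|Z t| ^+ 2 +
    (`|s1| * (3 * c ^+ 2 * e' * `|Z t| ^+ 2) + `|s2| * (3 * c ^+ 2 * e' * `|Z t| ^+ 2))); last by ring.
  apply: lerD => //; apply: le_trans (ler_normB _ _) _; rewrite !normrM.
  have half (s : R) : `|s| * `|2^-1 : R| <= `|s|.
    by rewrite ler_piMr// ger0_norm ?invr_ge0// invf_le1// ler1n.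
  by apply: lerD; apply: ler_pM; rewrite ?mulr_ge0.
rewrite sumr_const card_ord -[leLHS]mulr_natl.
pose b1 := Na%:R * `|w| * (1 + (`|s1| + `|s2|) * (3 * c ^+ 2)).
rewrite (_ : _ * (_ * (_ * _ * _)) = b1 * e' * `|Z t| ^+ 2); last by rewrite /b1; ring.
have b10 : 0 <= b1.
  by rewrite !mulr_ge0// addr_ge0// !mulr_ge0// ?addr_ge0// exprn_ge0// ltW.
have e'b : e' <= e / b by rewrite /e' ge_min lexx.
apply: ler_wpM2r; first exact: sqr_ge0.
apply: le_trans (ler_wpM2l b10 e'b) _.
rewrite mulrCA ger_pMr// ler_pdivrMr// mul1r /b -/b1 lerDl.
exact: ler01.
Unshelve. all: by end_near. Qed.

Let y t : 'rV[R]_No := `|Z t|^-1 *: Y t.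

(** The projection subtracts a constant from all coordinates. *)
Let P0_diff (x : 'rV[R]_No) j k : (x *m P) 0 j - (x *m P) 0 k = x 0 j - x 0 k.
Proof.
have h l : (x *m P) 0 l = x 0 l - No%:R^-1 * (x *m ones R No) 0 0.
  rewrite /P0 mulmxBr mulmx1 -scalemxAr mulmxA [LHS]mxE; congr (_ + _).
  by rewrite !mxE big_ord1 !mxE mulr1.
by rewrite !h; ring.
Qed.

(** Differences of the reduced equation between two options have the form
    (Y_a - Y_b) * (shift - q * (Y_a + Y_b)) = o(|Z|^2). Two such relations with
    an option in common eliminate the shift and leave q times the triple
    product. *)
Let triple j k l (e : R) : 0 < e -> \forall t \near 0^'+,
  `|(y t 0 j - y t 0 k) * (y t 0 k - y t 0 l) * (y t 0 l - y t 0 j)| <= e.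
Proof.
move=> e0; pose q := quad_coef / 2.
have q0 : 0 < `|q| by rewrite normr_gt0 mulf_neq0// invr_eq0 pnatr_eq0.
pose cw := Na%:R * `|w|.
have cw0 : 0 <= cw by rewrite mulr_ge0.
pose e' := e * `|q| / (8 * cw + 1).
have cw8 : 0 < 8 * cw + 1 by rewrite ltr_wpDl// mulr_ge0.
have e'0 : 0 < e' by rewrite divr_gt0// mulr_gt0.
near=> t.
have t01 : 0 < t <= 1 by near: t.
have u0 : 0 < ub t by near: t.
have RQ : forall j, `|(w *m rem (Z t)) 0 j - q * Y t 0 j ^+ 2| <= e' * `|Z t| ^+ 2.
  by near: t; exact: reduced_quadratic.
have N0 := Zn t01; set N := `|Z t| in N0 RQ.
have YN i : `|Y t 0 i| <= cw * N.
  by apply: le_trans (mx_entry_le _ _ _) _; exact: mx_norm_mul.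
have pair a b : `|shift t * (Y t 0 a - Y t 0 b) - q * (Y t 0 a ^+ 2 - Y t 0 b ^+ 2)| <=
    2 * e' * N ^+ 2.
  have : (shift t *: Y t) 0 a - (shift t *: Y t) 0 b =
      (w *m rem (Z t)) 0 a - (w *m rem (Z t)) 0 b.
    by rewrite proj_eqn// P0_diff.
  have sc i : (shift t *: Y t) 0 i = shift t * Y t 0 i by rewrite [LHS]mxE.
  rewrite !sc -mulrBr => ->.
  rewrite (_ : _ - _ - _ = ((w *m rem (Z t)) 0 a - q * Y t 0 a ^+ 2) -
     ((w *m rem (Z t)) 0 b - q * Y t 0 b ^+ 2)); last by ring.
  apply: le_trans (ler_normB _ _) _; apply: le_trans (lerD (RQ a) (RQ b)) _; lra.
have dY a b : `|Y t 0 a - Y t 0 b| <= 2 * cw * N.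
  apply: le_trans (ler_normB _ _) _; apply: le_trans (lerD (YN a) (YN b)) _; lra.
have key : `|q| * `|(Y t 0 j - Y t 0 k) * (Y t 0 k - Y t 0 l) * (Y t 0 l - Y t 0 j)| <=
    8 * cw * e' * N ^+ 3.
  rewrite -normrM.
  rewrite (_ : q * _ =
    (Y t 0 j - Y t 0 l) * (shift t * (Y t 0 j - Y t 0 k) - q * (Y t 0 j ^+ 2 - Y t 0 k ^+ 2)) -
    (Y t 0 j - Y t 0 k) * (shift t * (Y t 0 j - Y t 0 l) - q * (Y t 0 j ^+ 2 - Y t 0 l ^+ 2))); last first.
    by move: (Y t 0 j) (Y t 0 k) (Y t 0 l) (shift t) => a1 a2 a3 a4; ring.
  apply: le_trans (ler_normB _ _) _; rewrite (normrM (_ - _)) (normrM (_ - _)).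
  apply: le_trans (lerD (ler_pM _ _ (dY j l) (pair j k)) (ler_pM _ _ (dY j k) (pair j l))) _ => //.
  by rewrite le_eqVlt; apply/orP; left; apply/eqP; ring.
have -> : (y t 0 j - y t 0 k) * (y t 0 k - y t 0 l) * (y t 0 l - y t 0 j) =
  (Y t 0 j - Y t 0 k) * (Y t 0 k - Y t 0 l) * (Y t 0 l - Y t 0 j) / N ^+ 3.
  have sc i : y t 0 i = N^-1 * Y t 0 i by rewrite [LHS]mxE.
  by rewrite !sc; field; rewrite gt_eqF.
have N3 : 0 < N ^+ 3 by rewrite exprn_gt0.
rewrite normrM normfV (gtr0_norm N3) ler_pdivrMr// -(ler_pM2l q0).
apply: le_trans key _; rewrite [leRHS]mulrA; apply: ler_wpM2r; first exact: ltW.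
have e'E : e' * (8 * cw + 1) = e * `|q| by rewrite /e' divfK// gt_eqF.
by rewrite (mulrC `|q|) -e'E; have := e'0; lra.
Unshelve. all: by end_near. Qed.

(** By [reduced_quadratic] all coordinates of Y satisfy one quadratic equation
    up to a common constant, so any three of them have two that agree
    asymptotically. With Z = v *m Y + o(|Z|), the limit direction of Y given by
    [axial_limit] is the tangent. *)
Lemma branch_tangent : exists v_ax : 'rV[R]_No,
  [/\ ones_perp v_ax, v_ax != 0 & tangent_to_line Z (v *m v_ax)].
Proof.
have v1 : 0 < `|v|.
  rewrite normr_gt0; apply/eqP => v0; move: wv; rewrite v0 mulmx0 => /matrixP/(_ 0 0).
  by rewrite !mxE mulr1n => /eqP; rewrite eq_sym oner_eq0.
pose rho := (2 * `|v|)^-1.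
have rho0 : 0 < rho by rewrite invr_gt0 mulr_gt0.
have ysum t : 0 < t <= 1 -> \sum_l y t 0 l = 0.
  move=> t01; have : y t *m ones R No = 0.
    have zo : Z t *m ones R No = 0 by apply/VP; exact: VZ.
    by rewrite /y -scalemxAl /Y -mulmxA zo mulmx0 scaler0.
  move=> yo; transitivity ((y t *m ones R No) 0 0); last by rewrite yo mxE.
  by rewrite [RHS]mxE; apply: eq_bigr => l _; rewrite [const_mx _ _ _]mxE mulr1.
have yc j : {within `]0, 1], continuous (fun t => y t 0 j)}.
  have [zc _ _ _ _] := branch.
  have sub : `](0 : R), 1] `<=` `[(0 : R), 1].
    by move=> x /=; rewrite !in_itv /= => /andP[/ltW -> ->].
  have zc' := continuous_subspaceW sub zc.
  have -> : (fun t => y t 0 j) = (fun t => `|Z t|^-1 * \sum_i w 0 i * Z t i j).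
    by apply/funext => t; rewrite /y /Y !mxE.
  apply/subspace_continuousP => t t01.
  have t01' : 0 < t <= 1 by move: t01; rewrite /= in_itv.
  have zct := (subspace_continuousP _ _).1 zc' t t01.
  apply: cvgM.
    by apply: cvgV; [rewrite gt_eqF// Zn|exact: cvg_norm zct].
  apply: cvg_sumr => i; apply: cvgM; first exact: cvg_cst.
  exact: (mx_cvgP _ _ _).1 zct i j.
have half0 : 0 < 2^-1 :> R by rewrite invr_gt0.
have ylow : \forall t \near 0^'+, rho <= `|y t|.
  near=> t.
  have t01 : 0 < t <= 1 by near: t.
  have tr : `|Z t - v *m Y t| <= 2^-1 * `|Z t| by near: t; exact: transverse_small.
  have vY : `|Z t| <= 2 * `|v *m Y t|.
    have := ler_normD (Z t - v *m Y t) (v *m Y t); rewrite subrK; lra.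
  have := mx_norm_mul v (Y t); rewrite mul1r => vY2.
  rewrite /y normrZ normfV normr_id /rho -[leLHS]mul1r ler_pdivrMr ?mulr_gt0//.
  rewrite -mulrA ler_pdivlMl ?Zn// mulr1; lra.
have [ax [k [axp ax0 axl]]] := axial_limit rho0 ysum yc ylow triple.
exists ax; split=> //; exists (fun t => `|Z t| * k t).
apply/cvgrPdist_le => e e0.
have v1' : 0 < 1 + `|v| by rewrite addr_gt0.
have e1 : 0 < e / (1 + `|v|) by rewrite divr_gt0.
near=> t.
have t01 : 0 < t <= 1 by near: t.
have tr : `|Z t - v *m Y t| <= e / (1 + `|v|) * `|Z t| by near: t; exact: transverse_small.
have ax1 : `|y t - k t *: ax| <= e / (1 + `|v|) by near: t; exact: axl.
have N0 := Zn t01.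
rewrite sub0r normrN ger0_norm ?divr_ge0// ler_pdivrMr//.
have -> : Z t - (`|Z t| * k t) *: (v *m ax) = (Z t - v *m Y t) + `|Z t| *: (v *m (y t - k t *: ax)).
  rewrite mulmxBr scalerBr /y -!scalemxAr !scalerA divff ?gt_eqF// scale1r.
  by rewrite addrA subrK.
apply: le_trans (ler_normD _ _) _; rewrite normrZ normr_id.
have h : `|v *m (y t - k t *: ax)| <= `|v| * (e / (1 + `|v|)).
  apply: le_trans (mx_norm_mul _ _) _; rewrite mul1r; exact: ler_wpM2l.
apply: le_trans (lerD tr (ler_wpM2l (normr_ge0 _) h)) _.
rewrite le_eqVlt; apply/orP; left; apply/eqP; field.
by rewrite gt_eqF.
Unshelve. all: by end_near. Qed.

End Tangency.

(** * Continuity of the leading eigenvalue *)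

Section MatrixLimits.
Variables (R : realType) (T : Type) (F : set_system T).
Hypothesis FF : Filter F.

Lemma cvg_mulmx m n q (A : T -> 'M[R]_(m, n)) (B : T -> 'M[R]_(n, q))
    (A0 : 'M[R]_(m, n)) (B0 : 'M[R]_(n, q)) :
  A x @[x --> F] --> A0 -> B x @[x --> F] --> B0 -> A x *m B x @[x --> F] --> A0 *m B0.
Proof.
move=> /mx_cvgP Ac /mx_cvgP Bc; apply/mx_cvgP => i j.
rewrite [X in _ --> X]mxE; under eq_fun do rewrite mxE.
by apply: cvg_sumr => k; apply: cvgM.
Qed.

Lemma cvg_det n (A : T -> 'M[R]_n) (A0 : 'M[R]_n) :
  A x @[x --> F] --> A0 -> \det (A x) @[x --> F] --> \det A0.
Proof.
move=> /mx_cvgP Ac; apply: cvg_sumr => s.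
by apply: cvgM; [exact: cvg_cst|apply: cvg_prodr => i; exact: Ac].
Qed.

Lemma cvg_adj n (A : T -> 'M[R]_n) (A0 : 'M[R]_n) :
  A x @[x --> F] --> A0 -> \adj (A x) @[x --> F] --> \adj A0.
Proof.
move=> /mx_cvgP Ac; apply/mx_cvgP => i j.
rewrite [X in _ --> X]mxE; under eq_fun do rewrite mxE.
apply: cvgM; first exact: cvg_cst.
apply: cvg_det; apply/mx_cvgP => k l; rewrite !mxE; under eq_fun do rewrite !mxE.
exact: Ac.
Qed.

Lemma cvg_scalar_mx n (a : T -> R) (a0 : R) :
  a x @[x --> F] --> a0 -> ((a x)%:M : 'M[R]_n) @[x --> F] --> (a0%:M : 'M[R]_n).
Proof.
move=> ac; apply/mx_cvgP => i j; rewrite mxE; under eq_fun do rewrite mxE.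
by case: (i == j) => //=; rewrite ?mulr1n ?mulr0n//; exact: cvg_cst.
Qed.

End MatrixLimits.

Section ParamLimits.
Variables (R : realType) (n : nat).
Local Notation T := (params R n).
Variables (p0 : T).

Lemma fst_continuous (X Y : topologicalType) : continuous (@fst X Y).
Proof. by move=> [x y]; exact: cvg_fst. Qed.

Lemma snd_continuous (X Y : topologicalType) : continuous (@snd X Y).
Proof. by move=> [x y]; exact: cvg_snd. Qed.

Lemma cvg_pGamma : (@pGamma R n) @ p0 --> pGamma p0.
Proof. by apply: continuous_comp; [exact: fst_continuous|exact: snd_continuous]. Qed.

Lemma cvg_pDelta : (@pDelta R n) @ p0 --> pDelta p0.
Proof. exact: snd_continuous. Qed.

Lemma cvg_pbeta : (@pbeta R n) @ p0 --> pbeta p0.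
Proof.
apply: (@continuous_comp _ _ _ (fun p : T => p.1.1) snd); last exact: snd_continuous.
by apply: continuous_comp; exact: fst_continuous.
Qed.

Lemma cvg_palpha : (@palpha R n) @ p0 --> palpha p0.
Proof.
apply: (@continuous_comp _ _ _ (fun p : T => p.1.1.1) snd); last exact: snd_continuous.
apply: (@continuous_comp _ _ _ (fun p : T => p.1.1) fst); last exact: fst_continuous.
by apply: continuous_comp; exact: fst_continuous.
Qed.

Lemma cvg_coupling : pGamma p - pDelta p @[p --> p0] --> pGamma p0 - pDelta p0.
Proof. by apply: cvgB; [exact: cvg_pGamma|exact: cvg_pDelta]. Qed.

End ParamLimits.

Section LeadingEigenvalue.
Variables (R : realType) (n : nat).

Lemma horner_char_poly (M : 'M[R]_n) (x : R) : (char_poly M).[x] = \det (x%:M - M).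
Proof.
rewrite -[LHS]/(horner_eval x _) -det_map_mx; congr (\det _).
apply/matrixP => i j; rewrite !mxE /= /horner_eval.
by rewrite hornerD hornerN hornerC hornerMn hornerX.
Qed.

Lemma leading_root_le (M : 'M[R]_n) (lam x : R) :
  real_leading_eigenvalue M lam -> root (char_poly M) x -> x <= lam.
Proof.
by move=> [_ le _] /real_eigenvalueP/le.
Qed.

Lemma leading_unique (M : 'M[R]_n) (lam mu : R) :
  real_leading_eigenvalue M lam -> real_leading_eigenvalue M mu -> lam = mu.
Proof.
move=> hl hm; apply/le_anti/andP; split.
  by apply: leading_root_le hm _; apply/real_eigenvalueP; have [] := hl.
by apply: leading_root_le hl _; apply/real_eigenvalueP; have [] := hm.
Qed.

(** The characteristic polynomial is monic, hence positive at +oo. *)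
Lemma root_of_neg (M : 'M[R]_n) (x : R) : (char_poly M).[x] <= 0 ->
  exists2 z, x <= z & root (char_poly M) z.
Proof.
move=> neg; have l1 : 0 < lead_coef (char_poly M).
  by rewrite (monicP (char_poly_monic M)).
have [b hb] := polyrcf.poly_pinfty_gt_lc l1.
have xb : x <= Num.max x b by rewrite le_max lexx.
have [|z /andP[xz _] rz] := poly_ivt (p := char_poly M) xb; last by exists z.
by rewrite neg (le_trans (ltW l1))// hb// le_max lexx orbT.
Qed.

(** The characteristic polynomial is positive to the right of lam and has a
    simple zero at lam. *)
Lemma leading_crossing (M : 'M[R]_n) (lam e : R) : real_leading_eigenvalue M lam ->
  simple_eigenvalue M lam -> 0 < e -> exists2 x, lam - e <= x & (char_poly M).[x] < 0.
Proof.
move=> lead simple e0; have [g cg gl] := char_poly_simple simple.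
have chi_pos x : lam < x -> 0 < (char_poly M).[x].
  move=> lx; rewrite ltNge; apply/negP => /root_of_neg[z xz rz].
  by have := leading_root_le lead rz; rewrite leNgt (lt_le_trans lx).
have gc : horner g @ lam --> g.[lam] := @continuous_horner _ g lam.
have gpos : 0 < g.[lam].
  rewrite lt_neqAle eq_sym gl /= leNgt; apply/negP => gneg.
  have nb : \forall z \near lam, g.[z] < 0 by exact: (cvgr_lt _ gc _ gneg).
  have [r /= r0 hr] := (nbhs_ballP _ _).1 nb.
  have lx : lam < lam + r / 2 by rewrite ltrDl divr_gt0.
  have := chi_pos _ lx; rewrite cg hornerM hornerXsubC addrC addKr.
  rewrite pmulr_rgt0 ?divr_gt0// ltNge => /negP; apply; apply: ltW; apply: hr.
  rewrite /ball /= opprD addNKr normrN gtr0_norm ?divr_gt0//.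
  by rewrite ltr_pdivrMr// ltr_pMr// ltr1n.
have nb : \forall z \near lam, 0 < g.[z] by exact: (cvgr_gt _ gc _ gpos).
have [r /= r0 hr] := (nbhs_ballP _ _).1 nb.
pose m := Num.min r e.
have m0 : 0 < m by rewrite lt_min r0.
exists (lam - m / 2).
  rewrite lerB// ler_pdivrMr//; have : m <= e by rewrite /m ge_min lexx orbT.
  by move: e0; lra.
rewrite cg hornerM hornerXsubC addrAC subrr sub0r mulNr oppr_lt0 pmulr_rgt0 ?divr_gt0//.
apply: hr; rewrite /ball /= opprB addrCA subrr addr0 gtr0_norm ?divr_gt0//.
rewrite ltr_pdivrMr//; have : m <= r by rewrite /m ge_min lexx.
by move: r0; lra.
Qed.

(** A negative value of the characteristic polynomial at some x near lam
    persists, and by [root_of_neg] it forces a real eigenvalue beyond x. *)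
Lemma leading_lower (M : 'M[R]_n) (lam e : R) : real_leading_eigenvalue M lam ->
  simple_eigenvalue M lam -> 0 < e ->
  \forall M' \near M, forall mu, real_leading_eigenvalue M' mu -> lam - e <= mu.
Proof.
move=> lead simple e0; have [x lx neg] := leading_crossing lead simple e0.
rewrite horner_char_poly in neg.
have dc : \det (x%:M - N) @[N --> M] --> \det (x%:M - M).
  apply: (cvg_det (nbhs_filter M)); apply/(mx_cvgP (nbhs_filter M)) => i j.
  under eq_fun do rewrite !mxE; rewrite !mxE.
  apply: cvgB; first exact: cvg_cst.
  exact: (@coord_continuous R n n i j M).
near=> M' => mu lead'.
have neg' : \det (x%:M - M') < 0 by near: M'; exact: (cvgr_lt _ dc _ neg).
have [|z xz rz] := @root_of_neg M' x; first by rewrite horner_char_poly ltW.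
by apply: le_trans lx _; apply: le_trans xz _; exact: leading_root_le lead' rz.
Unshelve. all: by end_near. Qed.

(** The Lyapunov form of M at lam + e is negative definite with a gap that
    survives small perturbations, and such a form excludes a real eigenvector
    with a larger eigenvalue. *)
Lemma leading_upper (M : 'M[R]_n) (lam e : R) : real_leading_eigenvalue M lam -> 0 < e ->
  \forall M' \near M, forall mu, real_leading_eigenvalue M' mu -> mu <= lam + e.
Proof.
move=> [_ le _] e0; pose th := lam + e.
have lt mu : complex_eigenvalue M mu -> complex.Re mu < th.
  by move=> /le h; rewrite (le_lt_trans h)// ltrDl.
have [|H [c [c0 HT hH /(_ lt) Hneg]]] := @lyapunov_form R n M th.
  by move=> mu /lt h; rewrite lt_eqF.
have [cH cH0 bH] := form_bound 1 H.
pose D := cH * (n%:R + 1).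
have D0 : 0 < D by rewrite mulr_gt0// ltr_wpDl.
have id_cvg : (fun N : 'M[R]_n => N) @ M --> M by exact: cvg_id.
near=> M' => mu [ev _ _].
have dM : `|M - M'| <= c / (2 * D).
  near: M'; apply: (cvgrPdist_le _ _).1 id_cvg _ _.
  by rewrite divr_gt0// mulr_gt0.
have [x Mx x0] := real_eigenvector ev.
rewrite leNgt; apply/negP => thmu.
have h1 := hH _ x; have h2 := Hneg _ x; have h3 := form1_ge x.
have n0 : 0 < `|x| by rewrite normr_gt0.
have N2 : 0 < `|x| ^+ 2 by rewrite exprn_gt0.
have e1 : form H x (M *m x) = mu * form H x x + form H x ((M - M') *m x).
  by rewrite -formZr -Mx -formDr -mulmxDl addrC subrK.
have h4 : `|form H x ((M - M') *m x)| <= c / 2 * `|x| ^+ 2.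
  apply: le_trans (bH _ _) _; apply: le_trans (ler_wpM2l _ (mx_norm_mul _ _)) _.
    by rewrite mulr_ge0// ltW.
  apply: le_trans (_ : D * `|M - M'| * `|x| ^+ 2 <= _).
    rewrite (_ : D * _ * _ = cH * `|x| * (n%:R * `|M - M'| * `|x|) + cH * `|M - M'| * `|x| ^+ 2).
      by rewrite lerDl !mulr_ge0// ltW.
    by rewrite /D; ring.
  rewrite ler_wpM2r ?(ltW N2)//.
  apply: le_trans (ler_wpM2l (ltW D0) dM) _.
  by rewrite le_eqVlt; apply/orP; left; apply/eqP; field; rewrite gt_eqF.
have h5 : 0 <= (th - mu) * form H x x.
  rewrite nmulr_rge0 ?subr_lt0//; apply: le_trans h2 _.
  by rewrite mulNr oppr_le0 mulr_ge0 ?(ltW c0)// (le_trans _ h3)// ltW.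
have := ler_norm (form H x ((M - M') *m x)).
have := ler_wpM2l (ltW c0) h3; have := mulr_gt0 c0 N2.
by move: h1 h4 h5; rewrite e1; lra.
Unshelve. all: by end_near. Qed.

End LeadingEigenvalue.

(** * Genericity of the tangency condition *)

Section Genericity.
Variables (R : realType) (Na : nat) (s1 s2 : R).
Local Notation T := (params R Na).
Local Notation M p := (pGamma p - pDelta p).

Definition simple_params : set T :=
  [set p | exists lam, admissible p lam /\ simple_eigenvalue (M p) lam].

(** At a simple eigenvalue \adj (lam - M) is a multiple of v w, so this
    polynomial in the parameters and the eigenvalue detects the quadratic
    coefficient with no choice of eigenvectors. *)
Definition quad_test (k l : 'I_Na) (p : T) (lam : R) : R :=
  let B := \adj (lam%:M - M p) in
  \sum_i B l i * (s1 * (gainS p *m B) i k ^+ 2 - s2 * (gainD p *m B) i k ^+ 2).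

Lemma quad_testE (k l : 'I_Na) (p : T) (lam c : R) (v : 'cV[R]_Na) (w : 'rV[R]_Na) :
  \adj (lam%:M - M p) = c *: (v *m w) ->
  quad_test k l p lam = c ^+ 3 * v l 0 * w 0 k ^+ 2 * quad_coef p s1 s2 v w.
Proof.
move=> e; rewrite /quad_test e /quad_coef mulr_sumr; apply: eq_bigr => i _.
have vw a b : (c *: (v *m w)) a b = c * (v a 0 * w 0 b) by rewrite !mxE big_ord1.
have gain (D : 'M[R]_Na) : (D *m (c *: (v *m w))) i k = c * ((D *m v) i 0 * w 0 k).
  by rewrite -scalemxAr mulmxA [LHS]mxE [X in _ * X]mxE big_ord1.
by rewrite vw !gain; ring.
Qed.

Lemma cvg_quad_test (k l : 'I_Na) (p0 : T) (lam0 : R) :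
  quad_test k l q.1 q.2 @[q --> (p0, lam0)] --> quad_test k l p0 lam0.
Proof.
pose F := nbhs ((p0, lam0) : T * R).
have c1 : fst @ F --> p0 by exact: cvg_fst.
have c2 : snd @ F --> lam0 by exact: cvg_snd.
have FF : Filter F by exact: nbhs_filter.
have cM : (M q.1) @[q --> F] --> M p0 := cvg_comp fst (fun p => M p) c1 (cvg_coupling (p0 := p0)).
have cB : \adj ((q.2)%:M - M q.1) @[q --> F] --> \adj (lam0%:M - M p0).
  apply: (cvg_adj FF); apply: cvgB => //.
  exact: (cvg_scalar_mx FF).
have cG : pGamma q.1 @[q --> F] --> pGamma p0.
  exact: (cvg_comp fst (@pGamma R Na) c1 (cvg_pGamma (p0 := p0))).
have cDe : pDelta q.1 @[q --> F] --> pDelta p0.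
  exact: (cvg_comp fst (@pDelta R Na) c1 (cvg_pDelta (p0 := p0))).
have ca : palpha q.1 @[q --> F] --> palpha p0.
  exact: (cvg_comp fst (@palpha R Na) c1 (cvg_palpha (p0 := p0))).
have cb : pbeta q.1 @[q --> F] --> pbeta p0.
  exact: (cvg_comp fst (@pbeta R Na) c1 (cvg_pbeta (p0 := p0))).
have cS : gainS q.1 @[q --> F] --> gainS p0.
  by apply: cvgD; [exact: (cvg_scalar_mx FF ca)|exact: cG].
have cD : gainD q.1 @[q --> F] --> gainD p0.
  by apply: cvgD; [exact: (cvg_scalar_mx FF cb)|exact: cDe].
have entry := fun A A0 (h : A @ F --> (A0 : 'M[R]_Na)) => (mx_cvgP FF A A0).1 h.
apply: cvg_sumr => i; apply: cvgM; first exact: entry cB l i.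
have sq (D : T * R -> 'M[R]_Na) (D0 : 'M[R]_Na) : D @ F --> D0 ->
   (D q *m \adj ((q.2)%:M - M q.1)) i k ^+ 2 @[q --> F] --> (D0 *m \adj (lam0%:M - M p0)) i k ^+ 2.
  move=> Dc; have h := entry _ _ (cvg_mulmx FF Dc cB) i k.
  by apply: cvgM; exact: h.
by apply: cvgB; apply: cvgM; [exact: cvg_cst|exact: sq|exact: cvg_cst|exact: sq].
Qed.

(** The test is continuous in (p, lam), and the leading eigenvalue is continuous
    in p by [leading_lower] and [leading_upper]. *)
Lemma quad_open (p : T) (lam : R) (v : 'cV[R]_Na) (w : 'rV[R]_Na) :
  admissible p lam -> simple_eigenvalue (M p) lam ->
  M p *m v = lam *: v -> w *m M p = lam *: w -> w *m v = 1%:M ->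
  quad_coef p s1 s2 v w != 0 ->
  \forall p' \near p, forall lam' v' w',
    admissible p' lam' -> simple_eigenvalue (M p') lam' ->
    M p' *m v' = lam' *: v' -> w' *m M p' = lam' *: w' -> w' *m v' = 1%:M ->
    quad_coef p' s1 s2 v' w' != 0.
Proof.
move=> adm simple Mv wM wv q0.
have neq0 (x : 'cV[R]_Na) (y : 'rV[R]_Na) : y *m x = 1%:M -> x != 0.
  move=> yx; apply/eqP => x0; move: yx; rewrite x0 mulmx0 => /matrixP/(_ 0 0).
  by rewrite !mxE mulr1n => /eqP; rewrite eq_sym oner_eq0.
have v0 := neq0 _ _ wv.
have w0 : w != 0.
  apply/eqP => w0; move: wv; rewrite w0 mul0mx => /matrixP/(_ 0 0).
  by rewrite !mxE mulr1n => /eqP; rewrite eq_sym oner_eq0.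
have /matrix0Pn[l [a vl]] := v0; have /matrix0Pn[b [k wk]] := w0.
rewrite (ord1 a) in vl; rewrite (ord1 b) in wk.
have [c c0 adjE] := adj_rank1 Mv v0 simple wM wv.
have t0 : quad_test k l p lam != 0.
  by rewrite (quad_testE k l adjE) !mulf_neq0// expf_neq0.
have near0 : \forall q \near ((p, lam) : T * R), quad_test k l q.1 q.2 != 0.
  exact: (cvgr_neq0 _ (@cvg_quad_test k l p lam) t0).
have [[P Q] /= [nP nQ] sub] := near0.
have [e /= e0 eQ] := (nbhs_ballP _ _).1 nQ.
have [_ _ lead _] := adm.
have e2 : 0 < e / 2 by rewrite divr_gt0.
have up := leading_upper lead e2; have lo := leading_lower lead simple e2.
have up' : \forall p' \near p, forall mu, real_leading_eigenvalue (M p') mu -> mu <= lam + e / 2.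
  exact: (@cvg_coupling R Na p) up.
have lo' : \forall p' \near p, forall mu, real_leading_eigenvalue (M p') mu -> lam - e / 2 <= mu.
  exact: (@cvg_coupling R Na p) lo.
near=> p' => lam' v' w' adm' simple' Mv' wM' wv'.
have [_ _ lead' _] := adm'.
have h1 : forall mu, real_leading_eigenvalue (M p') mu -> mu <= lam + e / 2 by near: p'.
have h2 : forall mu, real_leading_eigenvalue (M p') mu -> lam - e / 2 <= mu by near: p'.
have Pp' : P p' by near: p'.
have test : quad_test k l p' lam' != 0.
  apply: (sub (p', lam')); split => //=; apply: eQ.
  rewrite /ball /= ltr_norml; have := h1 _ lead'; have := h2 _ lead'.
  by move: e0 => /=; lra.
have [c' c'0 adjE'] := adj_rank1 Mv' (neq0 _ _ wv') simple' wM' wv'.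
by apply: contraNneq test => qz; rewrite (quad_testE k l adjE') qz mulr0.
Unshelve. all: by end_near. Qed.

Hypothesis s20 : s2 != 0.

(** Changes both gains by t *: (a%:M + D), hence leaves the coupling matrix and
    its eigenvectors fixed. *)
Definition perturb (p : T) (a : R) (D : 'M[R]_Na) (t : R) : T :=
  (pd p, palpha p + t * a, pbeta p + t * a, pGamma p + t *: D, pDelta p + t *: D).

Lemma cvg_perturb (p : T) (a : R) (D : 'M[R]_Na) : perturb p a D t @[t --> (0 : R)] --> p.
Proof.
have lin0 (x y : R) : x + t * y @[t --> (0 : R)] --> x.
  have : x + t * y @[t --> (0 : R)] --> x + 0 * y.
    apply: cvgD; first exact: cvg_cst.
    by apply: cvgM; [exact: cvg_id|exact: cvg_cst].
  by rewrite mul0r addr0.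
have mx0 (X Y : 'M[R]_Na) : X + t *: Y @[t --> (0 : R)] --> X.
  by apply/mx_cvgP => i j; under eq_fun do rewrite !mxE; exact: lin0.
case: p => [[[[d al] be] Ga] De]; rewrite /perturb /pd /palpha /pbeta /pGamma /pDelta /=.
have cd : d @[t --> (0 : R)] --> d by exact: cvg_cst.
exact: (cvg_pair (cvg_pair (cvg_pair (cvg_pair cd (lin0 al a)) (lin0 be a)) (mx0 Ga D)) (mx0 De D)).
Qed.

Lemma perturb_coupling (p : T) (a t : R) (D : 'M[R]_Na) : M (perturb p a D t) = M p.
Proof. by rewrite /perturb /pGamma /pDelta /= opprD addrACA subrr addr0. Qed.

Lemma perturb_admissible (p : T) (lam a t : R) (D : 'M[R]_Na) : 0 <= a -> 0 <= t -> (forall i, D i i = 0) ->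
  admissible p lam -> admissible (perturb p a D t) lam.
Proof.
move=> a0 t0 D0 [[d0 al0] [G0 De0] lead kap0]; split.
- by split=> //; rewrite addr_ge0// mulr_ge0.
- by split=> i; rewrite /pGamma /pDelta /= !mxE D0 mulr0 addr0 ?G0 ?De0.
- by rewrite perturb_coupling.
- by rewrite /palpha /pbeta /= opprD addrACA subrr addr0.
Qed.

(** Finite differences at three equidistant points recover q2 and q1. *)
Lemma quadratic_nonvanishing (q0 q1 q2 e : R) : (q1 != 0) || (q2 != 0) -> 0 < e ->
  exists2 t, 0 < t < e & q0 + q1 * t + q2 * t ^+ 2 != 0.
Proof.
move=> nz e0; apply: contrapT => /forall2NP none.
have z t : 0 < t < e -> q0 + q1 * t + q2 * t ^+ 2 = 0.
  by move=> te; have [//|/negP/negPn/eqP] := none t.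
have [a1 a2 a3] : [/\ 0 < e / 4 < e, 0 < 2 * (e / 4) < e & 0 < 3 * (e / 4) < e].
  by split; apply/andP; split; move: e0; lra.
have z1 := z _ a1; have z2 := z _ a2; have z3 := z _ a3.
set t := e / 4 in z1 z2 z3; have t0 : t != 0 by rewrite mulf_neq0 ?gt_eqF.
have d2 : q2 * t ^+ 2 = 0 by lra.
have d1 : q1 * t = 0 by lra.
move/eqP: d2; rewrite mulf_eq0 expf_eq0 (negPf t0) andbF orbF => /eqP q20.
move/eqP: d1; rewrite mulf_eq0 (negPf t0) orbF => /eqP q10.
by move: nz; rewrite q20 q10 eqxx.
Qed.

(** Move gainS v and gainD v by t c along one coordinate i with w_i v_i != 0.
    The quadratic coefficient becomes a quadratic polynomial in t: the
    coefficient of t ^+ 2 is w_i (s1 - s2) c ^+ 2, and for s1 = s2 that of t is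
    a nonzero multiple of (gainS v - gainD v)_i = (alpha - beta + lam) v_i. *)
Lemma quad_dense (p : T) (lam : R) (v : 'cV[R]_Na) (w : 'rV[R]_Na) :
  admissible p lam -> M p *m v = lam *: v -> w *m v = 1%:M ->
  exists (a : R) (D : 'M[R]_Na), [/\ 0 <= a, forall i, D i i = 0 &
    forall e : R, 0 < e -> exists2 t, 0 < t < e &
      quad_coef (perturb p a D t) s1 s2 v w != 0].
Proof.
move=> adm Mv wv.
have [i wvi] : exists i, w 0 i * v i 0 != 0.
  apply: contrapT => /forallNP h; move: wv => /matrixP/(_ 0 0).
  rewrite !mxE mulr1n big1 => [/eqP|i _]; first by rewrite eq_sym oner_eq0.
  by have /negP/negPn/eqP := h i.
have [wi vi] : w 0 i != 0 /\ v i 0 != 0 by apply/andP; rewrite -negb_or -mulf_eq0.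
(* If v has another nonzero coordinate k, the off-diagonal entry (i, k)
   suffices; otherwise v is a multiple of a basis vector, and a common shift of
   alpha and beta does. *)
have [a [D [c [a0 D0 c0 hD]]]] : exists (a : R) (D : 'M[R]_Na) (c : R),
    [/\ 0 <= a, forall i, D i i = 0, c != 0 &
      forall j, ((a%:M + D) *m v) j 0 = c *+ (j == i)].
  have [[k [ki vk]]|none] := pselect (exists k, k != i /\ v k 0 != 0).
    exists 0, (delta_mx i k), (v k 0); split=> //.
      move=> j; rewrite mxE; have [->|//] := eqVneq j i.
      by rewrite eq_sym (negPf ki).
    move=> j; rewrite raddf0 add0r mxE (bigD1 k)//= mxE eqxx andbT.
    rewrite big1 ?addr0 => [|l lk]; last by rewrite mxE (negPf lk) andbF mul0r.
    by case: (j == i); rewrite ?mul1r ?mul0r.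
  exists 1, 0, (v i 0); split=> //; first by move=> j; rewrite mxE.
  move=> j; rewrite addr0 mul1mx; have [->//|ji] := eqVneq j i.
  by apply/eqP; apply: contrapT => /negP vj; apply: none; exists j.
exists a, D; split=> // e' e'0.
have gS t j : (gainS (perturb p a D t) *m v) j 0 = (gainS p *m v) j 0 + t * c *+ (j == i).
  rewrite -mulrnAr -hD /gainS.
  have -> : (palpha (perturb p a D t))%:M + pGamma (perturb p a D t) =
     (palpha p)%:M + pGamma p + t *: (a%:M + D).
    apply/matrixP => x y; rewrite /palpha /pGamma /= !mxE mulrnDl; ring.
  by rewrite mulmxDl -scalemxAl [LHS]mxE [X in _ + X]mxE.
have gD t j : (gainD (perturb p a D t) *m v) j 0 = (gainD p *m v) j 0 + t * c *+ (j == i).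
  rewrite -mulrnAr -hD /gainD.
  have -> : (pbeta (perturb p a D t))%:M + pDelta (perturb p a D t) =
     (pbeta p)%:M + pDelta p + t *: (a%:M + D).
    apply/matrixP => x y; rewrite /pbeta /pDelta /= !mxE mulrnDl; ring.
  by rewrite mulmxDl -scalemxAl [LHS]mxE [X in _ + X]mxE.
set A := (gainS p *m v) i 0 in gS gD; set B := (gainD p *m v) i 0 in gS gD.
have AB : A - B != 0.
  have -> : A - B = (palpha p - pbeta p + lam) * v i 0.
    have -> : A - B = ((gainS p - gainD p) *m v) i 0.
      by rewrite mulmxBl [RHS]mxE [X in _ = _ + X]mxE.
    by rewrite gain_diff mulmxDl mul_scalar_mx Mv -scalerDl mxE.
  by rewrite mulf_neq0// gt_eqF//; have [] := adm.
pose q1 := w 0 i * (2 * c * (s1 * A - s2 * B)); pose q2 := w 0 i * ((s1 - s2) * c ^+ 2).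
have qE t : quad_coef (perturb p a D t) s1 s2 v w =
    quad_coef p s1 s2 v w + q1 * t + q2 * t ^+ 2.
  rewrite /quad_coef (bigD1 i)//= [X in _ = X + _ + _](bigD1 i)//=.
  rewrite gS gD eqxx !mulr1n (eq_bigr (fun j => w 0 j *
    (s1 * (gainS p *m v) j 0 ^+ 2 - s2 * (gainD p *m v) j 0 ^+ 2))).
    rewrite -/A -/B /q1 /q2; move: (\sum_(_ | _) _) => rest; ring.
  by move=> j ji; rewrite gS gD (negPf ji) !mulr0n !addr0.
have [t te qt] : exists2 t, 0 < t < e' & quad_coef p s1 s2 v w + q1 * t + q2 * t ^+ 2 != 0.
  apply: quadratic_nonvanishing => //.
  have [s12|s12] := eqVneq s1 s2; last first.
    by apply/orP; right; rewrite !mulf_neq0 ?subr_eq0// expf_neq0.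
  apply/orP; left; rewrite /q1 s12 -mulrBr.
  by rewrite !mulf_neq0// pnatr_eq0.
by exists t => //; rewrite qE.
Qed.

Variables (No : nat) (S1 S2 : R -> R).
Hypotheses (No2 : (1 < No)%N) (hS1 : strict1 S1) (hS2 : strict1 S2)
  (tS1 : taylor2 s1 S1) (tS2 : taylor2 s2 S2).

(** Parameters with nonzero quadratic coefficient are dense by [quad_dense],
    interior to the set of good ones by [quad_open], and good by
    [branch_tangent]. *)
Lemma generic_tangency : generically simple_params
  [set p | forall lam v, admissible p lam -> right_unit_eigenvector (M p) lam v ->
      forall Zb ub, bifurcation_branch (No := No) S1 S2 p (ustar p lam) Zb ub ->
        exists v_ax : 'rV[R]_No,
          [/\ ones_perp v_ax, v_ax != 0 & tangent_to_line Zb (v *m v_ax)]].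
Proof.
set good := [set p | _].
pose U := interior (~` simple_params `|` good).
have unit_neq0 (v : 'cV[R]_Na) (m : 'M[R]_Na) lam : right_unit_eigenvector m lam v -> v != 0.
  move=> [_ v1]; apply/eqP => v0; move: v1; rewrite v0 big1 => [/eqP|i _].
    by rewrite eq_sym oner_eq0.
  by rewrite mxE expr0n.
have quad_good p lam v w : admissible p lam -> simple_eigenvalue (M p) lam ->
    M p *m v = lam *: v -> w *m M p = lam *: w -> w *m v = 1%:M ->
    quad_coef p s1 s2 v w != 0 -> U p.
  move=> adm simple Mv wM wv q0.
  have near0 := quad_open adm simple Mv wM wv q0.
  rewrite /U /interior; near=> p'.
  have [[lam0 [adm0 simple0]]|] := pselect (simple_params p'); last by left.
  right => lam' v' adm' ev' Zb ub br.
  have hl : lam0 = lam'.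
    by have [_ _ l0 _] := adm0; have [_ _ l' _] := adm'; exact: leading_unique l0 l'.
  subst lam0; have v'0 := unit_neq0 _ _ _ ev'; have [Mv' _] := ev'.
  have [w' wM' wv'] := left_eigenvector Mv' v'0 simple0.
  have q'0 : quad_coef p' s1 s2 v' w' != 0.
    have H : forall lam' v' w',
      admissible p' lam' -> simple_eigenvalue (M p') lam' ->
      M p' *m v' = lam' *: v' -> w' *m M p' = lam' *: w' -> w' *m v' = 1%:M ->
      quad_coef p' s1 s2 v' w' != 0 by near: p'.
    exact: H adm' simple0 Mv' wM' wv'.
  have uA := deflated_unit Mv' v'0 simple0 wM' wv'.
  exact: (branch_tangent No2 adm' hS1 hS2 tS1 tS2 Mv' wM' wv' uA q'0 br).
exists U; split; first exact: open_interior.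
  move=> p [lam [adm simple]] W nW.
  have [_ _ [eiglam _ _] _] := adm.
  have [v Mv v0] := real_eigenvector eiglam.
  have [w wM wv] := left_eigenvector Mv v0 simple.
  have [a [D [a0 D0 dense]]] := quad_dense adm Mv wv.
  have nW0 : nbhs (0 : R) [set t | W (perturb p a D t)] := @cvg_perturb p a D W nW.
  have [e /= e0 he] := (nbhs_ballP _ _).1 nW0.
  have [t /andP[t0 te] qt] := dense e e0.
  exists (perturb p a D t); split; last first.
    by apply: he; rewrite /ball /= sub0r normrN gtr0_norm.
  have adm' := perturb_admissible a0 (ltW t0) D0 adm.
  have Mp := perturb_coupling p a t D.
  split; first by exists lam; rewrite Mp.
  by apply: (quad_good _ lam v w) => //; rewrite Mp.
move=> p [[lam [adm simple]] /interior_subset[]//].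
by case; exists lam.
Unshelve. all: by end_near. Qed.

End Genericity.

(** * Stability, bifurcation and generic tangency *)

Theorem mainTheorem1 (R : realType) (Na No : nat) (k11 k12 k21 k22 : R)
    (S1 S2 : R -> R) (hNo : (2 <= No)%N)
    (hS1 : sigmoid k11 k12 S1) (hS2 : sigmoid k21 k22 S2) :
  (forall (p : params R Na) (lam : R), admissible p lam ->
    [/\ (forall u : R, 0 < u < ustar p lam -> loc_exp_stable No S1 S2 p u),
        (forall u : R, ustar p lam < u -> unstable No S1 S2 p u) &
        simple_eigenvalue (pGamma p - pDelta p) lam ->
        opinion_forming_bifurcation No S1 S2 p (ustar p lam) /\
        (forall v, right_unit_eigenvector (pGamma p - pDelta p) lam v ->
          ker_jacobian S1 S2 p (ustar p lam)
            = tens_line (line v) (@ones_perp R No))])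
  /\
  generically
    [set p : params R Na | exists lam,
      admissible p lam /\ simple_eigenvalue (pGamma p - pDelta p) lam]
    [set p | forall lam v,
      admissible p lam ->
      right_unit_eigenvector (pGamma p - pDelta p) lam v ->
      forall Zb ub,
        bifurcation_branch (No := No) S1 S2 p (ustar p lam) Zb ub ->
        exists v_ax : 'rV[R]_No,
          [/\ ones_perp v_ax, v_ax != 0 & tangent_to_line Zb (v *m v_ax)]].
Proof.
have No0 : (0 < No)%N by exact: ltnW.
have st1 := sigmoid_strict1 hS1; have st2 := sigmoid_strict1 hS2.
split; last first.
  have [_ _ _ _ [_ _ _ [c2 _]]] := hS2.
  exact: (generic_tangency Na c2 hNo st1 st2 (sigmoid_taylor2 hS1) (sigmoid_taylor2 hS2)).
move=> p lam adm; have [[d0 _] [G0 D0] _ _] := adm.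
split=> [u|u|simple].
- exact: (stable_below No0 adm st1 st2).
- apply: (unstable_above No0 adm st1 st2 hNo) => u' Z0.
  pose k := Num.max (k11 + k12) (k21 + k22).
  apply: (global_solution (k := k) No0 d0 G0 D0).
  + by move=> x; rewrite (le_trans (sigmoid_bounded hS1 x))// le_max lexx.
  + by move=> x; rewrite (le_trans (sigmoid_bounded hS2 x))// le_max lexx orbT.
  + by move=> K; exact: sigmoid_lip hS1 K.
  + by move=> K; exact: sigmoid_lip hS2 K.
- split; first exact: (opinion_bifurcation hNo adm st1 st2 simple).
  by move=> v; exact: (ker_jacobianE hNo adm st1 st2 simple).
Qed.
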